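(* Let $G$ be a group with a finitely generated abelian normal subgroup $A$ such that $\beta=G/A$ is a $PD_2^+$-group. Then the canonical projection from $G$ to $\beta$ has a section (i.e., there is a homomorphism $\beta\to G$ whose composite with the projection is $id_\beta$) if and only if $$G^{ab}\cong A/[G,A]\oplus\beta^{ab}.$$
   Context: A $PD_2^+$-group is a group isomorphic to the fundamental group of an orientable aspherical closed connected surface. $G^{ab}=G/G'$ is the abelianization of $G$, and $[G,A]$ is the subgroup generated by the commutators $[g,a]$ with $g\in G$ and $a\in A$. *)

(* Defs.v *)
From HB Require Import structures.
From mathcomp Require Import all_boot all_order all_algebra.
From mathcomp Require Import all_classical all_reals all_analysis.
From mathcomp Require Import homotopy.
From mathcomp Require Import lra.
Import Order.TTheory GRing.Theory Num.Theory.
Import numFieldNormedType.Exports.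

Set Implicit Arguments.
Unset Strict Implicit.
Unset Printing Implicit Defensive.

Local Open Scope classical_set_scope.
Local Open Scope quotient_scope.

Local Open Scope group_scope.

HB.mixin Record isConjClosed (G : groupType) (S : {pred G}) := {
  gpredJr : forall x y : G, x \in S -> x ^ y \in S
}.

#[short(type="normalSubgroup")]
HB.structure Definition NormalSubgroup (G : groupType) :=
  {S of GroupClosed G S & isConjClosed G S}.

Definition isomorphic (G H : groupType) : Prop :=
  exists f : {multiplicative G -> H}, bijective f.

Section QuotientGroup.
Variables (G : groupType) (N : normalSubgroup G).

Definition coset_rel : rel G := fun x y => x^-1 * y \in N.

Lemma coset_rel_refl : reflexive coset_rel.
Proof. by move=> x; rewrite /coset_rel mulVg gpred1. Qed.

Lemma coset_rel_sym : symmetric coset_rel.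
Proof. by move=> x y; rewrite /coset_rel -gpredV invgM invgK. Qed.

Lemma coset_rel_trans : transitive coset_rel.
Proof.
move=> y x z xy yz; rewrite /coset_rel.
by rewrite -[z](mulKg y^-1) invgK mulgA gpredM// -?mulgA ?mulKg.
Qed.

Definition coset_equiv :=
  EquivRel coset_rel coset_rel_refl coset_rel_sym coset_rel_trans.

Definition quotient_group : Type := {eq_quot coset_equiv}.

HB.instance Definition _ := EqQuotient.on quotient_group.
HB.instance Definition _ := Choice.on quotient_group.

Definition quotient_one : quotient_group := \pi_quotient_group 1.
Definition quotient_mul (a b : quotient_group) : quotient_group :=
  \pi_quotient_group (repr a * repr b).
Definition quotient_inv (a : quotient_group) : quotient_group :=
  \pi_quotient_group (repr a)^-1.

Lemma eq_coset (x y : G) :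
  (\pi_quotient_group x = \pi_quotient_group y) <-> x^-1 * y \in N.
Proof. exact: (rwP (@eqmodP _ _ x y)). Qed.

Lemma quotient_mulE (x y : G) :
  quotient_mul (\pi_quotient_group x) (\pi_quotient_group y) = \pi_quotient_group (x * y).
Proof.
apply/eq_coset; have /eq_coset hx := reprK (\pi_quotient_group x).
have /eq_coset hy := reprK (\pi_quotient_group y).
rewrite invgM; set a := repr _ in hx *; set b := repr _ in hy *.
have -> : b^-1 * a^-1 * (x * y) = (a^-1 * x) ^ b * (b^-1 * y).
  by rewrite /conjg !mulgA mulgK.
by apply: gpredM => //; exact: gpredJr.
Qed.

Lemma quotient_invE (x : G) :
  quotient_inv (\pi_quotient_group x) = \pi_quotient_group x^-1.
Proof.
apply/eq_coset; have /eq_coset hx := reprK (\pi_quotient_group x).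
set a := repr _ in hx *; rewrite invgK.
have -> : a * x^-1 = ((a^-1 * x)^-1) ^ a^-1.
  by rewrite /conjg !invgM !invgK !mulgA mulgK.
by apply: gpredJr; rewrite gpredV.
Qed.

Lemma quotient_mulA : associative quotient_mul.
Proof.
move=> a b c; rewrite -[a]reprK -[b]reprK -[c]reprK.
rewrite (quotient_mulE (repr b) (repr c)) (quotient_mulE (repr a) (repr b)).
by rewrite !quotient_mulE mulgA.
Qed.

Lemma quotient_mul1 : left_id quotient_one quotient_mul.
Proof. by move=> a; rewrite -[a]reprK quotient_mulE mul1g. Qed.

Lemma quotient_1mul : right_id quotient_one quotient_mul.
Proof. by move=> a; rewrite -[a]reprK quotient_mulE mulg1. Qed.

Lemma quotient_mulV : left_inverse quotient_one quotient_inv quotient_mul.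
Proof. by move=> a; rewrite -[a]reprK quotient_invE quotient_mulE mulVg. Qed.

Lemma quotient_Vmul : right_inverse quotient_one quotient_inv quotient_mul.
Proof. by move=> a; rewrite -[a]reprK quotient_invE quotient_mulE mulgV. Qed.

HB.instance Definition _ := isGroup.Build quotient_group
  quotient_mulA quotient_mul1 quotient_1mul quotient_mulV quotient_Vmul.

Definition quotient_proj (x : G) : quotient_group := \pi_quotient_group x.

Lemma quotient_projM : {morph quotient_proj : x y / x * y}.
Proof. by move=> x y; rewrite [RHS]quotient_mulE. Qed.

HB.instance Definition _ :=
  isMultiplicative.Build G quotient_group quotient_proj quotient_projM.

End QuotientGroup.

Section Generated.
Variable G : groupType.

Definition generated (S : set G) : {pred G} := fun x =>
  `[< forall H : {pred G}, group_closed H -> S `<=` [set` H] -> x \in H >].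

Lemma mem_generated (S : set G) : S `<=` [set` generated S].
Proof. by move=> x Sx; apply/asboolP => H _; exact. Qed.

Lemma generated_min (S : set G) (H : {pred G}) : group_closed H ->
  S `<=` [set` H] -> {subset generated S <= H}.
Proof. by move=> gH SH x /asboolP; exact. Qed.

Lemma generated_group_closed (S : set G) : group_closed (generated S).
Proof.
split=> [|x y /asboolP Sx /asboolP Sy]; first by apply/asboolP => H [].
by apply/asboolP => H gH SH; apply: gH.2; [exact: Sx|exact: Sy].
Qed.

HB.instance Definition _ (S : set G) := isMulClosed.Build G (generated S)
  (group_closedM (generated_group_closed S)).
HB.instance Definition _ (S : set G) := isMul1Closed.Build G (generated S)
  (generated_group_closed S).1.
HB.instance Definition _ (S : set G) := isInvClosed.Build G (generated S)
  (group_closedV (generated_group_closed S)).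

Definition finitely_generated (A : {pred G}) : Prop :=
  exists s : seq G, A =i generated [set` s].

(* The subgroup [G, B]. *)
Definition commutators_with (B : {pred G}) : {pred G} :=
  generated [set [~ g, b] | g in [set: G] & b in [set` B]].

HB.instance Definition _ (B : {pred G}) :=
  GroupClosed.copy (commutators_with B)
    (generated [set [~ g, b] | g in [set: G] & b in [set` B]]).

Lemma commutators_withJ (B : {pred G}) (x y : G) :
  x \in commutators_with B -> x ^ y \in commutators_with B.
Proof.
pose H : {pred G} := fun z => z ^ y \in commutators_with B.
have HE z : (z \in H) = (z ^ y \in commutators_with B) by [].
rewrite -HE; apply: generated_min => [|_ [g _ [b Bb <-]]] /=.
  split=> [|u v]; rewrite !HE ?conj1g ?gpred1//.
  by rewrite conjMg conjVg => Hu Hv; rewrite gpredM// gpredV.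
rewrite HE.
have -> : [~ g, b] ^ y = [~ g * y, b] * [~ y, b]^-1.
  rewrite /commg /conjg !invgM !invgK !mulgA.
  by rewrite -!mulgA !(mulKg, mulVKg, mulVg, mulgV, mulg1).
rewrite gpredM ?gpredV//; apply: mem_generated.
  by exists (g * y) => //; exists b.
by exists y => //; exists b.
Qed.

HB.instance Definition _ (B : {pred G}) :=
  isConjClosed.Build G (commutators_with B) (@commutators_withJ B).

Definition abelianization : groupType :=
  quotient_group (commutators_with [pred _ : G | true]).

End Generated.

Section Subgroup.
Variables (G : groupType) (A : groupClosed G).

Definition subgroup : Type := {x : G | x \in A}.

HB.instance Definition _ := SubChoice.on subgroup.

Lemma subgroup_closed : group_closed (fun x => x \in A).
Proof. by split=> [|x y]; [exact: gpred1|exact: gpredF]. Qed.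

HB.instance Definition _ :=
  SubChoice_isSubGroup.Build G _ subgroup subgroup_closed.

(* For N contained in A, this is N viewed as a subgroup of A. *)
Definition restrict (N : {pred G}) : {pred subgroup} :=
  fun x => val x \in N.

Section Normal.
Variable N : normalSubgroup G.

Lemma restrict_group_closed : group_closed (restrict N).
Proof.
split=> [|x y Nx Ny]; rewrite unfold_in; first exact: gpred1.
exact: (@gpredF G N).
Qed.

Lemma restrictJ (x y : subgroup) : x \in restrict N -> x ^ y \in restrict N.
Proof. exact: (@gpredJr G N). Qed.

HB.instance Definition _ := isMulClosed.Build subgroup (restrict N)
  (group_closedM restrict_group_closed).
HB.instance Definition _ := isMul1Closed.Build subgroup (restrict N)
  restrict_group_closed.1.
HB.instance Definition _ := isInvClosed.Build subgroup (restrict N)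
  (group_closedV restrict_group_closed).
HB.instance Definition _ := isConjClosed.Build subgroup (restrict N) restrictJ.

End Normal.
End Subgroup.
Arguments restrict {G} A N.

(* The group A / [G, A]. *)
Definition coinvariants (G : groupType) (A : groupClosed G) : groupType :=
  quotient_group (restrict A (commutators_with A)).

Local Open Scope ring_scope.

Section UnitInterval.
Variable R : realType.

Definition unit_interval : Type := `[0 : R, 1]%classic.

HB.instance Definition _ := Topological.on unit_interval.

Lemma clamp_subproof (x : R) :
  Num.max 0 (Num.min 1 x) \in (`[0 : R, 1]%classic : set R).
Proof.
by rewrite inE /= in_itv/= le_max lexx ge_max ler01 ge_min lexx.
Qed.

Definition clamp (x : R) : unit_interval := 
  exist (fun x => x \in (`[0 : R, 1]%classic : set R)) _ (clamp_subproof x).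

Definition uval : unit_interval -> R := set_val.

Lemma uval_itv t : 0 <= uval t <= 1.
Proof. by have /= := set_valP t; rewrite in_itv. Qed.

Lemma clampE x : uval (clamp x) = Num.max 0 (Num.min 1 x).
Proof. by []. Qed.

Lemma uval_inj : injective uval. Proof. exact: val_inj. Qed.

Lemma uvalK : cancel uval clamp.
Proof.
move=> t; apply: uval_inj; rewrite clampE.
by have /andP[t0 t1] := uval_itv t; rewrite (min_r t1) (max_r t0).
Qed.

Lemma clampK x : 0 <= x <= 1 -> uval (clamp x) = x.
Proof. by move=> /andP[t0 t1]; rewrite clampE (min_r t1) (max_r t0). Qed.

Lemma clamp_le0 x : x <= 0 -> clamp x = clamp 0.
Proof.
move=> x0; apply: uval_inj; rewrite !clampE (min_r ler01) maxxx.
by rewrite (min_r (le_trans x0 ler01)) (max_l x0).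
Qed.

Lemma clamp_ge1 x : 1 <= x -> clamp x = clamp 1.
Proof. by move=> x1; apply: uval_inj; rewrite !clampE (min_l x1) minxx. Qed.

Lemma unit_interval_neq : clamp 0 != clamp 1.
Proof.
apply/eqP => /(congr1 uval); rewrite !clampK ?lexx ?ler01// => /esym/eqP.
by rewrite oner_eq0.
Qed.

HB.instance Definition _ := isBiPointed.Build unit_interval unit_interval_neq.

Lemma uval0 : uval zero = 0. Proof. by rewrite clampK// lexx ler01. Qed.
Lemma uval1 : uval one = 1. Proof. by rewrite clampK// lexx ler01. Qed.

Lemma uval_continuous : continuous uval.
Proof. exact: initial_continuous. Qed.

Lemma clamp_continuous : continuous clamp.
Proof.
apply: continuous_comp_initial => x.
apply: continuous_max; first exact: cst_continuous.
by apply: continuous_min; [exact: cst_continuous|exact: cvg_id].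
Qed.

Lemma pasting (T X : topologicalType) (u : T -> R) (f g : T -> X) (a : R) :
  continuous u -> continuous f -> continuous g ->
  (forall t, u t = a -> f t = g t) ->
  continuous (fun t => if u t <= a then f t else g t).
Proof.
move=> uc fc gc fg; apply/continuous_subspace_setT.
have -> : [set: T] = (u @^-1` [set x | x <= a]) `|` (u @^-1` [set x | a <= x]).
  by apply/seteqP; split=> // t _; have /orP[] := le_total (u t) a; [left|right].
apply: withinU_continuous.
- by apply: closed_comp => [? _|]; [exact: uc|exact: closed_le].
- by apply: closed_comp => [? _|]; [exact: uc|exact: closed_ge].
- apply: (@subspace_eq_continuous _ _ _ f); last exact: continuous_subspaceT.
  by move=> t; rewrite inE /preimage /= => tA; rewrite /from_subspace tA.
- apply: (@subspace_eq_continuous _ _ _ g); last exact: continuous_subspaceT.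
  move=> t; rewrite inE /preimage /= => at_; rewrite /from_subspace; case: ifPn => // ta; apply/esym/fg.
  by apply/eqP; rewrite eq_le ta.
Qed.

End UnitInterval.
Arguments uval {R}.
Arguments clamp {R}.

Section ContinuityHelpers.
Variables (R : realType) (S T U : topologicalType).

Lemma ccomp (f : S -> T) (g : T -> U) :
  continuous f -> continuous g -> continuous (fun x => g (f x)).
Proof. by move=> fc gc x; apply: continuous_comp; [exact: fc|exact: gc]. Qed.

Lemma cpair (f : S -> T) (g : S -> U) :
  continuous f -> continuous g -> continuous (fun x => (f x, g x)).
Proof. by move=> fc gc x; apply: cvg_pair; [exact: fc|exact: gc]. Qed.

Lemma cfst : continuous (@fst S T). Proof. by move=> x; exact: cvg_fst. Qed.

Lemma csnd : continuous (@snd S T). Proof. by move=> x; exact: cvg_snd. Qed.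

Lemma caddr (f g : S -> R) :
  continuous f -> continuous g -> continuous (fun x => f x + g x).
Proof. by move=> fc gc x; apply: cvgD; [exact: fc|exact: gc]. Qed.

Lemma cmulr (f g : S -> R) :
  continuous f -> continuous g -> continuous (fun x => f x * g x).
Proof. by move=> fc gc x; apply: cvgM; [exact: fc|exact: gc]. Qed.

Lemma ccst (x : T) : continuous (fun _ : S => x).
Proof. exact: cst_continuous. Qed.

Lemma caffine (a b : R) (f : S -> R) :
  continuous f -> continuous (fun x => a * f x + b).
Proof.
by move=> fc x; apply: cvgD; [apply: cvgMr; exact: fc|exact: cvg_cst].
Qed.

Lemma cmin (f g : S -> R) : continuous f -> continuous g ->
  continuous (fun x => Num.min (f x) (g x)).
Proof. by move=> fc gc x; apply: continuous_min; [exact: fc|exact: gc]. Qed.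

Lemma cmax (f g : S -> R) : continuous f -> continuous g ->
  continuous (fun x => Num.max (f x) (g x)).
Proof. by move=> fc gc x; apply: continuous_max; [exact: fc|exact: gc]. Qed.

End ContinuityHelpers.

Section FundamentalGroup.
Variables (R : realType) (X : topologicalType) (x : X).
Local Notation I := (unit_interval R).

Definition loop : Type := {path I from x to x in X}.

HB.instance Definition _ := Choice.on loop.

Implicit Types p q r : loop.

(* The homotopy parameter is the first coordinate; endpoints stay fixed. *)
Definition homotopic p q : Prop :=
  exists H : I * I -> X, [/\ continuous H,
    forall t, H (zero, t) = p t, forall t, H (one, t) = q t,
    forall s, H (s, zero) = x & forall s, H (s, one) = x].

Definition concat (f g : I -> X) : I -> X := fun t =>
  if uval t <= 2^-1 then f (clamp (2 * uval t)) else g (clamp (2 * uval t - 1)).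

Lemma loop_continuous p : continuous (p : I -> X).
Proof. exact: cts_fun. Qed.

Lemma clampS (a b : R) : continuous (fun t : I => clamp (a * uval t + b)).
Proof.
apply: ccomp (@clamp_continuous R).
by apply: caffine; exact: uval_continuous.
Qed.

Lemma clamp_double : continuous (fun t : I => clamp (2 * uval t)).
Proof. by have := @clampS 2 0; under eq_fun do rewrite addr0. Qed.

Lemma half_lt1 : (2^-1 : R) < 1. Proof. by rewrite invf_lt1 ?ltr1n. Qed.

Lemma concat0 p q : concat p q zero = x.
Proof. by rewrite /concat uval0 invr_ge0 ler0n mulr0 -/(@zero I) path_zero. Qed.

Lemma concat1 p q : concat p q one = x.
Proof.
rewrite /concat uval1 leNgt half_lt1/= mulr1.
have -> : 2 - 1 = 1 :> R by rewrite -[2]/(1 + 1) addrK.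
by rewrite -/(@one I) path_one.
Qed.

Lemma half_double (a : R) : a = 2^-1 -> 2 * a = 1.
Proof. by move=> ->; rewrite divff// pnatr_eq0. Qed.

Lemma concat_continuous p q : continuous (concat p q).
Proof.
apply: pasting; first exact: uval_continuous.
- exact: ccomp clamp_double (@loop_continuous p).
- exact: ccomp (@clampS 2 (-1)) (@loop_continuous q).
move=> t /half_double ->; rewrite subrr -/(@zero I) -/(@one I).
by rewrite path_zero path_one.
Qed.

Definition loop_mul p q : loop :=
  mk_path (@concat_continuous p q) (concat0 p q) (concat1 p q).

Lemma loop_mulE p q t : loop_mul p q t =
  if uval t <= 2^-1 then p (clamp (2 * uval t)) else q (clamp (2 * uval t - 1)).
Proof. by []. Qed.

Definition reverse (f : I -> X) : I -> X := fun t => f (clamp (1 - uval t)).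

Lemma reverse_continuous p : continuous (reverse p).
Proof.
apply: ccomp (@loop_continuous p).
by have := @clampS (-1) 1; under eq_fun do rewrite mulN1r addrC.
Qed.

Lemma reverse0 p : reverse p zero = x.
Proof. by rewrite /reverse uval0 subr0 -/(@one I) path_one. Qed.

Lemma reverse1 p : reverse p one = x.
Proof. by rewrite /reverse uval1 subrr -/(@zero I) path_zero. Qed.

Definition loop_inv p : loop :=
  mk_path (@reverse_continuous p) (reverse0 p) (reverse1 p).

Lemma loop_invE p t : loop_inv p t = p (clamp (1 - uval t)).
Proof. by []. Qed.

Definition loop_one : loop := cst x.

Lemma homotopic_refl p : homotopic p p.
Proof.
exists (p \o snd); split=> //= [|_|_]; rewrite ?path_zero ?path_one//.
exact: ccomp (@csnd _ _) (@loop_continuous p).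
Qed.

Lemma homotopic_sym p q : homotopic p q -> homotopic q p.
Proof.
move=> [H [Hc H0 H1 Hl Hr]].
exists (fun st => H (clamp (1 - uval st.1), st.2)); split=> //= [|t|t].
- apply: ccomp Hc; apply: cpair; last exact: csnd.
  apply: (ccomp (@cfst _ _) (g := fun s => clamp (1 - uval s))).
  by have := @clampS (-1) 1; under eq_fun do rewrite mulN1r addrC.
- by rewrite uval0 subr0 -/(@one I).
- by rewrite uval1 subrr -/(@zero I).
Qed.

Lemma clampS_fst (a b : R) :
  continuous (fun st : I * I => (clamp (a * uval st.1 + b), st.2)).
Proof.
apply: cpair; last exact: csnd.
exact: (ccomp (@cfst I I) (@clampS a b)).
Qed.

Lemma clampS_snd (a b : R) :
  continuous (fun st : I * I => (st.1, clamp (a * uval st.2 + b))).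
Proof.
apply: cpair; first exact: cfst.
exact: (ccomp (@csnd I I) (@clampS a b)).
Qed.

Lemma homotopic_trans q p r : homotopic p q -> homotopic q r -> homotopic p r.
Proof.
move=> [H [Hc H0 H1 Hl Hr]] [K [Kc K0 K1 Kl Kr]].
exists (fun st => if uval st.1 <= 2^-1 then H (clamp (2 * uval st.1 + 0), st.2)
                  else K (clamp (2 * uval st.1 + -1), st.2)).
split=> /= [|t|t|s|s].
- apply: (pasting (u := fun st : I * I => uval st.1)).
  + exact: ccomp (@cfst _ _) (@uval_continuous R).
  + exact: ccomp (@clampS_fst 2 0) Hc.
  + exact: ccomp (@clampS_fst 2 (-1)) Kc.
  move=> st /half_double ->; rewrite addr0 subrr -/(@zero I) -/(@one I).
  by rewrite H1 K0.
- by rewrite uval0 invr_ge0 ler0n mulr0 addr0 -/(@zero I) H0.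
- rewrite uval1 leNgt half_lt1/= mulr1.
  have -> : 2 - 1 = 1 :> R by rewrite -[2]/(1 + 1) addrK.
  by rewrite -/(@one I) K1.
- by case: ifP.
- by case: ifP.
Qed.

Definition homotopic_rel : rel loop := fun p q => `[< homotopic p q >].

Lemma homotopic_rel_refl : reflexive homotopic_rel.
Proof. by move=> p; apply/asboolP/homotopic_refl. Qed.

Lemma homotopic_rel_sym : symmetric homotopic_rel.
Proof.
by move=> p q; apply: asbool_equiv_eq; split; exact: homotopic_sym.
Qed.

Lemma homotopic_rel_trans : transitive homotopic_rel.
Proof.
move=> q p r /asboolP pq /asboolP qr; apply/asboolP.
exact: homotopic_trans pq qr.
Qed.

Definition homotopic_equiv := EquivRel homotopic_rel
  homotopic_rel_refl homotopic_rel_sym homotopic_rel_trans.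

Definition pi1 : Type := {eq_quot homotopic_equiv}.

HB.instance Definition _ := EqQuotient.on pi1.
HB.instance Definition _ := Choice.on pi1.

Lemma eq_pi1 p q : \pi_pi1 p = \pi_pi1 q <-> homotopic p q.
Proof.
split=> [/eqmodP/asboolP//|pq]; apply/eqmodP; exact/asboolP.
Qed.

(* Two reparametrizations of one loop are homotopic, by straight lines. *)
Lemma homotopic_reparam p (u v : loop) (phi psi : R -> R) :
  continuous phi -> continuous psi -> phi 0 = psi 0 -> phi 1 = psi 1 ->
  (forall t : I, u t = p (clamp (phi (uval t)))) ->
  (forall t : I, v t = p (clamp (psi (uval t)))) ->
  homotopic u v.
Proof.
move=> phic psic e0 e1 uE vE.
exists (fun st => p (clamp ((1 - uval st.1) * phi (uval st.2) +
                            uval st.1 * psi (uval st.2)))).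
have lin (s y : R) : (1 - s) * y + s * y = y by rewrite -mulrDl subrK mul1r.
have c1 : continuous (fun st : I * I => uval st.1).
  exact: ccomp (@cfst _ _) (@uval_continuous R).
have c2 : continuous (fun st : I * I => uval st.2).
  exact: ccomp (@csnd _ _) (@uval_continuous R).
split=> /= [|t|t|s|s].
- apply: ccomp (@loop_continuous p); apply: ccomp (@clamp_continuous R).
  apply: caddr; apply: cmulr; [|exact: ccomp c2 phic|exact: c1|
    exact: ccomp c2 psic].
  by have := @caffine R _ (-1) 1 _ c1; under eq_fun do rewrite mulN1r addrC.
- by rewrite uval0 subr0 mul1r mul0r addr0 -uE.
- by rewrite uval1 subrr mul1r mul0r add0r -vE.
- by rewrite uval0 e0 lin -[X in psi X]uval0 -vE path_zero.
- by rewrite uval1 e1 lin -[X in psi X]uval1 -vE path_one.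
Qed.

Lemma loop_mul_homotopic p p' q q' :
  homotopic p p' -> homotopic q q' -> homotopic (loop_mul p q) (loop_mul p' q').
Proof.
move=> [H [Hc H0 H1 Hl Hr]] [K [Kc K0 K1 Kl Kr]].
exists (fun st => if uval st.2 <= 2^-1 then H (st.1, clamp (2 * uval st.2 + 0))
                  else K (st.1, clamp (2 * uval st.2 + -1))).
split=> /= [|t|t|s|s].
- apply: (pasting (u := fun st : I * I => uval st.2)).
  + exact: ccomp (@csnd _ _) (@uval_continuous R).
  + exact: ccomp (@clampS_snd 2 0) Hc.
  + exact: ccomp (@clampS_snd 2 (-1)) Kc.
  move=> st /half_double ->; rewrite addr0 subrr -/(@zero I) -/(@one I).
  by rewrite Hr Kl.
- by rewrite addr0 H0 K0.
- by rewrite addr0 H1 K1.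
- by rewrite uval0 invr_ge0 ler0n mulr0 addr0 -/(@zero I) Hl.
- rewrite uval1 leNgt half_lt1/= mulr1.
  have -> : 2 - 1 = 1 :> R by rewrite -[2]/(1 + 1) addrK.
  by rewrite -/(@one I) Kr.
Qed.

Lemma reverse_homotopic p q :
  homotopic p q -> homotopic (loop_inv p) (loop_inv q).
Proof.
move=> [H [Hc H0 H1 Hl Hr]].
exists (fun st => H (st.1, clamp (-1 * uval st.2 + 1))).
split=> /= [|t|t|s|s].
- exact: ccomp (@clampS_snd (-1) 1) Hc.
- by rewrite H0 mulN1r addrC.
- by rewrite H1 mulN1r addrC.
- by rewrite uval0 mulr0 add0r -/(@one I) Hr.
- by rewrite uval1 mulr1 addNr -/(@zero I) Hl.
Qed.

Definition pi1_one : pi1 := \pi_pi1 loop_one.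
Definition pi1_mul (a b : pi1) : pi1 := \pi_pi1 (loop_mul (repr a) (repr b)).
Definition pi1_inv (a : pi1) : pi1 := \pi_pi1 (loop_inv (repr a)).

Lemma repr_pi1 p : homotopic (repr (\pi_pi1 p)) p.
Proof. by apply/eq_pi1; rewrite reprK. Qed.

Lemma pi1_mulE p q : pi1_mul (\pi_pi1 p) (\pi_pi1 q) = \pi_pi1 (loop_mul p q).
Proof. by apply/eq_pi1/loop_mul_homotopic; exact: repr_pi1. Qed.

Lemma pi1_invE p : pi1_inv (\pi_pi1 p) = \pi_pi1 (loop_inv p).
Proof. by apply/eq_pi1/reverse_homotopic; exact: repr_pi1. Qed.


Lemma loop_mulA_homotopic p q r :
  homotopic (loop_mul p (loop_mul q r)) (loop_mul (loop_mul p q) r).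
Proof.
pose phi (t : R) :=
  Num.min (2 * t + 0) (Num.min (1 * t + 4^-1) (2^-1 * t + 2^-1)).
have phiE t : phi t = if t <= 4^-1 then 2 * t else
    if t <= 2^-1 then t + 4^-1 else 2^-1 * t + 2^-1.
  rewrite /phi; case: (leP (1 * t + 4^-1)) => h1; case: (leP (2 * t + 0)) => h2;
  by case: (leP t 4^-1) => h3; case: (leP t 2^-1) => h4; lra.
apply/homotopic_sym/(@homotopic_reparam (loop_mul p (loop_mul q r)) _ _
  phi idfun).
- have cid : continuous (fun t : R => t) by move=> t; exact: cvg_id.
  by apply: cmin; [exact: caffine|apply: cmin; exact: caffine].
- by move=> t; exact: cvg_id.
- by rewrite phiE/=; do ?[case: leP => ?]; lra.
- by rewrite phiE/=; do ?[case: leP => ?]; lra.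
- move=> t; have := uval_itv t; rewrite !loop_mulE.
  move: (uval t) => {}t /andP[t0 t1].
  have ph01 : 0 <= phi t <= 1.
    rewrite phiE; apply/andP; split; case: (leP t 4^-1) => ?;
    by case: (leP t 2^-1) => ?; lra.
  rewrite (clampK ph01) phiE; case: (leP t 4^-1) => t4.
    have t2 : t <= 2^-1 by lra.
    have e1 : 0 <= 2 * t <= 1 by apply/andP; split; lra.
    have t42 : 2 * t <= 2^-1 by lra.
    by rewrite t2 clampK// t42.
  case: (leP t 2^-1) => t2.
    have e1 : 0 <= 2 * t <= 1 by apply/andP; split; lra.
    have e2 : 0 <= 2 * (t + 4^-1) - 1 <= 1 by apply/andP; split; lra.
    have f1 : (2 * t <= 2^-1) = false by apply/negbTE; rewrite -ltNge; lra.
    have f2 : (t + 4^-1 <= 2^-1) = false by apply/negbTE; rewrite -ltNge; lra.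
    have f3 : 2 * (t + 4^-1) - 1 <= 2^-1 by lra.
    rewrite (clampK e1) (clampK e2) f1 f2 f3.
    by congr (q (clamp _)); lra.
  have e2 : 0 <= 2 * (2^-1 * t + 2^-1) - 1 <= 1 by apply/andP; split; lra.
  have f2 : (2^-1 * t + 2^-1 <= 2^-1) = false.
    by apply/negbTE; rewrite -ltNge; lra.
  have f3 : (2 * (2^-1 * t + 2^-1) - 1 <= 2^-1) = false.
    by apply/negbTE; rewrite -ltNge; lra.
  rewrite (clampK e2) f2 f3.
  by congr (r (clamp _)); lra.
- by move=> t; rewrite /= uvalK.
Qed.

Lemma loop_1mul_homotopic p : homotopic (loop_mul loop_one p) p.
Proof.
apply: (@homotopic_reparam p _ _ (fun t => Num.max 0 (2 * t + -1)) idfun).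
- apply: cmax; first exact: cst_continuous.
  by apply: caffine => u; exact: cvg_id.
- by move=> t; exact: cvg_id.
- by rewrite /=; case: leP => ?; lra.
- by rewrite /=; case: leP => ?; lra.
- move=> t; rewrite loop_mulE; case: (leP _ 2^-1) => t2.
    rewrite max_l; last by lra.
    by rewrite -/(@zero I) path_zero.
  by rewrite max_r//; lra.
- by move=> t; rewrite /= uvalK.
Qed.

Lemma loop_mul1_homotopic p : homotopic (loop_mul p loop_one) p.
Proof.
apply: (@homotopic_reparam p _ _ (fun t => Num.min 1 (2 * t + 0)) idfun).
- apply: cmin; first exact: cst_continuous.
  by apply: caffine => u; exact: cvg_id.
- by move=> t; exact: cvg_id.
- by rewrite /=; case: leP => ?; lra.
- by rewrite /=; case: leP => ?; lra.
- move=> t; rewrite loop_mulE; case: (leP _ 2^-1) => t2.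
    by rewrite addr0 min_r//; lra.
  rewrite min_l; last by lra.
  by rewrite -/(@one I) path_one.
- by move=> t; rewrite /= uvalK.
Qed.

Lemma loop_Vmul_homotopic p : homotopic (loop_mul (loop_inv p) p) loop_one.
Proof.
apply: (@homotopic_reparam p _ _
  (fun t => Num.max (-2 * t + 1) (2 * t + -1)) (fun=> 1)).
- have cid : continuous (fun t : R => t) by move=> t; exact: cvg_id.
  by apply: cmax; exact: caffine.
- by move=> t; exact: cvg_cst.
- by rewrite /=; case: leP => ?; lra.
- by rewrite /=; case: leP => ?; lra.
- move=> t; have := uval_itv t; rewrite loop_mulE loop_invE => /andP[t0 t1].
  case: (leP _ 2^-1) => t2.
    rewrite max_l; last by lra.
    rewrite clampK; last by apply/andP; split; lra.
    by congr (p (clamp _)); lra.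
  by rewrite max_r//; lra.
- by move=> t; rewrite -/(@one I) path_one.
Qed.

Lemma loop_mulV_homotopic p : homotopic (loop_mul p (loop_inv p)) loop_one.
Proof.
apply: (@homotopic_reparam p _ _
  (fun t => Num.min (2 * t + 0) (-2 * t + 2)) (fun=> 0)).
- have cid : continuous (fun t : R => t) by move=> t; exact: cvg_id.
  by apply: cmin; exact: caffine.
- by move=> t; exact: cvg_cst.
- by rewrite /=; case: leP => ?; lra.
- by rewrite /=; case: leP => ?; lra.
- move=> t; have := uval_itv t; rewrite loop_mulE loop_invE => /andP[t0 t1].
  case: (leP _ 2^-1) => t2.
    by rewrite addr0 min_l//; lra.
  rewrite min_r; last by lra.
  rewrite clampK; last by apply/andP; split; lra.
  by congr (p (clamp _)); lra.
- by move=> t; rewrite -/(@zero I) path_zero.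
Qed.

Lemma pi1_mulA : associative pi1_mul.
Proof.
move=> a b c; rewrite -[a]reprK -[b]reprK -[c]reprK.
rewrite (pi1_mulE (repr b) (repr c)) (pi1_mulE (repr a) (repr b)).
by rewrite !pi1_mulE; apply/eq_pi1/loop_mulA_homotopic.
Qed.

Lemma pi1_1mul : left_id pi1_one pi1_mul.
Proof.
move=> a; rewrite -[a]reprK pi1_mulE.
by apply/eq_pi1/loop_1mul_homotopic.
Qed.

Lemma pi1_mul1 : right_id pi1_one pi1_mul.
Proof.
move=> a; rewrite -[a]reprK pi1_mulE.
by apply/eq_pi1/loop_mul1_homotopic.
Qed.

Lemma pi1_Vmul : left_inverse pi1_one pi1_inv pi1_mul.
Proof.
move=> a; rewrite -[a]reprK pi1_invE pi1_mulE.
by apply/eq_pi1/loop_Vmul_homotopic.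
Qed.

Lemma pi1_mulV : right_inverse pi1_one pi1_inv pi1_mul.
Proof.
move=> a; rewrite -[a]reprK pi1_invE pi1_mulE.
by apply/eq_pi1/loop_mulV_homotopic.
Qed.

HB.instance Definition _ := isGroup.Build pi1
  pi1_mulA pi1_1mul pi1_mul1 pi1_Vmul pi1_mulV.

End FundamentalGroup.
Arguments pi1 R {X} x.

Section Surfaces.
Variable R : realType.
Local Notation I := (unit_interval R).

Record chart (S : topologicalType) : Type := Chart {
  chart_dom : set S;
  chart_map : S -> R * R;
  chart_inv : R * R -> S;
  chart_dom_open : open chart_dom;
  chart_img_open : open (chart_map @` chart_dom);
  chart_map_continuous : {within chart_dom, continuous chart_map};
  chart_inv_continuous :
    {within chart_map @` chart_dom, continuous chart_inv};
  chart_mapK : forall x, chart_dom x -> chart_inv (chart_map x) = x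
}.

Definition is_atlas (S : topologicalType) (A : set (chart S)) : Prop :=
  forall x : S, exists2 c, A c & chart_dom c x.

(* No boundary charts are allowed, so compactness makes the surface closed. *)
Definition closed_surface (S : topologicalType) : Prop :=
  [/\ hausdorff_space S, @second_countable S, compact [set: S]
    & is_atlas [set: chart S]].

Definition polar (z : R * R) (r t : R) : R * R :=
  (z.1 + r * cos t, z.2 + r * sin t).

(* The map f, defined near z, has local degree +1 at z: the image under f of
   every small counterclockwise circle around z has winding number +1 around
   f z, where theta is a continuous choice of the angle along that image. *)
Definition orientation_preserving_at (f : R * R -> R * R) (z : R * R) : Prop :=
  \forall r \near 0^'+, exists theta rho : R -> R,
    [/\ {within `[0, 2 * pi], continuous theta},
        theta (2 * pi) = theta 0 + 2 * pi
      & forall t, t \in `[0, 2 * pi] ->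
          0 < rho t /\ f (polar z r t) = polar (f z) (rho t) (theta t)].

Definition orientable (S : topologicalType) : Prop :=
  exists2 A : set (chart S), is_atlas A &
    forall c d, A c -> A d -> forall x, chart_dom c x -> chart_dom d x ->
      orientation_preserving_at (chart_map d \o chart_inv c) (chart_map c x).

Definition cube (n : nat) : topologicalType := {ptws 'I_n -> I}.

Definition cube_boundary (n : nat) : set (cube n) :=
  [set t | exists i : 'I_n, t i = zero \/ t i = one].

(* The n-th homotopy group of X at x vanishes. *)
Definition homotopy_group_trivial (X : topologicalType) (x : X) (n : nat) :
    Prop :=
  forall f : cube n -> X, continuous f ->
    (forall t, cube_boundary t -> f t = x) ->
    exists H : I * cube n -> X, [/\ continuous H,
      forall t, H (zero, t) = f t, forall t, H (one, t) = x
      & forall s t, cube_boundary t -> H (s, t) = x].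

(* Used for connected X. *)
Definition aspherical (X : topologicalType) : Prop :=
  forall (x : X) (n : nat), (2 <= n)%N -> homotopy_group_trivial x n.

Definition PD2plus_group (B : groupType) : Prop :=
  exists (S : topologicalType) (x : S),
    [/\ closed_surface S, connected [set: S], orientable S, aspherical S
      & isomorphic B (pi1 R x)].

End Surfaces.

(* Main.v *)
(** A flat cochain on a surface [S] with values in a group [H] is a map
    [f : S * S -> H] such that [f x y * f y z = f x z] near the diagonal. It has
    a holonomy along every path, hence induces a morphism from the fundamental
    group to [H]; it replaces a cocycle on a triangulation. Short paths define
    a flat cochain [g] with values in [beta] whose holonomy is the identity, and
    a flat lift of [g] to [G] yields a section of [G -> beta].

    Proceeding box by box, [g] lifts to [G] with finitely many singularities,
    each having a residue in [A]. Residues can be moved along paths, which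
    conjugates them by the holonomy, so that they can be gathered at one point.
    Since the residues of a cochain with values in an abelian group sum to zero
    on a closed oriented surface, the residue left over is trivial in the
    abelianization of [G]. Moving [a] around a loop of holonomy [proj g] changes
    it by the commutator of [g] and [a], so a residue in [[G, A]] can be killed.
    Hence a section exists as soon as [A] and [G'] meet in [[G, A]], that is when
    [A/[G, A] -> G^ab] is injective. An isomorphism of [G^ab] with
    [A/[G, A] + beta^ab] forces this: modulo each [n > 0] all these groups are
    finite, so by counting each kernel element is divisible by every [n], and
    a finitely generated abelian group has no nonzero infinitely divisible
    element. *)
Require Import Defs.
From HB Require Import structures.
From mathcomp Require Import all_boot all_order all_algebra.
From mathcomp Require Import all_classical all_reals all_analysis.
From mathcomp Require Import homotopy.
From mathcomp Require Import lra.
Import Order.TTheory GRing.Theory Num.Theory.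
Import numFieldNormedType.Exports.

Set Implicit Arguments.
Unset Strict Implicit.
Unset Printing Implicit Defensive.

Local Open Scope classical_set_scope.
Local Open Scope ring_scope.

(** * Flat cochains and their potentials *)

(** The surface is known through charts only, so the substitute for a triangulation has to be local:
    a flat cochain counts through its germ along the diagonal, and cochains are built by cutting and
    pasting such germs over boxes in charts. The orientation serves to make the residue independent
    of the chart. Residues of a lift live in a system of local coefficients, since beta acts on A.
    Local gauges reduce every local question to the abelian case, and composing with G -> G^ab makes
    the total residue available globally. The given isomorphism of abelian groups is abstract and
    need not be compatible with A/[G, A] -> G^ab, hence the detour through counting; it uses finite
    generation of beta, which is read off a finite cover by boxes. Conversely, a section s gives g
    |-> g s(proj g)^-1, which becomes a morphism modulo [G, A] and splits the abelianization. *)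

Lemma connected_loc (T : topologicalType) (X : set T) (P : T -> Prop) :
  connected X ->
  (forall z, X z -> exists2 W, nbhs z W &
     forall x, W x -> X x -> (P x <-> P z)) ->
  forall a, X a -> P a -> forall x, X x -> P x.
Proof.
move=> cX loc a Xa Pa.
(* A property that propagates from each of its points to nearby points of [X] is relatively open.
   This is applied to [P] and to its negation, so that [P] is also relatively closed. *)
have op (Q : T -> Prop) : (forall z, X z -> Q z -> exists2 W, nbhs z W &
     forall x, W x -> X x -> Q x) ->
   X `&` Q = X `&` [set x | X x -> Q x]°.
  move=> locQ; apply/seteqP; split=> x [Xx].
    move=> Qx; split=> //; have [W Wx WQ] := locQ _ Xx Qx.
    exact: filterS Wx.
  by move=> /nbhs_singleton Qx; split=> //; exact: Qx.
have eqP : X `&` P = X.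
  apply: cX; first by exists a.
  - exists ([set x | X x -> P x]°); first exact: open_interior.
    apply: op => z Xz Pz; have [W Wz WP] := loc _ Xz; exists W => // x Wx Xx.
    by apply/(WP _ Wx Xx).
  - exists (~` [set x | X x -> ~ P x]°).
      by apply: open_closedC; exact: open_interior.
    have /seteqP[e1 e2] : X `&` (fun x => ~ P x) = X `&` [set x | X x -> ~ P x]°.
      apply: op => z Xz Pz; have [W Wz WP] := loc _ Xz; exists W => // x Wx Xx.
      by move/(WP _ Wx Xx).
    apply/seteqP; split=> x [Xx].
      by move=> Px; split=> // /(conj Xx)/e2[].
    move=> nP; split=> //; apply: contrapT => NP; apply: nP.
    by apply: (e1 x _).2; split.
by move=> x; rewrite -eqP => -[].
Qed.

Lemma connected_const (T : topologicalType) (X : set T) (Y : Type) (u : T -> Y) :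
  connected X ->
  (forall z, X z -> exists2 W, nbhs z W & forall x, W x -> X x -> u x = u z) ->
  forall a b, X a -> X b -> u a = u b.
Proof.
move=> cX loc a b Xa Xb; apply/esym.
apply: (connected_loc (P := fun x => u x = u a) cX _ Xa (erefl _) Xb).
move=> z Xz; have [W Wz Wu] := loc _ Xz; exists W => // x Wx Xx.
by rewrite (Wu _ Wx Xx).
Qed.

Lemma connectedX (T U : topologicalType) (X : set T) (Y : set U) :
  connected X -> connected Y -> connected (X `*` Y).
Proof.
move=> cX cY B [[a b] Bab] [C oC BC] [D cD BD].
have [Xa Yb] : (X `*` Y) (a, b) by move: Bab; rewrite BC => -[].
have loc (z : T * U) : (X `*` Y) z -> exists2 W, nbhs z W &
     forall x, W x -> (X `*` Y) x -> (B x <-> B z).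
  move=> XYz; have [Bz|Bz] := pselect (B z).
    exists C => [|x Cx Xx]; first by apply: open_nbhs_nbhs; split=> //; move: Bz; rewrite BC => -[].
    by split=> // _; rewrite BC.
  exists (~` D) => [|x Dx Xx].
    apply: open_nbhs_nbhs; split; first exact: closed_openC.
    by move=> Dz; apply: Bz; rewrite BD.
  by split=> //; rewrite BD => -[].
apply/seteqP; split; first by rewrite BC => x [].
move=> [x y] [/= Xx Yy].
have Bxb : B (x, b).
  apply: (connected_loc (P := fun t => B (t, b)) cX _ Xa Bab Xx) => z Xz.
  have [W [[W1 W2] /= [W1z W2b] WW] WB] := loc (z, b) (conj Xz Yb).
  exists W1 => // t W1t Xt; apply: WB => //; apply: WW; split=> //=.
  exact: nbhs_singleton.
apply: (connected_loc (P := fun t => B (x, t)) cY _ Yb Bxb Yy) => z Yz.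
have [W [[W1 W2] /= [W1z W2b] WW] WB] := loc (x, z) (conj Xx Yz).
exists W2 => // t W1t Xt; apply: WB => //; apply: WW; split=> //=.
exact: nbhs_singleton.
Qed.

Section Flat.
Local Open Scope group_scope.
Variables (T : topologicalType) (H : groupType).
Implicit Types (f : T -> T -> H) (u : T -> H) (X Y : set T).

(* Only the germ of [f] along the diagonal matters. *)
Definition flat f (z : T) := exists2 W, nbhs z W &
  forall x y w, W x -> W y -> W w -> f x y * f y w = f x w.

(** A primitive of [f] on [X]. The formula is required for nearby pairs only, because [f] carries no
    information away from the diagonal. *)
Definition potential X f u := forall z : T, X z -> exists2 W, nbhs z W &
  forall x y, W x -> X x -> W y -> X y -> f x y = u x / u y.

Lemma potential_sub X Y f u : Y `<=` X -> potential X f u -> potential Y f u.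
Proof.
move=> YX fu z /YX Xz; have [W Wz Wf] := fu z Xz; exists W => // x y Wx Yx Wy Yy.
by apply: Wf => //; exact: YX.
Qed.

Lemma potential_mulr X f u c :
  potential X f u -> potential X f (fun x => u x * c).
Proof.
move=> fu z /fu[W Wz Wf]; exists W => // x y Wx Xx Wy Xy.
by rewrite (Wf x y)// mulgKA.
Qed.

(** The ratio [u x / u y] is invariant under right multiplication of [u] by a constant, and this is
    the only freedom: [(u x)^-1 * v x] is locally constant. *)
Lemma potential_unique X f u v : connected X ->
  potential X f u -> potential X f v ->
  forall a b, X a -> X b -> (u a)^-1 * v a = (u b)^-1 * v b.
Proof.
move=> cX fu fv; apply: connected_const => // z Xz.
have [W Wz Wu] := fu z Xz; have [W' Wz' Wv] := fv z Xz.
exists (W `&` W') => [|x [Wx Wx'] Xx]; first exact: filterI.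
have : u x / u z = v x / v z.
  by rewrite -(Wu x z)// ?(Wv x z)//; exact: nbhs_singleton.
move=> /(congr1 (fun t => (u x)^-1 * t * v z)).
by rewrite mulKg -mulgA mulgVK => ->.
Qed.

Lemma flat1 f z : flat f z -> exists2 W, nbhs z W &
  forall x y, W x -> W y -> f x x = 1 /\ f x y = (f y x)^-1.
Proof.
move=> [W Wz Wf]; exists W => // x y Wx Wy.
have fxx t : W t -> f t t = 1.
  by move=> Wt; apply: (mulgI (f t t)); rewrite Wf// mulg1.
split; first exact: fxx.
by apply/eqP; rewrite -mulg_eq1 Wf// fxx.
Qed.

(** After a right multiplication [v] agrees with [u] at one common point, hence on the whole
    connected intersection. Closedness gives a point of one piece only a neighbourhood that misses
    the other piece. *)
Lemma glue_potential X Y f u v : closed X -> closed Y ->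
  X `&` Y !=set0 -> connected (X `&` Y) ->
  (forall z, X z -> Y z -> flat f z) ->
  potential X f u -> potential Y f v ->
  exists w, potential (X `|` Y) f w.
Proof.
move=> clX clY [a [Xa Ya]] cXY flf fu fv.
pose c := (v a)^-1 * u a.
have {}fv := potential_mulr c fv.
set v' := fun x => v x * c in fv.
have uv x : X x -> Y x -> u x = v' x.
  move=> Xx Yx; have : (u x)^-1 * v' x = (u a)^-1 * v' a.
    apply: (@potential_unique (X `&` Y) f) => //.
      by apply: potential_sub fu => t [].
    by apply: potential_sub fv => t [].
  by rewrite /v' /c mulVKg mulVg => /eqP; rewrite mulg_eq1 => /eqP/invg_inj.
exists (fun x => if x \in X then u x else v' x).
have onY x : Y x -> (if x \in X then u x else v' x) = v' x.
  by move=> Yx; case: ifPn => //; rewrite inE => Xx; exact: uv.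
have onX x : X x -> (if x \in X then u x else v' x) = u x.
  by rewrite -in_setE => ->.
move=> z; have [Xz|nXz] := pselect (X z); last first.
  case=> // Yz; have [W Wz Wf] := fv z Yz.
  exists (W `&` ~` X) => [|x y [Wx nXx] Ux [Wy nXy] Uy].
    by apply: filterI => //; apply: open_nbhs_nbhs; split=> //; exact: closed_openC.
  have Yx : Y x by case: Ux.
  have Yy : Y y by case: Uy.
  by rewrite !onY//; exact: Wf.
have [Yz|nYz] := pselect (Y z); last first.
  move=> _; have [W Wz Wf] := fu z Xz.
  exists (W `&` ~` Y) => [|x y [Wx nXx] Ux [Wy nXy] Uy].
    by apply: filterI => //; apply: open_nbhs_nbhs; split=> //; exact: closed_openC.
  have Xx : X x by case: Ux.
  have Xy : X y by case: Uy.
  by rewrite !onX//; exact: Wf.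
move=> _; have [W Wz Wf] := fu z Xz; have [W' Wz' Wf'] := fv z Yz.
have [V Vz Vf] := flf _ Xz Yz.
exists (V `&` W `&` W') => [|x y [[Vx Wx] Wx'] Ux [[Vy Wy] Wy'] Uy].
  by do 2?apply: filterI.
have zz := (nbhs_singleton Vz, nbhs_singleton Wz, nbhs_singleton Wz').
(* Near a common point [z], two points may lie in different pieces; flatness splits [f x y] as
   [f x z * f z y], and each factor stays in one piece. *)
have E : forall t, V t -> W t -> W' t -> (X `|` Y) t ->
    f t z = (if t \in X then u t else v' t) / u z /\
    f z t = u z / (if t \in X then u t else v' t).
  move=> t Vt Wt Wt' [Xt|Yt].
    by rewrite onX// !Wf//; apply zz.
  by rewrite onY// (uv z)// !Wf'//; apply zz.
rewrite -(Vf x z y)//; last exact: zz.1.1.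
by rewrite (E x _ _ _ _).1// (E y _ _ _ _).2// divgKA.
Qed.

End Flat.

(** * Potentials on closed and open boxes of the plane *)

Section Boxes.
Variable R : realType.
Implicit Types (a b c d e : R) (P : R -> R -> Prop).

Lemma nbhs_ballR (x : R) (W : set R) : nbhs x W ->
  exists2 e, 0 < e & forall y, `|y - x| < e -> W y.
Proof.
move=> /nbhs_ballP[e /= e0 We]; exists e => // y yx; apply: We.
by rewrite /ball/= distrC.
Qed.

Lemma nbhs_box (z : R * R) (W : set (R * R)) : nbhs z W ->
  exists2 e, 0 < e &
    forall x, `|x.1 - z.1| < e -> `|x.2 - z.2| < e -> W x.
Proof.
move=> /nbhs_ballP[e /= e0 We]; exists e => // x x1 x2; apply: We.
by split; rewrite /ball/= distrC.
Qed.

Lemma box_nbhs (z : R * R) (W : set (R * R)) e : 0 < e ->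
  (forall x, `|x.1 - z.1| < e -> `|x.2 - z.2| < e -> W x) -> nbhs z W.
Proof.
move=> e0 We; apply/nbhs_ballP; exists e => // x [x1 x2]; apply: We;
by rewrite distrC.
Qed.

(** This replaces a subdivision of the interval: the set of [x] with [P a x] is open and closed in
    [[a, b]]. *)
Lemma interval_induction P a b : a <= b ->
  (forall x y z, a <= x -> x <= y -> y <= z -> z <= b -> P x z -> P x y) ->
  (forall x y z, a <= x -> x <= y -> y <= z -> z <= b ->
     P x y -> P y z -> P x z) ->
  (forall x, a <= x <= b -> exists2 e, 0 < e &
     forall y z, x - e < y -> y <= z -> z < x + e -> a <= y -> z <= b -> P y z) ->
  P a b.
Proof.
move=> ab mono glue loc.
have aab : `[a, b]%classic a by rewrite /= in_itv /= lexx ab.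
have bab : `[a, b]%classic b by rewrite /= in_itv /= lexx ab.
apply: (connected_loc (P := P a) (@segment_connected R a b) _ aab _ bab).
  move=> z zab; have /andP[az zb] : a <= z <= b by move: zab; rewrite /= in_itv.
  have [|e e0 Pe] := loc z; first exact/andP.
  exists (ball z e) => [|x]; first exact: nbhsx_ballx.
  rewrite /ball/= ltr_distl => /andP[h1 h2].
  rewrite in_itv /= => /andP[ax xb].
  case: (leP x z) => xz.
    split; last exact: mono.
    by move=> Pax; apply: (glue _ x) => //; apply: Pe => //; lra.
  split; first by apply: mono => //; exact: ltW.
  by move=> Pax; apply: (glue _ z) => //; [exact: ltW|apply: Pe => //; lra].
have [|e e0 Pe] := loc a; first by rewrite lexx.
by apply: Pe; lra.
Qed.

Variables (H : groupType) (f : R * R -> R * R -> H).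

Definition rect a b c d : set (R * R) := `[a, b]%classic `*` `[c, d]%classic.

Lemma rectP a b c d x :
  rect a b c d x <-> (a <= x.1 <= b) /\ (c <= x.2 <= d).
Proof. by rewrite /rect /= !in_itv /=. Qed.

Lemma rect_connected a b c d : connected (rect a b c d).
Proof. by apply: connectedX; exact: segment_connected. Qed.

Lemma rect_closed a b c d : closed (rect a b c d).
Proof.
have -> : rect a b c d = fst @^-1` `[a, b]%classic `&` snd @^-1` `[c, d]%classic by [].
apply: closedI; apply: closed_comp; do ?exact: itv_closed.
  by move=> x _; exact: cvg_fst.
by move=> x _; exact: cvg_snd.
Qed.

(** Interval induction in the first coordinate, gluing along vertical sides; its local hypothesis is
    obtained by interval induction in the second coordinate over a thin vertical strip. All
    intersections are rectangles, hence connected. *)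
Lemma rect_potential a b c d : a <= b -> c <= d ->
  (forall z, rect a b c d z -> flat f z) ->
  exists u, potential (rect a b c d) f u.
Proof.
move=> ab cd fl.
pose Pot a' b' c' d' := exists u, potential (rect a' b' c' d') f u.
have sub a1 b1 c1 d1 a2 b2 c2 d2 : a2 <= a1 -> b1 <= b2 -> c2 <= c1 ->
    d1 <= d2 -> Pot a2 b2 c2 d2 -> Pot a1 b1 c1 d1.
  move=> ha hb hc hd [u fu]; exists u; apply: potential_sub fu => x /rectP[x1 x2].
  by apply/rectP; split; lra.
have glue X Y p q r s : closed X -> closed Y -> X `&` Y = rect p q r s ->
    a <= p -> p <= q -> q <= b -> c <= r -> r <= s -> s <= d ->
    (exists u, potential X f u) -> (exists u, potential Y f u) ->
    exists u, potential (X `|` Y) f u.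
  move=> clX clY XY ap pq qb cr rs sd [u fu] [v fv].
  apply: (glue_potential clX clY _ _ _ fu fv).
  - by rewrite XY; exists (p, r); apply/rectP; split=> /=; lra.
  - by rewrite XY; exact: rect_connected.
  move=> z Xz Yz; apply: fl; have /rectP[z1 z2] : rect p q r s z by rewrite -XY.
  by apply/rectP; split; lra.
apply: (@interval_induction (fun x y => Pot x y c d)) => //.
- by move=> x y z ax xy yz zb; apply: sub.
- move=> x y z ax xy yz zb P1 P2.
  have [||w fw] := glue _ _ y y c d (@rect_closed _ _ _ _) (@rect_closed _ _ _ _)
     _ (le_trans ax xy) (lexx y) (le_trans yz zb) (lexx c) _ (lexx d) P1 P2 => //.
    apply/seteqP; split=> t; first by move=> [/rectP[? ?] /rectP[? ?]]; apply/rectP; split; lra.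
    by move=> /rectP[? ?]; split; apply/rectP; split; lra.
  exists w; apply: potential_sub fw => s /rectP[s1 s2].
  by case: (leP s.1 y) => sy; [left|right]; apply/rectP; split; lra.
move=> x /andP[ax xb].
(* The width of the strip is quantified inside the statement, so that gluing two heights only
   requires the minimum of two widths. *)
pose Q c' d' := exists2 e, 0 < e &
  forall y z, x - e < y -> y <= z -> z < x + e -> a <= y -> z <= b -> Pot y z c' d'.
suff : Q c d by [].
apply: (@interval_induction Q) => //.
- move=> s t r cs st tr rd [e e0 Pe]; exists e => // y z h1 h2 h3 h4 h5.
  exact: sub (Pe y z h1 h2 h3 h4 h5).
- move=> s t r cs st tr rd [e e0 Pe] [e' e0' Pe']; exists (Num.min e e').
    by rewrite lt_min e0.
  move=> y z h1 h2 h3 h4 h5.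
  have [le1 le2] : Num.min e e' <= e /\ Num.min e e' <= e' by rewrite !ge_min !lexx orbT.
  have P1 : Pot y z s t by apply: Pe; lra.
  have P2 : Pot y z t r by apply: Pe'; lra.
  have [|w fw] := glue _ _ y z t t (@rect_closed _ _ _ _) (@rect_closed _ _ _ _)
     _ h4 h2 h5 (le_trans cs st) (lexx t) (le_trans tr rd) P1 P2.
    apply/seteqP; split=> p; first by move=> [/rectP[? ?] /rectP[? ?]]; apply/rectP; split; lra.
    by move=> /rectP[? ?]; split; apply/rectP; split; lra.
  exists w; apply: potential_sub fw => p /rectP[s1 s2].
  by case: (leP p.2 t) => sy; [left|right]; apply/rectP; split; lra.
move=> t tcd; have /fl[W /nbhs_box[e e0 We] Wf] : rect a b c d (x, t).
  by apply/rectP; split=> //; apply/andP.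
exists e => // s r h1 h2 h3 cs rd; exists e => // y z h4 h5 h6 ay zb.
exists (fun p => f p (x, t)) => p /rectP[p1 p2]; exists W.
  apply: (@box_nbhs _ _ (Num.min (e - `|p.1 - x|) (e - `|p.2 - t|))).
    by rewrite lt_min !subr_gt0 !ltr_distl; apply/andP; split; apply/andP; split; lra.
  move=> q; rewrite !lt_min !ltrBrDr => /andP[q1 _] /andP[_ q2].
  by apply: We => /=; [apply: le_lt_trans q1|apply: le_lt_trans q2];
    apply: le_trans (ler_normD _ _); rewrite addrA subrK.
move=> q q' Wq _ Wq' _; have Wxt : W (x, t) by apply: We; rewrite /= subrr normr0.
have e1 : (f (x, t) q' = (f q' (x, t))^-1)%g.
  apply/esym/mulg1_eq; rewrite Wf//; apply: (mulgI (f q' q')).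
  by rewrite Wf// mulg1.
by rewrite -(Wf q (x, t) q')// e1.
Qed.

End Boxes.

Section Exhaustion.
Local Open Scope group_scope.

(** Potentials normalized by the value 1 at the common point [p] agree on pairwise intersections, so
    the value at [x] does not depend on the member of the family that is used. *)
Lemma exhaust_potential (T : topologicalType) (H : groupType) (f : T -> T -> H)
    (X : set T) (p : T) (K : set (set T)) :
  (forall A, K A -> A p) ->
  (forall A B, K A -> K B -> connected (A `&` B)) ->
  (forall A, K A -> exists u, potential A f u) ->
  (forall z, X z -> exists2 A, K A & nbhs z A) ->
  exists u, potential X f u.
Proof.
move=> Kp KI Ku Kz.
have /choice[U UP] A : exists u, K A -> potential A f u /\ u p = 1.
  have [KA|nKA] := pselect (K A); last by exists (cst 1).
  have [u fu] := Ku _ KA; exists (fun x => u x * (u p)^-1) => _.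
  by split; [exact: potential_mulr|rewrite mulgV].
have /choice[A AP] z : exists A, X z -> K A /\ nbhs z A.
  have [Xz|nXz] := pselect (X z); last by exists setT.
  by have [A KA Az] := Kz _ Xz; exists A.
exists (fun x => U (A x) x) => z Xz.
have [KA Az] := AP _ Xz; have [UA U1] := UP _ KA.
have [W Wz Wf] := UA _ (nbhs_singleton Az).
exists (W `&` A z) => [|]; first exact: filterI.
have E x : A z x -> X x -> U (A x) x = U (A z) x.
  move=> Azx Xx; have [KAx Axx] := AP _ Xx; have [UAx Ux1] := UP _ KAx.
  have := @potential_unique _ _ (A z `&` A x) f (U (A z)) (U (A x)) (KI _ _ KA KAx).
  move=> /(_ (potential_sub (@subIsetl _ _ _) UA)).
  move=> /(_ (potential_sub (@subIsetr _ _ _) UAx)).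
  move=> /(_ p x (conj (Kp _ KA) (Kp _ KAx)) (conj Azx (nbhs_singleton Axx))).
  rewrite U1 Ux1 mulVg => /esym/eqP; rewrite mulg_eq1 => /eqP/invg_inj.
  by [].
by move=> x y [Wx Ax] Xx [Wy Ay] Xy; rewrite !E//; exact: Wf.
Qed.

End Exhaustion.

Section OpenBox.
Variable R : realType.
Implicit Types a b c d : R.

Definition obox a b c d : set (R * R) := `]a, b[%classic `*` `]c, d[%classic.

Lemma oboxP a b c d x :
  obox a b c d x <-> (a < x.1 < b) /\ (c < x.2 < d).
Proof. by rewrite /obox /= !in_itv /=. Qed.

Lemma obox_open a b c d : open (obox a b c d).
Proof.
have -> : obox a b c d = fst @^-1` `]a, b[%classic `&` snd @^-1` `]c, d[%classic by [].
apply: openI; apply: open_comp; do ?exact: itv_open.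
  by move=> x _; exact: cvg_fst.
by move=> x _; exact: cvg_snd.
Qed.

Lemma obox_nbhs a b c d x : obox a b c d x -> nbhs x (obox a b c d).
Proof. by move=> xb; apply: open_nbhs_nbhs; split=> //; exact: obox_open. Qed.

Lemma obox_connected a b c d : connected (obox a b c d).
Proof. by apply: connectedX; apply/connected_intervalP; exact: interval_is_interval. Qed.

Lemma rectI a b c d a' b' c' d' : rect a b c d `&` rect a' b' c' d' =
  rect (Num.max a a') (Num.min b b') (Num.max c c') (Num.min d d').
Proof.
apply/seteqP; split=> t.
  move=> [/rectP[/andP[? ?] /andP[? ?]] /rectP[/andP[? ?] /andP[? ?]]]; apply/rectP.
  by rewrite !ge_max !le_min; split; apply/andP; split; apply/andP.
move=> /rectP; rewrite !ge_max !le_min => -[].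
move=> /andP[/andP[? ?] /andP[? ?]] /andP[/andP[? ?] /andP[? ?]].
by split; apply/rectP; split; apply/andP.
Qed.

(** The exhausting family consists of the closed boxes around a fixed [p] inside the open box; two
    of them meet in a closed box. *)
Lemma obox_potential (H : groupType) (f : R * R -> R * R -> H) a b c d :
  (forall z, obox a b c d z -> flat f z) -> exists u, potential (obox a b c d) f u.
Proof.
move=> fl; have [[p /oboxP[/andP[p1 p2] /andP[p3 p4]]]|/forallNP out] :=
  pselect (exists p, obox a b c d p); last by exists (fun=> 1%g) => z /out.
pose K (A : set (R * R)) := A p /\ exists a' b' c' d',
  [/\ A = rect a' b' c' d', a < a', b' < b, c < c' & d' < d].
apply: (@exhaust_potential _ _ f _ p K).
- by move=> A [].
- move=> A B [_ [? [? [? [? [-> _ _ _ _]]]]]] [_ [? [? [? [? [-> _ _ _ _]]]]]].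
  by rewrite rectI; exact: rect_connected.
- move=> A [/[swap] -[a' [b' [c' [d' [-> aa bb cc dd]]]]] /rectP[pa pc]].
  apply: rect_potential; try lra.
  by move=> z /rectP[z1 z2]; apply: fl; apply/oboxP; lra.
move=> z /oboxP[/andP[z1 z2] /andP[z3 z4]].
have mid (x y t : R) : t < x -> t < y -> exists s, [/\ t < s, s < x & s < y].
  move=> tx ty; exists ((t + Num.min x y) / 2).
  have : t < Num.min x y by rewrite lt_min tx.
  have : Num.min x y <= x by rewrite ge_min lexx.
  have : Num.min x y <= y by rewrite ge_min lexx orbT.
  by move=> *; split; lra.
have mid' (x y t : R) : x < t -> y < t -> exists s, [/\ s < t, x < s & y < s].
  move=> xt yt; have [||s [? ? ?]] := mid (- x) (- y) (- t); rewrite ?ltrN2//.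
  by exists (- s); split; lra.
have [a' [? ? ?]] := mid z.1 p.1 a z1 p1.
have [b' [? ? ?]] := mid' z.1 p.1 b z2 p2.
have [c' [? ? ?]] := mid z.2 p.2 c z3 p3.
have [d' [? ? ?]] := mid' z.2 p.2 d z4 p4.
exists (rect a' b' c' d').
  by split; [apply/rectP; lra|exists a', b', c', d'].
apply: (@filterS _ (nbhs z) _ (obox a' b' c' d')); last by apply: obox_nbhs; apply/oboxP; lra.
by move=> t /oboxP[? ?]; apply/rectP; lra.
Qed.

End OpenBox.

Section AdditiveGroup.
Variable M : zmodType.

(** The additive group [M] in multiplicative notation, so that the results on potentials apply to
    it. *)
Definition addg : Type := M.
HB.instance Definition _ := Choice.on addg.
HB.instance Definition _ := isGroup.Build addg
  (@addrA M) (@add0r M) (@addr0 M) (@addNr M) (@addrN M).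

End AdditiveGroup.

(** * Isolated singularities in the plane *)

Section GermEquality.
Variables (T : topologicalType) (Y : Type).
Implicit Types (f h : T -> T -> Y) (z : T).

Definition eqg f h z := exists2 W, nbhs z W &
  forall x y, W x -> W y -> f x y = h x y.

Lemma eqg_refl f z : eqg f f z.
Proof. by exists setT => //; exact: filterT. Qed.

Lemma eqg_sym f h z : eqg f h z -> eqg h f z.
Proof. by move=> [W Wz Wf]; exists W => // x y Wx Wy; rewrite Wf. Qed.

Lemma eqg_trans f h k z : eqg f h z -> eqg h k z -> eqg f k z.
Proof.
move=> [W Wz Wf] [V Vz Vf]; exists (W `&` V); first exact: filterI.
by move=> x y [Wx Vx] [Wy Vy]; rewrite Wf// Vf.
Qed.

Lemma eqg_near f h z : eqg f h z -> nbhs z (eqg f h).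
Proof.
move=> [W Wz Wf]; have Wz' : nbhs z W° by apply: nbhs_interior.
by apply: filterS Wz' => x Wx; exists W.
Qed.

End GermEquality.

Lemma flat_eqg (T : topologicalType) (H : groupType) (f h : T -> T -> H) z :
  eqg f h z -> flat f z -> flat h z.
Proof.
move=> [W Wz Wf] [V Vz Vf]; exists (W `&` V); first exact: filterI.
by move=> x y w [Wx Vx] [Wy Vy] [Ww Vw]; rewrite -!Wf// Vf.
Qed.

Section Germs.
Variables (T : topologicalType) (M : zmodType).
Implicit Types (f h : T -> T -> M) (u v : T -> M) (z : T).

Definition zflat f z := exists2 W, nbhs z W &
  forall x y w, W x -> W y -> W w -> f x y + f y w = f x w.

Definition punct (P : set T) z := nbhs z [set x | x <> z -> P x].
Definition pflat f := punct (zflat f).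
Definition peq f h := punct (eqg f h).

Definition cadd f h : T -> T -> M := fun x y => f x y + h x y.
Definition copp f : T -> T -> M := fun x y => - f x y.
Definition czero : T -> T -> M := fun _ _ => 0.
Definition grad u : T -> T -> M := fun x y => u x - u y.

Lemma eqg_add f h f' h' z :
  eqg f f' z -> eqg h h' z -> eqg (cadd f h) (cadd f' h') z.
Proof.
move=> [W Wz Wf] [V Vz Vf]; exists (W `&` V); first exact: filterI.
by move=> x y [Wx Vx] [Wy Vy]; rewrite /cadd Wf// Vf.
Qed.

Lemma eqg_opp f h z : eqg f h z -> eqg (copp f) (copp h) z.
Proof. by move=> [W Wz Wf]; exists W => // x y Wx Wy; rewrite /copp Wf. Qed.

Lemma zflat_eqg f h z : eqg f h z -> zflat f z -> zflat h z.
Proof.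
move=> [W Wz Wf] [V Vz Vf]; exists (W `&` V); first exact: filterI.
by move=> x y w [Wx Vx] [Wy Vy] [Ww Vw]; rewrite -!Wf// Vf.
Qed.

Lemma zflat_add f h z : zflat f z -> zflat h z -> zflat (cadd f h) z.
Proof.
move=> [W Wz Wf] [V Vz Vf]; exists (W `&` V); first exact: filterI.
by move=> x y w [Wx Vx] [Wy Vy] [Ww Vw]; rewrite /cadd addrACA Wf// Vf.
Qed.

Lemma zflat_opp f z : zflat f z -> zflat (copp f) z.
Proof.
by move=> [W Wz Wf]; exists W => // x y w *; rewrite /copp -opprD Wf.
Qed.

Lemma zflat0 z : zflat czero z.
Proof. by exists setT => [|*]; [exact: filterT|rewrite addr0]. Qed.

Lemma zflat_grad u z : zflat (grad u) z.
Proof. by exists setT => [|*]; [exact: filterT|rewrite /grad addrA subrK]. Qed.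

Lemma zflat_near f z : zflat f z -> nbhs z (zflat f).
Proof.
move=> [W Wz Wf]; have Wz' : nbhs z W° by apply: nbhs_interior.
by apply: filterS Wz' => x Wx; exists W.
Qed.

Lemma zflat1 f z : zflat f z -> exists2 W, nbhs z W &
  forall x y, W x -> W y -> f x x = 0 /\ f x y = - f y x.
Proof. exact: (@flat1 T (addg M)). Qed.

Lemma punctS (P Q : set T) z : P `<=` Q -> punct P z -> punct Q z.
Proof. by move=> PQ; apply: filterS => x Px /Px /PQ. Qed.

Lemma punctI (P Q : set T) z : punct P z -> punct Q z -> punct (P `&` Q) z.
Proof. by move=> Pz Qz; apply: filterS2 Pz Qz => x Px Qx xz; split; auto. Qed.

Lemma nbhs_punct (P : set T) z : nbhs z P -> punct P z.
Proof. by apply: filterS => x Px _. Qed.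

Lemma zflat_pflat f z : zflat f z -> pflat f z.
Proof. by move=> /zflat_near; exact: nbhs_punct. Qed.

Lemma eqg_peq f h z : eqg f h z -> peq f h z.
Proof. by move=> /eqg_near; exact: nbhs_punct. Qed.

Lemma pflat_peq f h z : peq f h z -> pflat f z -> pflat h z.
Proof.
by move=> fh ff; apply: punctS (punctI fh ff) => x [fhx]; exact: zflat_eqg.
Qed.

Lemma pflat_add f h z : pflat f z -> pflat h z -> pflat (cadd f h) z.
Proof.
by move=> fh ff; apply: punctS (punctI fh ff) => x [fhx]; exact: zflat_add.
Qed.

Lemma pflat_opp f z : pflat f z -> pflat (copp f) z.
Proof. by apply: punctS => x; exact: zflat_opp. Qed.

Lemma peq_refl f z : peq f f z.
Proof. exact/eqg_peq/eqg_refl. Qed.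

Lemma peq_sym f h z : peq f h z -> peq h f z.
Proof. by apply: punctS => x; exact: eqg_sym. Qed.

Lemma peq_trans f h k z : peq f h z -> peq h k z -> peq f k z.
Proof.
by move=> fh ff; apply: punctS (punctI fh ff) => x [fhx]; exact: eqg_trans.
Qed.

Lemma peq_add f h f' h' z :
  peq f f' z -> peq h h' z -> peq (cadd f h) (cadd f' h') z.
Proof.
by move=> fh ff; apply: punctS (punctI fh ff) => x [fhx]; exact: eqg_add.
Qed.

Lemma peq_opp f h z : peq f h z -> peq (copp f) (copp h) z.
Proof. by apply: punctS => x; exact: eqg_opp. Qed.

Lemma eqg_grad_diff (X : set T) f u v : connected X ->
  (forall x, X x -> eqg f (grad u) x) -> (forall x, X x -> eqg f (grad v) x) ->
  exists k, forall x, X x -> v x = u x + k.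
Proof.
move=> cX fu fv; have [[a Xa]|/forallNP out] := pselect (exists a, X a); last first.
  by exists 0 => x /out.
exists (v a - u a) => x Xx.
have -> : v a - u a = v x - u x; last by rewrite addrC subrK.
apply: (connected_const (u := fun x => v x - u x) cX _ Xa Xx) => z Xz.
have [W Wz Wu] := fu z Xz; have [V Vz Vv] := fv z Xz.
exists (W `&` V) => [|y [Wy Vy] Xy]; first exact: filterI.
have : u y - u z = v y - v z.
  by rewrite -/(grad u y z) -/(grad v y z) -Wu ?Vv//; exact: nbhs_singleton.
move=> E; rewrite -(subrK (v z) (v y)) -E.
by rewrite addrAC (addrAC (u y)) subrr add0r addrC.
Qed.

Lemma potential_eqg (X : set T) f u : open X ->
  potential X (f : T -> T -> addg M) u -> forall x, X x -> eqg f (grad u) x.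
Proof.
move=> oX fu x Xx; have [W Wx Wf] := fu x Xx; exists (W `&` X).
  by apply: filterI => //; exact: open_nbhs_nbhs.
by move=> y y' [Wy Xy] [Wy' Xy']; exact: Wf.
Qed.

End Germs.
Arguments czero {T M}.

Section Pullback.
Variables (T U : topologicalType) (M : zmodType) (phi : T -> U).

Definition pull (f : U -> U -> M) : T -> T -> M := fun x y => f (phi x) (phi y).

Lemma eqg_pull f h z : {for z, continuous phi} ->
  eqg f h (phi z) -> eqg (pull f) (pull h) z.
Proof.
move=> cz [W Wz Wf]; exists (phi @^-1` W); first exact: cz.
by move=> x y Wx Wy; exact: Wf.
Qed.

Lemma zflat_pull f z : {for z, continuous phi} ->
  zflat f (phi z) -> zflat (pull f) z.
Proof.
move=> cz [W Wz Wf]; exists (phi @^-1` W); first exact: cz.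
by move=> x y w Wx Wy Ww; exact: Wf.
Qed.

End Pullback.

(** * The standard singularity with a given residue *)

Section Cut.
Variables (R : realType) (M : zmodType).
Implicit Types (z x y : R * R) (m : M).

Definition upper z m x : M := if z.2 <= x.2 then m else 0.

(* The crossing number, weighted by [m], of the horizontal ray issued from [z]
   to the right; it is the standard flat cochain with residue [m] at [z]. *)
Definition cut z m : R * R -> R * R -> M := fun x y =>
  if (z.1 < x.1) && (z.1 < y.1) then upper z m x - upper z m y else 0.

Lemma cutD z m m' : cut z (m + m') = cadd (cut z m) (cut z m').
Proof.
apply/funext => x; apply/funext => y; rewrite /cut /cadd /upper.
by do 3?case: ifP => _; rewrite ?subrr ?subr0 ?sub0r ?addr0 ?opprD.
Qed.

Lemma cutN z m : cut z (- m) = copp (cut z m).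
Proof.
apply/funext => x; apply/funext => y; rewrite /cut /copp /upper.
by do 3?case: ifP => _; rewrite ?subrr ?subr0 ?sub0r ?oppr0.
Qed.

Lemma cut0 z : cut z 0 = czero.
Proof.
apply/funext => x; apply/funext => y; rewrite /cut /czero /upper.
by do 3?case: ifP => _; rewrite ?subr0.
Qed.

Lemma nbhs_lt1 x (c : R) : c < x.1 -> nbhs x [set y : R * R | c < y.1].
Proof.
move=> cx; apply: (@box_nbhs _ _ _ (x.1 - c)); first by rewrite subr_gt0.
by move=> y /=; rewrite ltr_distl => /andP[]; lra.
Qed.

Lemma nbhs_gt1 x (c : R) : x.1 < c -> nbhs x [set y : R * R | y.1 < c].
Proof.
move=> cx; apply: (@box_nbhs _ _ _ (c - x.1)); first by rewrite subr_gt0.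
by move=> y /=; rewrite ltr_distl => /andP[]; lra.
Qed.

Lemma nbhs_lt2 x (c : R) : c < x.2 -> nbhs x [set y : R * R | c < y.2].
Proof.
move=> cx; apply: (@box_nbhs _ _ _ (x.2 - c)); first by rewrite subr_gt0.
by move=> y /= _; rewrite ltr_distl => /andP[]; lra.
Qed.

Lemma nbhs_gt2 x (c : R) : x.2 < c -> nbhs x [set y : R * R | y.2 < c].
Proof.
move=> cx; apply: (@box_nbhs _ _ _ (c - x.2)); first by rewrite subr_gt0.
by move=> y /= _; rewrite ltr_distl => /andP[]; lra.
Qed.

Lemma cut_right z m x : z.1 < x.1 -> eqg (cut z m) (grad (upper z m)) x.
Proof.
move=> zx; exists [set y | z.1 < y.1]; first exact: nbhs_lt1.
by move=> y y' /= zy zy'; rewrite /cut zy zy'.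
Qed.

Lemma cut_left z m x : x.1 < z.1 -> eqg (cut z m) czero x.
Proof.
move=> zx; exists [set y | y.1 < z.1]; first exact: nbhs_gt1.
by move=> y y' /= zy zy'; rewrite /cut ltNge (ltW zy).
Qed.

Lemma cut_above z m x : z.2 < x.2 -> eqg (cut z m) czero x.
Proof.
move=> zx; exists [set y | z.2 < y.2]; first exact: nbhs_lt2.
move=> y y' /= zy zy'; rewrite /cut /upper (ltW zy) (ltW zy') subrr.
by case: ifP.
Qed.

Lemma cut_below z m x : x.2 < z.2 -> eqg (cut z m) czero x.
Proof.
move=> zx; exists [set y | y.2 < z.2]; first exact: nbhs_gt2.
move=> y y' /= zy zy'; rewrite /cut /upper !leNgt zy zy' subrr.
by case: ifP.
Qed.

Lemma neq_pairP z x : x <> z ->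
  [\/ z.1 < x.1, x.1 < z.1, z.2 < x.2 | x.2 < z.2].
Proof.
move=> xz; case: (ltgtP z.1 x.1) => h1; [by constructor 1|by constructor 2|].
case: (ltgtP z.2 x.2) => h2; [by constructor 3|by constructor 4|].
by exfalso; apply: xz; rewrite (surjective_pairing x) -h1 -h2 -surjective_pairing.
Qed.

Lemma cut_flat z m x : x <> z -> zflat (cut z m) x.
Proof.
case/neq_pairP => [/(cut_right m)|/(cut_left m)|/(cut_above m)|/(cut_below m)] /eqg_sym e;
apply: zflat_eqg e _; [exact: zflat_grad|exact: zflat0..].
Qed.

Lemma cut_pflat z m x : pflat (cut z m) x.
Proof.
have [->|xz] := pselect (x = z); last exact/zflat_pflat/cut_flat.
by apply: filterS (@filterT _ (nbhs z) _) => y _; exact: cut_flat.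
Qed.

(** The parts of the box to the right of, above, to the left of and below [z] cover the punctured
    box, and each has a potential. Going around [z], three of them are adjusted to agree with their
    predecessor; the last comparison leaves a constant [m], the monodromy. *)
Lemma punctured_box_potential (f : R * R -> R * R -> M) z a b c d :
  (forall x, obox a b c d x -> x <> z -> zflat f x) ->
  exists u m, forall x, obox a b c d x -> x <> z ->
    eqg f (cadd (grad u) (cut z m)) x.
Proof.
move=> fl.
have pot a' b' c' d' : (forall x, obox a' b' c' d' x -> obox a b c d x /\ x <> z) ->
    exists u, forall x, obox a' b' c' d' x -> eqg f (grad u) x.
  move=> sub; have [x /sub[ox xz]|u fu] :=
    @obox_potential R (addg M) f a' b' c' d'; first exact: fl.
  by exists u; apply: potential_eqg => //; exact: obox_open.
pose X1 := Num.max a z.1; pose Y1 := Num.min b z.1.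
pose X2 := Num.max c z.2; pose Y2 := Num.min d z.2.
have rP x : obox X1 b c d x <-> z.1 < x.1 /\ obox a b c d x.
  by rewrite !oboxP gt_max; split=> [[/andP[/andP[-> ->] ->] ->]|[-> [/andP[-> ->] ->]]].
have lP x : obox a Y1 c d x <-> x.1 < z.1 /\ obox a b c d x.
  by rewrite !oboxP lt_min; split=> [[/andP[-> /andP[-> ->]] ->]|[-> [/andP[-> ->] ->]]].
have tP x : obox a b X2 d x <-> z.2 < x.2 /\ obox a b c d x.
  by rewrite !oboxP gt_max; split=> [[-> /andP[/andP[-> ->] ->]]|[-> [-> /andP[-> ->]]]].
have bP x : obox a b c Y2 x <-> x.2 < z.2 /\ obox a b c d x.
  by rewrite !oboxP lt_min; split=> [[-> /andP[-> /andP[-> ->]]]|[-> [-> /andP[-> ->]]]].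
have [|ur fr] := pot X1 b c d.
  by move=> x /rP[zx ox]; split=> // xz; rewrite xz ltxx in zx.
have [|ut0 ft0] := pot a b X2 d.
  by move=> x /tP[zx ox]; split=> // xz; rewrite xz ltxx in zx.
have [|ul0 fl0] := pot a Y1 c d.
  by move=> x /lP[zx ox]; split=> // xz; rewrite xz ltxx in zx.
have [|ub0 fb0] := pot a b c Y2.
  by move=> x /bP[zx ox]; split=> // xz; rewrite xz ltxx in zx.
have shift (X : set (R * R)) u k : (forall x, X x -> eqg f (grad u) x) ->
    forall x, X x -> eqg f (grad (fun y => u y - k)) x.
  move=> fu x /fu fx; apply: eqg_trans fx _; exists setT; first exact: filterT.
  by move=> y y' _ _; rewrite /grad opprB addrA subrK.
have cmp u v (X Y : set (R * R)) a' b' c' d' :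
    (forall x, obox a' b' c' d' x -> X x /\ Y x) ->
    (forall x, X x -> eqg f (grad u) x) -> (forall x, Y x -> eqg f (grad v) x) ->
    exists k, forall x, obox a' b' c' d' x -> v x = u x + k.
  move=> sub fu fv; apply: (eqg_grad_diff (@obox_connected R a' b' c' d')).
    by move=> x /sub[+ _]; exact: fu.
  by move=> x /sub[_]; exact: fv.
have [|kt ekt] := cmp ur ut0 _ _ X1 b X2 d _ fr ft0.
  move=> x /oboxP[/andP[x1 x2] /andP[x3 x4]].
  by split; apply/oboxP; move: x1 x3; rewrite !gt_max => /andP[? ?] /andP[? ?]; split; apply/andP; rewrite ?gt_max; split=> //; apply/andP.
pose ut := fun y => ut0 y - kt; have {}ft0 := shift _ _ kt ft0.
have {}ekt x : obox a b c d x -> z.1 < x.1 -> z.2 < x.2 -> ut x = ur x.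
  move=> /oboxP[/andP[x1 x2] /andP[x3 x4]] h1 h2; rewrite /ut ekt ?addrK//.
  by apply/oboxP; rewrite !gt_max x1 x2 x3 x4 h1 h2.
have [|kl ekl] := cmp ut ul0 _ _ a Y1 X2 d _ ft0 fl0.
  move=> x /oboxP[/andP[x1 x2] /andP[x3 x4]].
  by split; apply/oboxP; move: x2 x3; rewrite !gt_max !lt_min => /andP[? ?] /andP[? ?]; split; apply/andP; rewrite ?gt_max ?lt_min; split=> //; apply/andP.
pose ul := fun y => ul0 y - kl; have {}fl0 := shift _ _ kl fl0.
have {}ekl x : obox a b c d x -> x.1 < z.1 -> z.2 < x.2 -> ul x = ut x.
  move=> /oboxP[/andP[x1 x2] /andP[x3 x4]] h1 h2; rewrite /ul ekl ?addrK//.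
  by apply/oboxP; rewrite !gt_max !lt_min x1 x2 x3 x4 h1 h2.
have [|kb ekb] := cmp ul ub0 _ _ a Y1 c Y2 _ fl0 fb0.
  move=> x /oboxP[/andP[x1 x2] /andP[x3 x4]].
  by split; apply/oboxP; move: x2 x4; rewrite !lt_min => /andP[? ?] /andP[? ?]; split; apply/andP; rewrite ?lt_min; split=> //; apply/andP.
pose ub := fun y => ub0 y - kb; have {}fb0 := shift _ _ kb fb0.
have {}ekb x : obox a b c d x -> x.1 < z.1 -> x.2 < z.2 -> ub x = ul x.
  move=> /oboxP[/andP[x1 x2] /andP[x3 x4]] h1 h2; rewrite /ub ekb ?addrK//.
  by apply/oboxP; rewrite !lt_min x1 x2 x3 x4 h1 h2.
(* No constant is left to adjust: the turn around [z] is closed here, between below and right. *)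
have [|m em] := cmp ur ub _ _ X1 b c Y2 _ fr fb0.
  move=> x /oboxP[/andP[x1 x2] /andP[x3 x4]].
  by split; apply/oboxP; move: x1 x4; rewrite !gt_max !lt_min => /andP[? ?] /andP[? ?]; split; apply/andP; rewrite ?gt_max ?lt_min; split=> //; apply/andP.
have {}em x : obox a b c d x -> z.1 < x.1 -> x.2 < z.2 -> ub x = ur x + m.
  move=> /oboxP[/andP[x1 x2] /andP[x3 x4]] h1 h2; rewrite em//.
  by apply/oboxP; rewrite !gt_max !lt_min x1 x2 x3 x4 h1 h2.
(* To the right of [z] the branch [ur] is used on the ray itself, matching the weak inequality in
   [upper]; below the ray the excess [m] of [ub] over [ur] is cancelled by the jump of [cut]. *)
pose u x := if z.1 < x.1 then (if z.2 <= x.2 then ur x else ub x)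
  else if z.2 < x.2 then ut x else if x.2 < z.2 then ub x else ul x.
exists u, m => x ox xz.
have oxN := obox_nbhs ox.
have loc v (W : set (R * R)) : nbhs x W -> eqg f (grad v) x ->
    (forall y y', W y -> obox a b c d y -> W y' -> obox a b c d y' ->
      grad v y y' = u y - u y' + cut z m y y') ->
    eqg f (cadd (grad u) (cut z m)) x.
  move=> Wx fv vu; apply: eqg_trans fv _; exists (W `&` obox a b c d).
    exact: filterI.
  by move=> y y' [Wy oy] [Wy' oy']; rewrite vu.
case: (ltgtP z.1 x.1) => h1.
- apply: (loc ur [set y | z.1 < y.1]); [exact: nbhs_lt1|by apply: fr; apply/rP|].
  move=> y y' /= zy oy zy' oy'; rewrite /grad /cut /u /upper zy zy' /=.
  case: (leP z.2 y.2) => hy; case: (leP z.2 y'.2) => hy'; rewrite ?em//.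
  + by rewrite subrr addr0.
  + by rewrite subr0 opprD addrA subrK.
  + by rewrite sub0r addrAC addrK.
  + by rewrite subrr addr0 opprD addrACA subrr addr0.
- apply: (loc ul [set y | y.1 < z.1]); [exact: nbhs_gt1|by apply: fl0; apply/lP|].
  move=> y y' /= zy oy zy' oy'; rewrite /grad /cut /u !ltNge (ltW zy) (ltW zy') /= addr0.
  by case: (ltgtP z.2 y.2) => hy; case: (ltgtP z.2 y'.2) => hy' /=;
    rewrite ?ekb// -?ekl// ?ekb//; do ?exact: ltW.
case: (ltgtP z.2 x.2) => h2.
- apply: (loc ut [set y | z.2 < y.2]); [exact: nbhs_lt2|by apply: ft0; apply/tP|].
  move=> y y' /= zy oy zy' oy'; rewrite /grad /cut /u /upper (ltW zy) (ltW zy') zy zy' subrr if_same addr0.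
  by case: (ltP z.1 y.1) => hy; case: (ltP z.1 y'.1) => hy'; rewrite -?ekt.
- apply: (loc ub [set y | y.2 < z.2]); [exact: nbhs_gt2|by apply: fb0; apply/bP|].
  move=> y y' /= zy oy zy' oy'; rewrite /grad /cut /u /upper !leNgt !ltNge (ltW zy) (ltW zy') /=.
  by rewrite -!ltNge zy zy' /= subrr !if_same addr0.
by exfalso; apply: xz; rewrite (surjective_pairing x) -h1 -h2 -surjective_pairing.
Qed.

End Cut.

(** * Winding numbers of curves around a singularity *)

Section Winding.
Variable R : realType.
Implicit Types (t : R) (k : int).

Let twopi_gt0 : 0 < 2 * pi :> R.
Proof. by rewrite mulr_gt0// pi_gt0. Qed.

Definition turns t : int := Num.floor (t / (2 * pi)).

Lemma turnsD t k : turns (t + 2 * pi * k%:~R) = turns t + k.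
Proof.
rewrite /turns mulrDl mulrAC mulfV ?gt_eqF// mul1r floorDrz ?intr_int//.
by rewrite intrKfloor.
Qed.

Lemma sinD_turn t k : sin (t + 2 * pi * k%:~R) = sin t.
Proof.
have pn n s : sin (s + 2 * pi * n%:R) = sin s.
  elim: n s => [|n IH] s; first by rewrite mulr0 addr0.
  by rewrite -[n.+1%:R]natr1 mulrDr mulr1 addrA [X in sin (_ + X)]mulr_natl sinD2pi.
case: k => n; first exact: pn.
by rewrite NegzE mulrNz mulrN -{2}(subrK (2 * pi * (n.+1)%:R) t) pn.
Qed.

Lemma cosD_turn t k : cos (t + 2 * pi * k%:~R) = cos t.
Proof.
have pn n s : cos (s + 2 * pi * n%:R) = cos s.
  elim: n s => [|n IH] s; first by rewrite mulr0 addr0.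
  by rewrite -[n.+1%:R]natr1 mulrDr mulr1 addrA [X in cos (_ + X)]mulr_natl cosD2pi.
case: k => n; first exact: pn.
by rewrite NegzE mulrNz mulrN -{2}(subrK (2 * pi * (n.+1)%:R) t) pn.
Qed.

Lemma turns_eq t k : 2 * pi * k%:~R <= t < 2 * pi * (k + 1)%:~R -> turns t = k.
Proof.
move=> /andP[h1 h2]; apply: floor_def.
by rewrite ler_pdivlMr// ltr_pdivrMr// ![_%:~R * _]mulrC h1.
Qed.

Lemma sin_lt0 t : pi < t < 2 * pi -> sin t < 0.
Proof.
move=> /andP[h1 h2]; rewrite -(subrK pi t) sinDpi oppr_lt0.
by apply: sin_gt0_pi; lra.
Qed.

Variable M : zmodType.
Implicit Types (m : M) (z : R * R).

Let cutf m t t' : M := if (0 < cos t) && (0 < cos t') then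
  (if 0 <= sin t then m else 0) - (if 0 <= sin t' then m else 0) else 0.

(** Near angle 0 the cosine is positive and the sign of the sine changes exactly where [turns]
    jumps. At other angles [turns] is locally constant, and the cut vanishes because the sine keeps
    its sign or, near [pi], because the cosine is negative. *)
Let cutf_turns0 m t : 0 <= t < 2 * pi -> exists2 e, 0 < e &
  forall s s', `|s - t| < e -> `|s' - t| < e ->
    cutf m s s' = m *~ turns s - m *~ turns s'.
Proof.
move=> /andP[t0 t2]; have pi0 := pi_gt0 R.
case: (eqVneq t 0) => [->|tn0].
  exists (pi / 2); first lra.
  suff E s : `|s - 0| < pi / 2 -> 0 < cos s /\
      (if 0 <= sin s then m else 0) = m + m *~ turns s.
    move=> s s' /E[c1 e1] /E[c2 e2]; rewrite /cutf c1 c2 /= e1 e2.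
    by rewrite opprD addrACA subrr add0r.
  rewrite subr0 ltr_norml => /andP[s1 s2]; split; first by apply: cos_gt0_pihalf; lra.
  case: (leP 0 s) => s0.
    rewrite sin_ge0_pi; last lra.
    by rewrite (@turns_eq s 0) ?mulr0z ?addr0//; lra.
  have : 0 < sin (- s) by apply: sin_gt0_pi; lra.
  rewrite sinN oppr_gt0 => h; rewrite leNgt h /=.
  by rewrite (@turns_eq s (-1)) ?mulrN1z ?subrr//; lra.
have {t0 tn0} t0 : 0 < t by rewrite lt_neqAle eq_sym tn0.
have tn s : 0 < s -> s < 2 * pi -> turns s = 0.
  by move=> ? ?; apply: turns_eq; lra.
suff [e [e0 e1 e2 E]] : exists e, [/\ 0 < e, e <= t, e <= 2 * pi - t &
    forall s s', `|s - t| < e -> `|s' - t| < e -> cutf m s s' = 0].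
  exists e => // s s' h h'; rewrite E//.
  by move: h h'; rewrite !ltr_distl => /andP[? ?] /andP[? ?];
    rewrite !tn ?subrr//; lra.
case: (ltgtP t pi) => tpi.
- exists (Num.min t (pi - t)); split.
  + by rewrite lt_min t0; lra.
  + by rewrite ge_min lexx.
  + by rewrite ge_min; apply/orP; right; lra.
  move=> s s'; rewrite !lt_min !ltr_distl => /andP[/andP[? ?] /andP[? ?]] /andP[/andP[? ?] /andP[? ?]].
  have s1 : 0 < sin s by apply: sin_gt0_pi; lra.
  have s2 : 0 < sin s' by apply: sin_gt0_pi; lra.
  by rewrite /cutf !ltW// subrr if_same.
- exists (Num.min (t - pi) (2 * pi - t)); split.
  + by rewrite lt_min; apply/andP; split; lra.
  + by rewrite ge_min; apply/orP; left; lra.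
  + by rewrite ge_min lexx orbT.
  move=> s s'; rewrite !lt_min !ltr_distl => /andP[/andP[? ?] /andP[? ?]] /andP[/andP[? ?] /andP[? ?]].
  have s1 : sin s < 0 by apply: sin_lt0; lra.
  have s2 : sin s' < 0 by apply: sin_lt0; lra.
  by rewrite /cutf !leNgt s1 s2 /= subrr if_same.
- exists (pi / 2); split; rewrite ?tpi; [lra..|].
  move=> s s' h _; rewrite /cutf.
  have : 0 < cos (s - pi) by apply: cos_gt0_pihalf; move: h; rewrite ltr_distl; lra.
  by rewrite -(subrK pi s) cosDpi addrK => h1; rewrite oppr_gt0 ltNge (ltW h1).
Qed.

(* The rays are half-open, so crossing the ray at angle [2 pi k] counts exactly
   the jump of [turns]. *)
Lemma cut_polar z m t : exists2 e, 0 < e &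
  forall s s' r r', `|s - t| < e -> `|s' - t| < e -> 0 < r -> 0 < r' ->
    cut z m (polar z r s) (polar z r' s') = m *~ turns s - m *~ turns s'.
Proof.
pose k := turns t.
have [|e e0 E] := @cutf_turns0 m (t + 2 * pi * (- k)%:~R).
  have /andP[h1 h2] := floor_itv (t / (2 * pi)); rewrite -/(turns t) -/k in h1 h2.
  move: h1 h2; rewrite ler_pdivlMr// ltr_pdivrMr// intrD mulrDl mul1r.
  by rewrite [k%:~R * _]mulrC mulrNz => h1 h2; lra.
exists e => // s s' r r' se se' r0 r0'.
have sh x : `|x - t| < e ->
    `|x + 2 * pi * (- k)%:~R - (t + 2 * pi * (- k)%:~R)| < e.
  by rewrite opprD addrACA subrr addr0.
have := E _ _ (sh _ se) (sh _ se'); rewrite !turnsD !mulrzDr opprD addrACA subrr addr0 => <-.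
rewrite /cut /upper /polar /cutf /= !ltrDl !lerDl !pmulr_rgt0// !pmulr_rge0//.
by rewrite !sinD_turn !cosD_turn.
Qed.

(** Along a curve with a continuous angle [th] around [z], a potential is [u] plus [m] times the
    number of turns. Its increment over a closed curve is therefore [m] times the winding number, up
    to sign conventions of [potential]. *)
Lemma curve_potential (T : topologicalType) (f : T -> T -> M) (u : T -> M)
    (phi : T -> R * R) (gam : R -> T) z m (rho th : R -> R) (A : set R) (t : R) :
  A t -> {for t, continuous gam} ->
  eqg f (cadd (grad u) (pull phi (cut z m))) (gam t) ->
  (forall s, A s -> 0 < rho s /\ phi (gam s) = polar z (rho s) (th s)) ->
  th @ within A (nbhs t) --> th t ->
  exists2 W, nbhs t W & forall s s', W s -> A s -> W s' -> A s' ->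
    f (gam s) (gam s') =
    (u (gam s) + m *~ turns (th s)) - (u (gam s') + m *~ turns (th s')).
Proof.
move=> At gc [V Vt Vf] phiE thc; have [e e0 E] := cut_polar z m (th t).
have /thc Wt : nbhs (th t) (ball (th t) e) by exact: nbhsx_ballx.
exists ((gam @^-1` V) `&` [set s | A s -> ball (th t) e (th s)]).
  by apply: filterI => //; exact: gc.
move=> s s' [Vs /[swap] As /(_ As) Bs] [Vs' /[swap] As' /(_ As') Bs'].
have [[r1 E1] [r2 E2]] := (phiE _ As, phiE _ As').
rewrite Vf// /cadd /grad /pull E1 E2 E//; last 2 first.
- by rewrite distrC.
- by rewrite distrC.
by rewrite opprD addrACA.
Qed.

End Winding.

(** * Residues read in a coordinate map *)

Section Residue.
Variables (R : realType) (T : topologicalType) (M : zmodType).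
Variable phi : T -> R * R.
Implicit Types (f h : T -> T -> M) (z : T) (m : M).

(** The residue is the coefficient of the standard singularity left over when a gradient is removed.
    It is read through [phi], hence depends a priori on the chart and on its orientation. *)
Definition is_res f z m :=
  exists u, peq f (cadd (grad u) (pull phi (cut (phi z) m))) z.

Lemma is_res_peq f h z m : peq f h z -> is_res f z m -> is_res h z m.
Proof. by move=> fh [u fu]; exists u; apply: peq_trans fu; exact: peq_sym. Qed.

Lemma is_res_add f h z m m' :
  is_res f z m -> is_res h z m' -> is_res (cadd f h) z (m + m').
Proof.
move=> [u fu] [v hv]; exists (fun x => u x + v x).
apply: peq_trans (peq_add fu hv) _.
rewrite cutD; apply/eqg_peq; exists setT => [|x y _ _]; first exact: filterT.
by rewrite /cadd /grad /pull addrACA opprD [X in X + _]addrACA.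
Qed.

Lemma is_res_opp f z m : is_res f z m -> is_res (copp f) z (- m).
Proof.
move=> [u fu]; exists (fun x => - u x).
apply: peq_trans (peq_opp fu) _.
rewrite cutN; apply/eqg_peq; exists setT => [|x y _ _]; first exact: filterT.
by rewrite /cadd /grad /pull /copp opprD opprD opprK.
Qed.

Lemma is_res_grad u z : is_res (grad u) z 0.
Proof.
exists u; rewrite cut0; apply/eqg_peq; exists setT => [|x y _ _]; first exact: filterT.
by rewrite /cadd /pull /czero addr0.
Qed.

Lemma is_res_flat f z : zflat f z -> is_res f z 0.
Proof.
move=> fz; apply: is_res_peq (is_res_grad (f ^~ z) z).
have [V Vz Vf] := zflat1 fz; case: fz => W Wz Wf.
apply/eqg_peq; exists (W `&` V); first exact: filterI.
move=> x y [Wx Vx] [Wy Vy]; have [Wzz Vzz] := (nbhs_singleton Wz, nbhs_singleton Vz).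
by rewrite /grad -(Vf z y _ _).2// Wf.
Qed.

Lemma is_res_cut z m : is_res (pull phi (cut (phi z) m)) z m.
Proof.
exists (fun=> 0); apply/eqg_peq; exists setT => [|x y _ _]; first exact: filterT.
by rewrite /cadd /grad subrr add0r.
Qed.

Lemma is_res_cut_away z w m : {for z, continuous phi} -> phi z <> w ->
  is_res (pull phi (cut w m)) z 0.
Proof.
by move=> cz zw; apply: is_res_flat; apply: zflat_pull => //; exact: cut_flat.
Qed.

Lemma is_res_map (M' : zmodType) (a : M -> M') f z m : {morph a : x y / x - y} ->
  is_res f z m -> exists u, peq (fun x y => a (f x y))
    (cadd (grad u) (pull phi (cut (phi z) (a m)))) z.
Proof.
move=> aB [u fu]; exists (a \o u); apply: punctS fu => x [W Wx Wf].
have a0 : a 0 = 0 by rewrite -(subrr 0) aB subrr.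
have aD : {morph a : x y / x + y}.
  by move=> p q; rewrite -[q in LHS]opprK aB -[- q]sub0r aB a0 sub0r opprK.
exists W => // y y' Wy Wy'; rewrite Wf// /cadd /grad /pull /cut /upper /= aD aB.
by congr (_ + _); do 3?case: ifP => _; rewrite ?aB ?a0.
Qed.

Lemma is_res_grad0 f z : is_res f z 0 -> exists u, peq f (grad u) z.
Proof.
move=> [u fu]; exists u; apply: peq_trans fu _; rewrite cut0.
apply/eqg_peq; exists setT => [|x y _ _]; first exact: filterT.
by rewrite /cadd /pull /czero addr0.
Qed.

Lemma is_res_pflat f z m : punct [set x | {for x, continuous phi} /\ phi x <> phi z] z ->
  is_res f z m -> pflat f z.
Proof.
move=> phiz [u fu]; apply: punctS (punctI phiz fu) => x [[cx xz] fx].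
apply: zflat_eqg (eqg_sym fx) _; apply: zflat_add; first exact: zflat_grad.
by apply: zflat_pull => //; exact: cut_flat.
Qed.

End Residue.

(** * Moving a residue from one point of the plane to another *)

Section Push.
Variables (R : realType) (M : zmodType).
Implicit Types (z w x y : R * R) (m : M).

(* Beyond both endpoints the two rays bound a strip, on which the correction
   term removes the crossings: only the box spanned by [z] and [w] remains. *)
Definition push_potential z w m x : M :=
  if Num.max z.1 w.1 < x.1 then upper z m x - upper w m x else 0.

Definition push z w m : R * R -> R * R -> M :=
  cadd (cadd (cut z m) (copp (cut w m))) (copp (grad (push_potential z w m))).

Lemma push_support z w m x :
  ~ rect (Num.min z.1 w.1) (Num.max z.1 w.1)
         (Num.min z.2 w.2) (Num.max z.2 w.2) x ->
  eqg (push z w m) czero x.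
Proof.
move=> /rectP nx.
have [h|h|h|h] : [\/ x.1 < Num.min z.1 w.1, Num.max z.1 w.1 < x.1,
    x.2 < Num.min z.2 w.2 | Num.max z.2 w.2 < x.2].
  case: (leP (Num.min z.1 w.1) x.1) => h1; last by constructor 1.
  case: (leP x.1 (Num.max z.1 w.1)) => h2; last by constructor 2.
  case: (leP (Num.min z.2 w.2) x.2) => h3; last by constructor 3.
  case: (leP x.2 (Num.max z.2 w.2)) => h4; last by constructor 4.
  by exfalso; apply: nx; rewrite h1 h2 h3 h4.
- exists [set y | y.1 < Num.min z.1 w.1]; first exact: nbhs_gt1.
  move=> y y' /=; rewrite !lt_min => /andP[a1 a2] /andP[a3 a4].
  rewrite /push /cadd /copp /grad /cut /push_potential /czero !gt_max.
  by rewrite !ltNge !(ltW a1, ltW a2, ltW a3, ltW a4) /= !(subrr, oppr0, addr0).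
- exists [set y | Num.max z.1 w.1 < y.1]; first exact: nbhs_lt1.
  move=> y y' /= b b'; rewrite /push /cadd /copp /grad /push_potential b b'.
  move: b b'; rewrite !gt_max => /andP[a1 a2] /andP[a3 a4].
  rewrite /cut a1 a2 a3 a4 /= /czero.
  set p := upper z m y; set q := upper z m y'; set r := upper w m y; set s := upper w m y'.
  apply/eqP; rewrite subr_eq0; apply/eqP.
  by rewrite !opprB addrACA [RHS]addrACA (addrC (- q)).
- exists [set y | y.2 < Num.min z.2 w.2]; first exact: nbhs_gt2.
  move=> y y' /=; rewrite !lt_min => /andP[a1 a2] /andP[a3 a4].
  rewrite /push /cadd /copp /grad /cut /push_potential /czero /upper.
  by rewrite !leNgt a1 a2 a3 a4 /= !subrr !if_same !(subrr, oppr0, addr0).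
- exists [set y | Num.max z.2 w.2 < y.2]; first exact: nbhs_lt2.
  move=> y y' /=; rewrite !gt_max => /andP[a1 a2] /andP[a3 a4].
  rewrite /push /cadd /copp /grad /cut /push_potential /czero /upper.
  by rewrite !(ltW a1, ltW a2, ltW a3, ltW a4) /= !subrr !if_same !(subrr, oppr0, addr0).
Qed.

Lemma push_res (T : topologicalType) (phi : T -> R * R) z w m (t : T) :
  {for t, continuous phi} ->
  is_res phi (pull phi (push z w m)) t
    ((if phi t == z then m else 0) - (if phi t == w then m else 0)).
Proof.
move=> ct; rewrite -[X in is_res _ _ _ X]subr0.
have E v : is_res phi (pull phi (cut v m)) t (if phi t == v then m else 0).
  by case: eqP => [<-|ne]; [exact: is_res_cut|exact: is_res_cut_away].
apply: (is_res_add (f := cadd (pull phi (cut z m)) (copp (pull phi (cut w m))))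
  (h := copp (grad (push_potential z w m \o phi)))).
  by apply: is_res_add => //; exact: is_res_opp.
by apply: is_res_opp; exact: is_res_grad.
Qed.

End Push.

(** * Extending flat cochains from a compact subset of the plane *)

Section Grid.
Variables (R : realType) (M : zmodType).

(** A Lebesgue number for flatness, from compactness of [K]. *)
Lemma uniform_flat (f : R * R -> R * R -> M) (K : set (R * R)) : compact K ->
  (forall k, K k -> zflat f k) -> exists2 e, 0 < e &
    forall k x y w, K k -> ball k e x -> ball k e y -> ball k e w ->
      f x y + f y w = f x w.
Proof.
move=> cK fl.
pose P (e : R) k := forall x y w, ball k e x -> ball k e y -> ball k e w ->
  f x y + f y w = f x w.
have : \forall e \near (0 : R)^'+, K `<=` P e.
  apply: (compact_near_coveringP K).1 => // k Kk.
  have [W /nbhs_ballP[e /= e0 We] Wf] := fl k Kk.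
  exists (ball k (e / 2), [set t | 0 < t < e / 2]) => /=.
    split; first by apply: nbhsx_ballx; rewrite divr_gt0.
    near=> t; apply/andP; split; near: t; first exact: nbhs_right_gt.
    by apply: nbhs_right_lt; rewrite divr_gt0.
  move=> [k' t] /= [kk' /andP[t0 te]] x y w.
  have sub p : ball k' t p -> W p.
    move=> kp; apply: We; rewrite (splitr e); apply: ball_triangle kk' _.
    exact: le_ball (ltW te) _ kp.
  by move=> /sub Wx /sub Wy /sub Ww; exact: Wf.
move=> nP; have [e [e0 Pe]] : exists e, 0 < e /\ K `<=` P e.
  near (0 : R)^'+ => e; exists e; split; first by near: e; exact: nbhs_right_gt.
  by near: e.
by exists e => // k x y w Kk; exact: Pe.
Unshelve. all: by end_near. Qed.

Variable e : R.
Hypothesis e0 : 0 < e.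

Let cell (x : R * R) : int * int := (Num.floor (x.1 / e), Num.floor (x.2 / e)).
Let corner (s : int * int) : R * R := (s.1%:~R * e, s.2%:~R * e).

Let floorE (r : R) : (Num.floor (r / e))%:~R * e <= r < (Num.floor (r / e))%:~R * e + e.
Proof.
have /andP[h1 h2] := floor_itv (r / e).
by move: h1 h2; rewrite ler_pdivlMr// ltr_pdivrMr// intrD mulrDl mul1r => -> ->.
Qed.

Let floor_near (r : R) : exists2 d, 0 < d & forall s, `|s - r| < d ->
  (Num.floor (s / e) = Num.floor (r / e)) \/
  ((Num.floor (r / e))%:~R * e = r /\ Num.floor (s / e) = Num.floor (r / e) - 1).
Proof.
set n := Num.floor (r / e); have /andP[h1 h2] := floorE r; rewrite -/n in h1 h2.
have fl k s : k%:~R * e <= s < k%:~R * e + e -> Num.floor (s / e) = k.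
  move=> h; apply: floor_def.
  by rewrite ler_pdivlMr// ltr_pdivrMr// intrD mulrDl mul1r.
case: (eqVneq (n%:~R * e) r) => [E|ne].
  exists e => // s; rewrite ltr_distl => /andP[s1 s2].
  case: (leP r s) => rs; [left|right; split=> //]; apply: fl; first lra.
  by rewrite intrB mulrBl mul1r E; lra.
have {h1 ne} h1 : n%:~R * e < r by rewrite lt_neqAle ne.
exists (Num.min (r - n%:~R * e) (n%:~R * e + e - r)).
  by rewrite lt_min !subr_gt0 h1.
move=> s; rewrite lt_min !ltr_distl => /andP[/andP[? ?] /andP[? ?]].
by left; apply: fl; lra.
Qed.

(** Away from the corners at most one coordinate of [x] lies on a grid line, so at most two cells
    meet near [x]. With two cells only, flatness of the transitions is mere antisymmetry. *)
Let grid_cells (x : R * R) : corner (cell x) <> x -> exists t,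
  [/\ `|(corner t).1 - (corner (cell x)).1| <= e,
      `|(corner t).2 - (corner (cell x)).2| <= e &
      nbhs x [set y | cell y = cell x \/ cell y = t]].
Proof.
move=> nx; have [d1 d10 D1] := floor_near x.1; have [d2 d20 D2] := floor_near x.2.
have far (n : int) : `|(n - 1)%:~R * e - n%:~R * e| <= e.
  by rewrite -mulrBl -intrB addrAC subrr add0r mulN1r normrN gtr0_norm.
have [x1|x1] := eqVneq (corner (cell x)).1 x.1.
  have x2 : (corner (cell x)).2 != x.2.
    apply/eqP => x2; apply: nx.
    by rewrite [LHS]surjective_pairing x1 x2 -surjective_pairing.
  exists ((cell x).1 - 1, (cell x).2); split=> /=; first exact: far.
    by rewrite subrr normr0 ltW.
  apply: (@box_nbhs _ _ _ (Num.min d1 d2)); first by rewrite lt_min d10.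
  move=> y; rewrite !lt_min => /andP[y1 _] /andP[_ y2].
  have [E2|[E2 _]] := D2 _ y2; last by rewrite /= E2 eqxx in x2.
  by have [E1|[_ E1]] := D1 _ y1; rewrite /cell /= E1 E2; [left|right].
exists ((cell x).1, (cell x).2 - 1); split=> /=.
- by rewrite subrr normr0 ltW.
- exact: far.
apply: (@box_nbhs _ _ _ (Num.min d1 d2)); first by rewrite lt_min d10.
move=> y; rewrite !lt_min => /andP[y1 _] /andP[_ y2].
have [E1|[E1 _]] := D1 _ y1; last by rewrite /= E1 eqxx in x1.
by have [E2|[_ E2]] := D2 _ y2; rewrite /cell /= E1 E2; [left|right].
Qed.

Let grid_isolated (x : R * R) : corner (cell x) = x ->
  punct [set y | corner (cell y) <> y] x.
Proof.
move=> xE; apply: (@box_nbhs _ _ _ e) => // y y1 y2 yx yE; apply: yx.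
have eq1 (a b : int) : `|a%:~R * e - b%:~R * e| < e -> a = b.
  rewrite -mulrBl -intrB normrM (gtr0_norm e0) -[X in _ < X]mul1r ltr_pM2r//.
  by rewrite -intr_norm ltrz1 -[1]add0r ltzD1 normr_le0 subr_eq0 => /eqP.
rewrite -yE -xE; congr corner.
rewrite [LHS]surjective_pairing [RHS]surjective_pairing; congr pair; apply: eq1.
  by move: y1; rewrite -{1}yE -{1}xE.
by move: y2; rewrite -{1}yE -{1}xE.
Qed.

Variables (f : R * R -> R * R -> M) (K : set (R * R)).
Hypothesis fl : forall k x y w, K k ->
  ball k (4 * e) x -> ball k (4 * e) y -> ball k (4 * e) w ->
  f x y + f y w = f x w.

Let close (s : int * int) := exists2 k, K k & ball k (2 * e) (corner s).
Let jump (s t : int * int) : M :=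
  if `[< close s >] && `[< close t >] then f (corner s) (corner t) else 0.
Let local (x : R * R) : M :=
  if `[< close (cell x) >] then f x (corner (cell x)) else 0.

(* Replace [f] on each grid cell by a gradient, keeping the transition between
   two cells when both are close to [K]; the result is flat off the corners. *)
Lemma grid_extension : exists h : R * R -> R * R -> M, (forall x, pflat h x) /\ (forall k, K k -> eqg f h k).
Proof.
have e24 : 2 * e <= 4 * e by rewrite ler_pM2r//; lra.
have e14 : e <= 4 * e by rewrite ler_peMl ?ltW//; lra.
have anti k x y : K k -> ball k (4 * e) x -> ball k (4 * e) y ->
    f x x = 0 /\ f x y = - f y x.
  move=> Kk kx ky; have z t : ball k (4 * e) t -> f t t = 0.
    by move=> kt; apply: (addrI (f t t)); rewrite (fl Kk)// addr0.
  split; first exact: z.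
  by apply/eqP; rewrite -addr_eq0 (fl Kk)// z.
have jss s : jump s s = 0.
  rewrite /jump andbb; case: asboolP => // -[k Kk ks].
  have ks4 : ball k (4 * e) (corner s) by apply: (le_ball e24) ks.
  exact: (anti _ _ _ Kk ks4 ks4).1.
exists (cadd (grad local) (fun x y : R * R => jump (cell x) (cell y))); split.
- suff fx x : corner (cell x) <> x ->
      zflat (cadd (grad local) (fun x y : R * R => jump (cell x) (cell y))) x.
    move=> x; have [/grid_isolated|/fx] := pselect (corner (cell x) = x).
      by apply: punctS => y; exact: fx.
    exact: zflat_pflat.
  move=> nx; apply: zflat_add; first exact: zflat_grad.
  have [t [t1 t2 Wx]] := grid_cells nx.
  have jst : jump (cell x) t = - jump t (cell x).
    rewrite /jump andbC; case: asboolP => [[k Kk kt]|]; last by rewrite oppr0.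
    case: asboolP => [_|]; last by rewrite oppr0.
    apply: (anti _ _ _ Kk _ _).2; last by apply: (le_ball e24) kt.
    (* The factor 4 leaves room for this: one corner lies within [2 * e] of [k], and the
       neighbouring corner less than [2 * e] further away. *)
    have -> : 4 * e = 2 * e + 2 * e by rewrite -mulrDl -natrD.
    have e2 : e < 2 * e by rewrite ltr_pMl// ltr1n.
    by apply: ball_triangle kt _; split; apply: le_lt_trans e2.
  exists [set y | cell y = cell x \/ cell y = t] => //.
  by move=> y y' y'' /= [->|->] [->|->] [->|->];
    rewrite ?jss ?addr0 ?add0r// jst ?addNr ?addrN ?opprK ?addNr ?addrN.
- move=> k Kk; exists (ball k e); first exact: nbhsx_ballx.
  have cornerP x : ball x e (corner (cell x)).
    have [/andP[? ?] /andP[? ?]] := (floorE x.1, floorE x.2).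
    by split; rewrite /ball/= ltr_distl; apply/andP; split; lra.
  have kc x : ball k e x -> ball k (2 * e) (corner (cell x)).
    have -> : 2 * e = e + e by rewrite mulr_natl.
    by move=> kx; apply: ball_triangle kx _; exact: cornerP.
  have cl x : ball k e x -> close (cell x) by move=> /kc; exists k.
  have b1 x : ball k e x -> ball k (4 * e) x by exact: (le_ball e14).
  have b2 x : ball k e x -> ball k (4 * e) (corner (cell x)).
    by move=> /kc; exact: (le_ball e24).
  move=> x y kx ky; rewrite /cadd /grad /local /jump !(asboolT (cl _ kx)) !(asboolT (cl _ ky)) /=.
  rewrite addrAC (fl Kk) ?b1 ?b2//; do ?[exact: b1|exact: b2].
  rewrite -(anti k (corner (cell y)) y Kk (b2 _ ky) (b1 _ ky)).2 (fl Kk) //; do ?[exact: b1|exact: b2].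
Qed.

End Grid.

(** Singularities of [h] cannot be avoided: if [K] surrounds a hole and [f] has monodromy around it,
    no extension is flat on the whole hole. *)
Lemma flat_extension (R : realType) (M : zmodType) (f : R * R -> R * R -> M)
    (K : set (R * R)) : compact K -> (forall k, K k -> zflat f k) ->
  exists h : R * R -> R * R -> M, (forall x, pflat h x) /\ (forall k, K k -> eqg f h k).
Proof.
move=> cK /(uniform_flat cK)[e e0 fl].
have e40 : 0 < e / 4 by rewrite divr_gt0.
apply: (grid_extension e40) => k x y w Kk.
have -> : 4 * (e / 4) = e by rewrite mulrCA mulfV ?mulr1// pnatr_eq0.
exact: fl.
Qed.

(** * Charts of a surface *)

Lemma finite_cover (T : topologicalType) (K : set T) (W : T -> set T) :
  compact K -> (forall x, K x -> nbhs x (W x)) ->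
  exists s : seq T, (forall p, p \in s -> K p) /\
    forall x, K x -> exists2 p, p \in s & W p x.
Proof.
move=> cK Wn.
(* The filter of large finite lists of points of [K]; the covering form of compactness applied to it
   yields one list that serves all points. *)
pose F (U : set (seq T)) := exists2 s0 : seq T, (forall p, p \in s0 -> K p) &
  forall s, {subset s0 <= s} -> (forall p, p \in s -> K p) -> U s.
have FF : Filter F.
  split=> [|U V [s sK sU] [t tK tV]|U V UV [s sK sU]].
  - by exists [::].
  - exists (s ++ t) => [p|r sr rK]; first by rewrite mem_cat => /orP[/sK|/tK].
    by split; [apply: sU|apply: tV] => // p ps; apply: sr; rewrite mem_cat ps ?orbT.
  - by exists s => // t st tK; apply: UV; exact: sU.
have [|s sK sP] := (compact_near_coveringP K).1 cK _ F
    (fun s x => exists2 p, p \in s & W p x) FF.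
  move=> x Kx; exists (W x, [set s | x \in s]) => /=; last first.
    by move=> [y s] /= [Wxy xs]; exists x.
  split; first exact: Wn.
  by exists [:: x] => [p|s + _]; [rewrite inE => /eqP->|apply; rewrite mem_head].
by exists s; split=> //; exact: sP.
Qed.

Lemma finite_singular (T : topologicalType) (M : zmodType) (f : T -> T -> M)
    (K : set T) : compact K -> (forall x, K x -> pflat f x) ->
  exists s : seq T, forall x, K x -> zflat f x \/ x \in s.
Proof.
move=> cK fl; have [s [_ sP]] := finite_cover cK fl.
exists s => x /sP[p ps /= Wpx].
by have [->|/Wpx] := pselect (x = p); [right|left].
Qed.

Section Mix.
Variables (T : topologicalType) (M : zmodType).
Implicit Types (f h : T -> T -> M) (V : set T).

(** Cut and paste of germs: [f] inside [V], [h] outside. On the boundary of [V] the germ is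
    controlled only where [f] and [h] agree. *)
Definition mix V f h : T -> T -> M :=
  fun x y => if `[< V x >] && `[< V y >] then f x y else h x y.

Lemma mix_in V f h z : nbhs z V -> eqg (mix V f h) f z.
Proof. by move=> Vz; exists V => // x y Vx Vy; rewrite /mix !asboolT. Qed.

Lemma mix_out V f h z : nbhs z (~` V) -> eqg (mix V f h) h z.
Proof. by move=> Vz; exists (~` V) => // x y Vx Vy; rewrite /mix asboolF. Qed.

Lemma mix_eq V f h z : eqg f h z -> eqg (mix V f h) h z.
Proof.
by move=> [W Wz Wf]; exists W => // x y Wx Wy; rewrite /mix; case: ifP => // _; exact: Wf.
Qed.

Lemma mix_peq V f h z : peq f h z -> peq (mix V f h) h z.
Proof. by apply: punctS => x; exact: mix_eq. Qed.

End Mix.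

Section Charts.
Variables (R : realType) (S : topologicalType).
Implicit Types (c d : chart R S) (x p : S).

Lemma dom_nbhs c x : chart_dom c x -> nbhs x (chart_dom c).
Proof.
by move=> cx; apply: open_nbhs_nbhs; split=> //; exact: chart_dom_open.
Qed.

Lemma img_nbhs c y :
  (chart_map c @` chart_dom c) y -> nbhs y (chart_map c @` chart_dom c).
Proof.
by move=> cx; apply: open_nbhs_nbhs; split=> //; exact: chart_img_open.
Qed.

Lemma map_cont c x : chart_dom c x -> {for x, continuous (chart_map c)}.
Proof.
move=> cx; have := @chart_map_continuous _ _ c.
rewrite continuous_open_subspace; last exact: chart_dom_open.
by apply; rewrite inE.
Qed.

Lemma inv_cont c y : (chart_map c @` chart_dom c) y ->
  {for y, continuous (chart_inv c)}.
Proof.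
move=> cy; have := @chart_inv_continuous _ _ c.
rewrite continuous_open_subspace; last exact: chart_img_open.
by apply; rewrite inE.
Qed.

Lemma invK c y : (chart_map c @` chart_dom c) y ->
  chart_dom c (chart_inv c y) /\ chart_map c (chart_inv c y) = y.
Proof. by move=> [x cx <-]; rewrite chart_mapK. Qed.

Lemma map_inj c x p : chart_dom c x -> chart_dom c p ->
  chart_map c x = chart_map c p -> x = p.
Proof.
move=> cx cp e; rewrite -(@chart_mapK _ _ c x cx) -(@chart_mapK _ _ c p cp).
by rewrite e.
Qed.

Lemma punct_map c x : chart_dom c x ->
  punct [set y | {for y, continuous (chart_map c)} /\
                 chart_map c y <> chart_map c x] x.
Proof.
move=> cx; apply: filterS (dom_nbhs cx) => y cy yx; split; first exact: map_cont.
by move/(map_inj cy cx).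
Qed.

Definition dist_le (z : R * R) (r : R) : set (R * R) :=
  rect (z.1 - r) (z.1 + r) (z.2 - r) (z.2 + r).
Definition dist_lt (z : R * R) (r : R) : set (R * R) :=
  obox (z.1 - r) (z.1 + r) (z.2 - r) (z.2 + r).

Lemma dist_lt_nbhs z r : 0 < r -> nbhs z (dist_lt z r).
Proof. by move=> r0; apply: obox_nbhs; apply/oboxP; lra. Qed.

Lemma dist_ltW z r r' : r <= r' -> dist_lt z r `<=` dist_le z r'.
Proof. by move=> rr x /oboxP[? ?]; apply/rectP; lra. Qed.

Lemma dist_lt_le z r r' : r < r' -> dist_le z r `<=` dist_lt z r'.
Proof. by move=> rr x /rectP[? ?]; apply/oboxP; lra. Qed.

Lemma dist_leW z r r' : r <= r' -> dist_le z r `<=` dist_le z r'.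
Proof. by move=> rr x /rectP[? ?]; apply/rectP; lra. Qed.

Lemma dist_ltS z r r' : r <= r' -> dist_lt z r `<=` dist_lt z r'.
Proof. by move=> rr x /oboxP[? ?]; apply/oboxP; lra. Qed.

Lemma nbhs_dist z (W : set (R * R)) : nbhs z W ->
  exists2 r, 0 < r & dist_le z r `<=` W.
Proof.
move=> /nbhs_box[e e0 We]; exists (e / 2); first by rewrite divr_gt0.
by move=> x /rectP[x1 x2]; apply: We; rewrite ltr_distl; lra.
Qed.

Lemma rect_compact (a b c d : R) : compact (rect a b c d).
Proof. by apply: compact_setX; exact: segment_compact. Qed.

Definition cbox c p r : set S :=
  [set x | chart_dom c x /\ dist_le (chart_map c p) r (chart_map c x)].
Definition ubox c p r : set S :=
  [set x | chart_dom c x /\ dist_lt (chart_map c p) r (chart_map c x)].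

(** The closed box of half-side [r] must lie in the image of the chart, so that [cbox] is a full box
    transported to the surface, compact in particular. *)
Definition admissible c p r := [/\ 0 < r, chart_dom c p &
  dist_le (chart_map c p) r `<=` chart_map c @` chart_dom c].

Lemma admissible_near c p (W : set S) : chart_dom c p -> nbhs p W ->
  exists2 r, admissible c p r & cbox c p r `<=` W.
Proof.
move=> cp Wp; have ip : (chart_map c @` chart_dom c) (chart_map c p) by exists p.
have : nbhs (chart_map c p) (chart_map c @` chart_dom c `&` (chart_inv c @^-1` W)).
  apply: filterI; first exact: img_nbhs.
  by apply: inv_cont => //; rewrite chart_mapK.
move=> /nbhs_dist[r r0 rW]; exists r; first by split=> // y /rW[].
by move=> x [cx /rW[_]]; rewrite /= chart_mapK.
Qed.

Lemma admissibleW c p r r' : 0 < r' -> r' <= r -> admissible c p r ->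
  admissible c p r'.
Proof. by move=> r0 rr [_ cp sub]; split=> // x /(dist_leW rr)/sub. Qed.

Lemma ubox_nbhs c p r x : ubox c p r x -> nbhs x (ubox c p r).
Proof.
move=> [cx xr]; apply: filterI; first exact: dom_nbhs.
by apply: map_cont => //; exact: obox_nbhs.
Qed.

Lemma ubox_center c p r : 0 < r -> chart_dom c p -> ubox c p r p.
Proof. by move=> r0 cp; split=> //; apply/oboxP; lra. Qed.

Lemma cboxE c p r : admissible c p r ->
  cbox c p r = chart_inv c @` dist_le (chart_map c p) r.
Proof.
move=> [_ _ sub]; apply/seteqP; split=> x.
  by move=> [cx xr]; exists (chart_map c x) => //; rewrite chart_mapK.
by move=> [y yr <-]; have [cy yE] := invK (sub _ yr); split; rewrite ?yE.
Qed.

Lemma cbox_compact c p r : admissible c p r -> compact (cbox c p r).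
Proof.
move=> ad; rewrite cboxE//; apply: continuous_compact; last exact: rect_compact.
have [_ _ sub] := ad.
apply: (@continuous_subspaceW _ _ _ (chart_map c @` chart_dom c)) => //.
exact: chart_inv_continuous.
Qed.

Lemma cbox_closed c p r : hausdorff_space S -> admissible c p r ->
  closed (cbox c p r).
Proof. by move=> hS ad; apply: compact_closed => //; exact: cbox_compact. Qed.

Section ChartFunctions.
Variable M : zmodType.
Implicit Types (f h : S -> S -> M) (F : R * R -> R * R -> M).

Lemma pull_map_inv c f x : chart_dom c x ->
  eqg f (pull (chart_map c) (pull (chart_inv c) f)) x.
Proof.
move=> cx; exists (chart_dom c); first exact: dom_nbhs.
by move=> y y' cy cy'; rewrite /pull !chart_mapK.
Qed.

Lemma zflat_inv c f x : chart_dom c x -> zflat f x ->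
  zflat (pull (chart_inv c) f) (chart_map c x).
Proof.
move=> cx fx; apply: zflat_pull; last by rewrite chart_mapK.
by apply: inv_cont; exists x.
Qed.

Lemma eqg_inv c f h x : chart_dom c x -> eqg f h x ->
  eqg (pull (chart_inv c) f) (pull (chart_inv c) h) (chart_map c x).
Proof.
move=> cx fx; apply: eqg_pull; last by rewrite chart_mapK.
by apply: inv_cont; exists x.
Qed.

Lemma residue_exists c f x : chart_dom c x -> pflat f x ->
  exists m, is_res (chart_map c) f x m.
Proof.
move=> cx fl; have [r [r0 _ sub] rf] := admissible_near cx fl.
have sub' y : dist_lt (chart_map c x) r y -> (chart_map c @` chart_dom c) y.
  by move=> /(dist_ltW (lexx r))/sub.
have [|u [m um]] := @punctured_box_potential R M (pull (chart_inv c) f)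
    (chart_map c x) ((chart_map c x).1 - r) ((chart_map c x).1 + r)
    ((chart_map c x).2 - r) ((chart_map c x).2 + r).
  move=> y yr yx; have [cy yE] := invK (sub' _ yr).
  rewrite -yE; apply: zflat_inv => //; apply: rf.
    by split=> //; rewrite yE; exact: (dist_ltW (lexx r)).
  by move=> e; apply: yx; rewrite -yE e.
exists m, (u \o chart_map c); rewrite /peq /punct.
apply: filterS (ubox_nbhs (ubox_center r0 cx)) => y [cy yr] yx.
apply: eqg_trans (pull_map_inv f cy) _.
have /(eqg_pull (map_cont cy)) := um _ yr (fun e => yx (map_inj cy cx e)).
exact.
Qed.

Lemma polar_near (z : R * R) (r t : R) : 0 < r -> dist_le z r (polar z r t).
Proof.
move=> r0; apply/rectP; rewrite /polar /=.
have : `|r * cos t| <= r by rewrite normrM (gtr0_norm r0) ler_piMr ?cos_max ?ltW.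
have : `|r * sin t| <= r by rewrite normrM (gtr0_norm r0) ler_piMr ?sin_max ?ltW.
by rewrite !ler_norml; lra.
Qed.

Lemma polar_neq (z : R * R) (r t : R) : 0 < r -> polar z r t <> z.
Proof.
move=> r0 /eqP; rewrite -subr_eq0 => /eqP[].
rewrite /polar /= !(addrC z.1, addrC z.2) !addrK => h1 h2.
have := cos2Dsin2 t; move/eqP: h1; move/eqP: h2; rewrite !mulf_eq0 gt_eqF//= => /eqP-> /eqP->.
by rewrite expr0n /= addr0 => /esym/eqP; rewrite oner_eq0.
Qed.

Lemma polar_continuous (z : R * R) (r : R) : continuous (polar z r).
Proof.
have ct (a b : R) (g : R -> R) : continuous g -> continuous (fun t => a + b * g t).
  by move=> gc; have := @caffine R R b a g gc; under eq_fun do rewrite addrC.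
by apply: cpair; apply: ct; [exact: continuous_cos|exact: continuous_sin].
Qed.

End ChartFunctions.
End Charts.

Lemma subr_swap (M : zmodType) (a b c d : M) : a - b = c - d -> a - c = b - d.
Proof.
by move=> /(canRL (subrK _)) ->; rewrite addrAC (addrAC c) subrr add0r addrC.
Qed.

(** * Monodromy along curves and independence of the chart *)

Section Monodromy.
Variables (R : realType) (M : zmodType).

(** The difference of two potentials along the curve is locally constant. This compares two
    expressions of one cochain along one curve, such as those given by two charts. *)
Lemma curve_monodromy (F : R -> R -> M) (V V' : R -> M) (b : R) : 0 <= b ->
  (forall t, `[0, b]%classic t -> exists2 W, nbhs t W &
     forall s s', W s -> `[0, b]%classic s -> W s' -> `[0, b]%classic s' ->
       F s s' = V s - V s') ->
  (forall t, `[0, b]%classic t -> exists2 W, nbhs t W &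
     forall s s', W s -> `[0, b]%classic s -> W s' -> `[0, b]%classic s' ->
       F s s' = V' s - V' s') ->
  V b - V 0 = V' b - V' 0.
Proof.
move=> b0 FV FV'.
have e : V 0 - V' 0 = V b - V' b.
  apply: (connected_const (u := fun t => V t - V' t) (@segment_connected R 0 b)).
  - move=> z zb; have [W Wz WV] := FV z zb; have [W' Wz' WV'] := FV' z zb.
    exists (W `&` W') => [|t [Wt Wt'] tb]; first exact: filterI.
    have : V t - V z = V' t - V' z.
      by rewrite -(WV t z)// ?(WV' t z)//; exact: nbhs_singleton.
    exact: subr_swap.
  - by rewrite /= in_itv /= lexx b0.
  - by rewrite /= in_itv /= lexx b0.
exact/subr_swap/esym.
Qed.

Lemma turns_2pi (z : R) : turns (z + 2 * pi) = turns z + 1.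
Proof. by rewrite -(turnsD z 1) mulr1. Qed.

Lemma turns0 : turns (0 : R) = 0.
Proof. by rewrite /turns mul0r floor0. Qed.

Lemma polar_2pi (z : R * R) (r : R) : polar z r (2 * pi) = polar z r 0.
Proof.
have e : 2 * pi = 0 + 2 * pi * 1%:~R :> R by rewrite add0r mulr1.
by rewrite /polar e (sinD_turn 0 1) (cosD_turn 0 1).
Qed.

(** The circle of radius [2 * r] runs inside the large box but outside the small one, where [F]
    vanishes. Its monodromy is thus zero, and it is also the residue [m] at [z], the only possible
    singularity. *)
Lemma big_circle (F : R * R -> R * R -> M) (z : R * R) (r : R) : 0 < r ->
  (forall x, dist_lt z (4 * r) x -> x <> z -> zflat F x) ->
  (forall x, dist_lt z (4 * r) x -> ~ dist_lt z r x -> eqg F czero x) ->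
  is_res idfun F z 0.
Proof.
move=> r0 fl fz.
have [u [m um]] := punctured_box_potential fl.
have r20 : 0 < 2 * r by rewrite mulr_gt0.
have on t : dist_lt z (4 * r) (polar z (2 * r) t).
  by apply: dist_lt_le (polar_near _ _ r20); rewrite ltr_pM2r// ltr_nat.
(* One of [cos t] and [sin t] is at least [1 / sqrt 2] in absolute value, which exceeds [1 / 2]. *)
have off t : ~ dist_lt z r (polar z (2 * r) t).
  move=> /oboxP; rewrite /polar /= => -[c s].
  have c1 : - 1 < 2 * cos t < 1 by apply/andP; split; nra.
  have s1 : - 1 < 2 * sin t < 1 by apply/andP; split; nra.
  by have := cos2Dsin2 t; nra.
have m0 : m = 0.
  suff : (u (polar z (2 * r) (2 * pi)) + m *~ turns (2 * pi : R)) -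
      (u (polar z (2 * r) 0) + m *~ turns (0 : R)) = 0 - 0.
    rewrite polar_2pi subrr -{1}[2 * pi]add0r turns_2pi turns0 add0r.
    by rewrite mulr0z addr0 mulr1z addrAC subrr add0r.
  apply: (curve_monodromy (F := fun s s' => F (polar z (2 * r) s) (polar z (2 * r) s'))
    (V := fun s => u (polar z (2 * r) s) + m *~ turns s) (V' := fun=> 0)).
  - by rewrite mulr_ge0// pi_ge0.
  - move=> t tb; apply: (curve_potential (phi := idfun) (gam := polar z (2 * r)) (th := idfun)
      (rho := fun=> 2 * r) (z := z)) => //.
    + exact: polar_continuous.
    + by apply: (um _ (on t)); exact: polar_neq.
    + by apply: cvg_within_filter; exact: cvg_id.
  - move=> t tb; have [W Wt WF] := fz _ (on t) (@off t).
    exists (polar z (2 * r) @^-1` W); first exact: polar_continuous.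
    by move=> s s' Ws _ Ws' _; rewrite WF// subrr.
move: um; rewrite m0 => um; exists u; rewrite /peq /punct; apply: filterS (dist_lt_nbhs z (r := 4 * r) _); last by rewrite mulr_gt0.
by move=> x xr xz; exact: um.
Qed.

End Monodromy.

Section Oriented.
Variables (R : realType) (S : topologicalType) (A : set (chart R S)).
Hypothesis atlas : is_atlas A.
Hypothesis oriented : forall c d, A c -> A d ->
  forall x, chart_dom c x -> chart_dom d x ->
  orientation_preserving_at (chart_map d \o chart_inv c) (chart_map c x).
Variable M : zmodType.
Implicit Types (f h : S -> S -> M) (x : S) (m : M).

(** This is where the orientation enters. A small circle around [x] in the chart [c] has an image in
    the chart [d] that winds once around [x]; the two monodromies of [f] along it are [m] and [m'],
    the gradient terms cancelling because the circle closes up. *)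
Lemma residue_chart c d f x m m' : A c -> A d -> chart_dom c x -> chart_dom d x ->
  is_res (chart_map c) f x m -> is_res (chart_map d) f x m' -> m = m'.
Proof.
move=> Ac Ad cx dx [u fu] [v fv].
have : nbhs x (chart_dom d `&` [set y | y <> x ->
    eqg f (cadd (grad u) (pull (chart_map c) (cut (chart_map c x) m))) y /\
    eqg f (cadd (grad v) (pull (chart_map d) (cut (chart_map d x) m'))) y]).
  by apply: filterI; [exact: dom_nbhs|exact: punctI].
move=> /(admissible_near cx)[e [e0 _ sub] eW].
near (0 : R)^'+ => r.
have r0 : 0 < r by near: r; exact: nbhs_right_gt.
have re : r <= e by near: r; exact: nbhs_right_le.
have [th [rho [thc th2pi thP]]] : exists theta rho : R -> R,
    [/\ {within `[0, 2 * pi], continuous theta},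
        theta (2 * pi) = theta 0 + 2 * pi
      & forall t, t \in `[0, 2 * pi] -> 0 < rho t /\
        (chart_map d \o chart_inv c) (polar (chart_map c x) r t) =
        polar ((chart_map d \o chart_inv c) (chart_map c x)) (rho t) (theta t)].
  by near: r; exact: oriented.
rewrite /= (@chart_mapK _ _ c x cx) in thP.
pose z := chart_map c x; pose gam t := chart_inv c (polar z r t).
have img t : (chart_map c @` chart_dom c) (polar z r t).
  by apply: sub; apply: dist_leW re _ (polar_near _ _ r0).
have cgam t : chart_dom c (gam t) /\ chart_map c (gam t) = polar z r t := invK (img t).
have gamx t : gam t <> x.
  by move=> gx; apply: (@polar_neq R z r t r0); rewrite -(cgam t).2 gx.
have gamW t := eW (gam t).
have {}gamW t : chart_dom d (gam t) /\
    (eqg f (cadd (grad u) (pull (chart_map c) (cut (chart_map c x) m))) (gam t) /\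
    eqg f (cadd (grad v) (pull (chart_map d) (cut (chart_map d x) m'))) (gam t)).
  have [|dg] := gamW t; last by move=> /(_ (gamx t)).
  split; first exact: (cgam t).1.
  by rewrite (cgam t).2; exact: dist_leW re _ (polar_near _ _ r0).
have gamc t : {for t, continuous gam}.
  by apply: continuous_comp; [exact: polar_continuous|exact: inv_cont].
have twopi0 : 0 <= 2 * pi :> R by rewrite mulr_ge0// pi_ge0.
suff : (u (gam (2 * pi)) + m *~ turns (2 * pi : R)) - (u (gam 0) + m *~ turns (0 : R)) =
    (v (gam (2 * pi)) + m' *~ turns (th (2 * pi))) - (v (gam 0) + m' *~ turns (th 0)).
  rewrite th2pi /gam polar_2pi turns_2pi turns0 -{1}[2 * pi]add0r turns_2pi turns0 add0r.
  rewrite mulr0z addr0 mulr1z mulrzDr mulr1z [LHS]addrAC subrr add0r => ->.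
  by rewrite opprD addrACA subrr add0r addrAC subrr add0r.
apply: (curve_monodromy (F := fun s s' => f (gam s) (gam s'))
    (V := fun s => u (gam s) + m *~ turns s) (V' := fun s => v (gam s) + m' *~ turns (th s))) => //.
- move=> t tb; apply: (curve_potential (phi := chart_map c) (gam := gam) (th := idfun)
      (rho := fun=> r) (z := z)) => //.
  + exact: (gamW t).2.1.
  + by move=> s _; rewrite (cgam s).2.
  + by apply: cvg_within_filter; exact: cvg_id.
- move=> t tb; apply: (curve_potential (phi := chart_map d) (gam := gam) (th := th)
      (A := `[0, 2 * pi]%classic)
      (rho := rho) (z := chart_map d x)) => //.
  + exact: (gamW t).2.2.
  + by have /subspace_continuousP := thc; apply.
Unshelve. all: by end_near. Qed.

End Oriented.

(** * The residue theorem *)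

Section Surface.
Variables (R : realType) (S : topologicalType) (A : set (chart R S)).
Hypothesis atlas : is_atlas A.
Hypothesis oriented : forall c d, A c -> A d ->
  forall x, chart_dom c x -> chart_dom d x ->
  orientation_preserving_at (chart_map d \o chart_inv c) (chart_map c x).
Hypothesis hS : hausdorff_space S.
Hypothesis cS : compact [set: S].

Section Residues.
Variable M : zmodType.
Implicit Types (f h : S -> S -> M) (x z : S) (m : M).

(** Quantifying over all oriented charts spares the choice of one; a single chart suffices to
    establish it, by [residue_chart]. *)
Definition residue f x m :=
  forall c, A c -> chart_dom c x -> is_res (chart_map c) f x m.

Lemma residue_pflat f x m : residue f x m -> pflat f x.
Proof.
have [c Ac cx] := atlas x; move=> /(_ c Ac cx).
by apply: is_res_pflat; exact: punct_map.
Qed.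

Lemma residue_of_chart c f x m : A c -> chart_dom c x ->
  is_res (chart_map c) f x m -> residue f x m.
Proof.
move=> Ac cx fm d Ad dx.
have [|m' fm'] := @residue_exists R S M d f x dx.
  by apply: is_res_pflat fm; exact: punct_map.
by rewrite (residue_chart oriented Ac Ad cx dx fm fm').
Qed.

Lemma residue_ex f x : pflat f x -> exists m, residue f x m.
Proof.
have [c Ac cx] := atlas x => /(residue_exists cx)[m fm].
by exists m; exact: residue_of_chart fm.
Qed.

Lemma residue_uniq f x m m' : residue f x m -> residue f x m' -> m = m'.
Proof.
have [c Ac cx] := atlas x => /(_ c Ac cx) fm /(_ c Ac cx).
exact: (residue_chart oriented Ac Ac cx cx fm).
Qed.

Lemma residue_peq f h x m : peq f h x -> residue f x m -> residue h x m.
Proof. by move=> fh fm c Ac cx; apply: is_res_peq fh _; exact: fm. Qed.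

Lemma residue_eqg f h x m : eqg f h x -> residue f x m -> residue h x m.
Proof. by move=> /eqg_peq; exact: residue_peq. Qed.

Lemma residue_add f h x m m' :
  residue f x m -> residue h x m' -> residue (cadd f h) x (m + m').
Proof. by move=> fm hm c Ac cx; apply: is_res_add; [exact: fm|exact: hm]. Qed.

Lemma residue_opp f x m : residue f x m -> residue (copp f) x (- m).
Proof. by move=> fm c Ac cx; apply: is_res_opp; exact: fm. Qed.

Lemma residue_flat f x : zflat f x -> residue f x 0.
Proof. by move=> fx c Ac cx; exact: is_res_flat. Qed.

Lemma residue_grad u x : residue (grad u) x 0.
Proof. by apply: residue_flat; exact: zflat_grad. Qed.

Lemma residue_map (M' : zmodType) (a : M -> M') f x m : {morph a : x y / x - y} ->
  residue f x m -> forall c, A c -> chart_dom c x ->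
  is_res (chart_map c) (fun y y' => a (f y y')) x (a m).
Proof. by move=> aB fm c Ac cx; exact: is_res_map (fm c Ac cx). Qed.

Lemma closed_nbhs x (W : set S) : nbhs x W ->
  exists V, [/\ closed V, nbhs x V & V `<=` W].
Proof.
have [c Ac cx] := atlas x => /(admissible_near cx)[r ad rW].
exists (cbox c x r); split=> //; first exact: cbox_closed.
have [r0 _ _] := ad; apply: filterS (ubox_nbhs (ubox_center r0 cx)).
by move=> y [cy yr]; split=> //; exact: dist_ltW yr.
Qed.

(** With zero residue, [f] is a gradient near [z] except at [z] itself. That gradient, flat at [z],
    is pasted in on a closed neighbourhood. *)
Lemma remove_singularity f z : residue f z 0 ->
  exists2 h, zflat h z & forall x, x <> z -> eqg f h x.
Proof.
have [c Ac cz] := atlas z => /(_ c Ac cz)/is_res_grad0[u fu].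
have [V [clV Vz VW]] := closed_nbhs fu.
exists (mix V (grad u) f).
  by apply: zflat_eqg (eqg_sym (mix_in _ _ Vz)) _; exact: zflat_grad.
move=> x xz; apply: eqg_sym; have [Vx|nVx] := pselect (V x).
  by apply: mix_eq; apply: eqg_sym; exact: VW.
by apply: mix_out; apply: open_nbhs_nbhs; split=> //; exact: closed_openC.
Qed.

Lemma pflat_pull c (F : R * R -> R * R -> M) x : chart_dom c x ->
  pflat F (chart_map c x) -> pflat (pull (chart_map c) F) x.
Proof.
move=> cx /(map_cont cx) Fx; apply: filterS2 (punct_map cx) Fx => y yP Fy yx.
have [cy ne] := yP yx; apply: zflat_pull => //.
exact: Fy.
Qed.

(** The flat part [f2] is what remains after one standard singularity is subtracted at each singular
    point. The correction [h], a sum of such cuts, is defined over the whole domain of the chart and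
    not only near [X], so that only [f2] is left to extend. *)
Lemma desingularize c (X : set S) (s : seq S) f : A c -> X `<=` chart_dom c ->
  (forall x, X x -> pflat f x) -> (forall x, X x -> zflat f x \/ x \in s) ->
  exists f2 h, [/\ forall x, X x -> zflat f2 x,
    forall x, chart_dom c x -> pflat h x,
    forall x, X x -> peq f (cadd f2 h) x &
    forall x, X x -> zflat f x -> eqg f (cadd f2 h) x].
Proof.
move=> Ac Xc; elim: s f => [|z s IH] f pf fs.
  have f0 x : eqg f (cadd f czero) x.
    by exists setT => [|y y' _ _]; [exact: filterT|rewrite /cadd /czero addr0].
  exists f, czero; split=> // x.
  - by case/fs.
  - by move=> _; apply: zflat_pflat; exact: zflat0.
  - by move=> _; apply: eqg_peq.
have [[Xz nfz]|zP] := pselect (X z /\ ~ zflat f z); last first.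
  apply: IH => // x Xx; have [|] := fs x Xx; first by left.
  rewrite inE => /orP[/eqP xz|]; last by right.
  by left; apply: contrapT => nfx; apply: zP; rewrite -xz.
have [m fm] := residue_ex (pf z Xz).
pose k := pull (chart_map c) (cut (chart_map c z) m).
have [|f1 f1z ff1] := @remove_singularity (cadd f (copp k)) z.
  rewrite -(subrr m); apply: residue_add fm _; apply: residue_opp.
  by apply: (residue_of_chart Ac (Xc _ Xz)); exact: is_res_cut.
have kx x : X x -> x <> z -> zflat k x.
  move=> Xx xz; apply: zflat_pull; first exact/map_cont/Xc.
  by apply: cut_flat => /(map_inj (Xc _ Xx) (Xc _ Xz)).
have pk x : chart_dom c x -> pflat k x.
  by move=> cx; apply: pflat_pull => //; exact: cut_pflat.
have fk x : x <> z -> eqg f (cadd f1 k) x.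
  move=> /ff1 e; apply: eqg_trans (eqg_add e (eqg_refl k x)).
  exists setT => [|y y' _ _]; first exact: filterT.
  by rewrite /cadd /copp subrK.
have pfk x : peq f (cadd f1 k) x.
  have [->|/fk/eqg_peq//] := pselect (x = z).
  by apply: filterS (@filterT _ (nbhs z) _) => y _; exact: fk.
have [||f2 [h [f2X ph pe ee]]] := IH f1.
- move=> x Xx; have [->|xz] := pselect (x = z); first exact: zflat_pflat.
  apply: (pflat_peq (eqg_peq (ff1 x xz))); apply: pflat_add; first exact: pf.
  by apply: pflat_opp; apply: zflat_pflat; exact: kx.
- move=> x Xx; have [->|xz] := pselect (x = z); first by left.
  have [fx|] := fs x Xx.
    by left; apply: zflat_eqg (ff1 x xz) _; apply: zflat_add => //; apply: zflat_opp; exact: kx.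
  by rewrite inE => /orP[/eqP//|]; right.
have assoc x : eqg (cadd (cadd f2 h) k) (cadd f2 (cadd h k)) x.
  by exists setT => [|y y' _ _]; [exact: filterT|rewrite /cadd addrA].
exists f2, (cadd h k); split=> // x.
- by move=> cx; apply: pflat_add; [exact: ph|exact: pk].
- move=> Xx; apply: peq_trans (pfk x) _; apply: peq_trans (eqg_peq (assoc x)).
  by apply: peq_add; [exact: pe|exact: peq_refl].
- move=> Xx fx; have xz : x <> z by move=> xz; apply: nfz; rewrite -xz.
  apply: eqg_trans (fk x xz) _; apply: eqg_trans (assoc x).
  apply: eqg_add (eqg_refl k x); apply: ee => //.
  by apply: zflat_eqg (ff1 x xz) _; apply: zflat_add => //; apply: zflat_opp; exact: kx.
Qed.

(** The flat part is extended by the grid in the plane, the singular part already extends. Since [f]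
    may be singular on [L], the germs are compared off isolated points in general, and exactly where
    [f] is flat. *)
Lemma chart_extension c p r (L : set S) f : A c -> admissible c p r -> closed L ->
  (forall x, L x -> cbox c p r x -> pflat f x) ->
  exists h, [/\ forall x, cbox c p r x -> pflat h x,
    forall x, L x -> cbox c p r x -> peq f h x &
    forall x, L x -> cbox c p r x -> zflat f x -> eqg f h x].
Proof.
move=> Ac ad clL pf; pose X := L `&` cbox c p r.
have Xc : X `<=` chart_dom c by move=> x [_ []].
have cX : compact X by rewrite /X setIC; apply: compact_closedI => //; exact: cbox_compact.
have pX x : X x -> pflat f x by move=> [Lx xr]; exact: pf.
have [s sP] := finite_singular cX pX.
have [f2 [h [f2X ph pe ee]]] := desingularize Ac Xc pX sP.
have [||F [pF eF]] := @flat_extension R M (pull (chart_inv c) f2) (chart_map c @` X).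
- apply: continuous_compact => //; apply: (@continuous_subspaceW _ _ _ (chart_dom c)) => //.
  exact: chart_map_continuous.
- by move=> _ [x Xx <-]; apply: zflat_inv; [exact: Xc|exact: f2X].
have f2F x : X x -> eqg f2 (pull (chart_map c) F) x.
  move=> Xx; apply: eqg_trans (pull_map_inv f2 (Xc _ Xx)) _.
  by apply: (eqg_pull (map_cont (Xc _ Xx))); apply: eF; exists x.
exists (cadd (pull (chart_map c) F) h); split=> x.
- by move=> [cx _]; apply: pflat_add; [apply: pflat_pull|exact: ph].
- move=> Lx xr; apply: peq_trans (pe x _) _ => //.
  by apply: peq_add (peq_refl h x); apply: eqg_peq; exact: f2F.
- move=> Lx xr fx; apply: eqg_trans (ee x _ fx) _ => //.
  by apply: eqg_add (eqg_refl h x); exact: f2F.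
Qed.

Definition spush (c : chart R S) (K : set S) z w m : S -> S -> M :=
  mix K (pull (chart_map c) (push (chart_map c z) (chart_map c w) m)) czero.

Lemma push_outside (q z w : R * R) r m y : dist_lt q r z -> dist_lt q r w ->
  ~ dist_lt q r y -> eqg (push z w m) czero y.
Proof.
move=> /oboxP[/andP[z1 z2] /andP[z3 z4]] /oboxP[/andP[w1 w2] /andP[w3 w4]] ny.
apply: push_support => /rectP; rewrite !ge_min !le_max => -[/andP[h1 h2] /andP[h3 h4]].
by apply: ny; apply/oboxP; split; apply/andP; split;
  [case/orP: h1|case/orP: h2|case/orP: h3|case/orP: h4] => h;
  (apply: lt_le_trans h || apply: le_lt_trans h _).
Qed.

(** The pushing cochain vanishes outside the small open box, which contains both endpoints, so its
    extension by zero beyond the larger box creates no further residue. *)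
Lemma spush_residue c p r r' z w m y : A c -> admissible c p r -> r' <= r ->
  ubox c p r' z -> ubox c p r' w ->
  residue (spush c (cbox c p r) z w m) y
    ((if y == z then m else 0) - (if y == w then m else 0)) /\
  (~ ubox c p r' y -> eqg (spush c (cbox c p r) z w m) czero y).
Proof.
move=> Ac ad rr [cz zr] [cw wr].
have out : ~ ubox c p r' y -> eqg (spush c (cbox c p r) z w m) czero y.
  move=> ny; have [yr|nyr] := pselect (cbox c p r y); last first.
    apply: mix_out; apply: open_nbhs_nbhs; split=> //.
    by apply: closed_openC; exact: cbox_closed.
  have [cy _] := yr; apply: mix_eq.
  have /(eqg_pull (map_cont cy)) := @push_outside _ _ _ _ m (chart_map c y) zr wr
    (fun yr' => ny (conj cy yr')).
  exact.
split=> //; have [yr|/[dup] ny /out ey] := pselect (ubox c p r' y); last first.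
  case: eqP => [yz|_]; first by exfalso; apply: ny; rewrite yz.
  case: eqP => [yw|_]; first by exfalso; apply: ny; rewrite yw.
  rewrite subr0; apply: residue_flat; apply: zflat_eqg (eqg_sym ey) _; exact: zflat0.
have [cy yr'] := yr.
apply: (residue_eqg (f := pull (chart_map c) (push (chart_map c z) (chart_map c w) m))).
  apply: eqg_sym; apply: mix_in; apply: filterS (ubox_nbhs yr) => t [ct tr].
  by split=> //; exact: dist_ltW tr.
apply: (residue_of_chart Ac cy).
have := push_res (chart_map c z) (chart_map c w) m (map_cont cy).
have E t : chart_dom c t -> (chart_map c y == chart_map c t) = (y == t).
  by move=> ct; apply/eqP/eqP => [/(map_inj cy ct)|->].
by rewrite !E.
Qed.

End Residues.

(** The factor 12 is 3 times 4: cochains are cut off within three times the radius, and the circle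
    argument for a cochain supported in a box needs four times the size of its support. *)
Definition good_box (W : set S) p (b : chart R S * R) :=
  [/\ A b.1, 0 < b.2, admissible b.1 p (12 * b.2) & cbox b.1 p (12 * b.2) `<=` W].

Lemma box_cover (W : S -> set S) : (forall x, nbhs x (W x)) ->
  exists (B : S -> chart R S * R) (l : seq S),
    (forall x, good_box (W x) x (B x)) /\
    forall x, exists2 p, p \in l & cbox (B p).1 p (B p).2 x.
Proof.
move=> Wn.
have /choice[B BP] x : exists b, good_box (W x) x b.
  have [c Ac cx] := atlas x; have [r ad rW] := admissible_near cx (Wn x).
  exists (c, r / 12); have [r0 _ _] := ad.
  have e : 12 * (r / 12) = r by rewrite mulrCA mulfV ?mulr1// pnatr_eq0.
  by split; rewrite /= ?e// divr_gt0.
have [|l [_ lP]] := @finite_cover S setT (fun x => ubox (B x).1 x (B x).2) cS.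
  move=> x _; have [_ r0 [_ cx _] _] := BP x.
  exact: ubox_nbhs (ubox_center r0 cx).
exists B, l; split=> // x; have [//|p ps [cx xr]] := lP x; exists p => //.
by split=> //; exact: dist_ltW xr.
Qed.

(** * The sum of the residues on a closed oriented surface *)

Section TotalResidue.
Variable M : zmodType.
Implicit Types (f h : S -> S -> M) (x z : S) (m : M) (s t : seq S).

Lemma sum_support (rho : S -> M) s t : uniq s -> uniq t -> {subset s <= t} ->
  (forall x, x \notin s -> rho x = 0) ->
  \sum_(x <- t) rho x = \sum_(x <- s) rho x.
Proof.
move=> us ut st r0; rewrite (bigID (mem s)) /= [X in _ + X]big1 ?addr0//.
rewrite -big_filter; apply: perm_big; apply: uniq_perm => //.
  exact: filter_uniq.
by move=> x; rewrite mem_filter; case: (boolP (x \in s)) => // /st ->.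
Qed.

Lemma residue_of_inv (c : chart R S) f p : chart_dom c p ->
  is_res idfun (pull (chart_inv c) f) (chart_map c p) 0 ->
  is_res (chart_map c) f p 0.
Proof.
move=> cp [u fu]; exists (u \o chart_map c); rewrite /peq /punct.
have := map_cont cp fu; apply: filterS2 (dom_nbhs cp) => y cy fy yp.
have e := fy (fun e => yp (map_inj cy cp e)).
exact: eqg_trans (pull_map_inv f cy) (eqg_pull (map_cont cy) e).
Qed.

(** Each residue is pushed to the centre [p], which leaves the sum unchanged. When only [p] may be
    singular, the residue there vanishes by [big_circle], since [f] is zero outside the box. *)
Lemma supported_total_residue (c : chart R S) p r f (rho : S -> M) s : A c ->
  0 < r -> admissible c p (4 * r) ->
  (forall x, residue f x (rho x)) ->
  (forall x, ~ ubox c p r x -> eqg f czero x) ->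
  uniq s -> (forall x, x \notin s -> rho x = 0) -> \sum_(x <- s) rho x = 0.
Proof.
move=> Ac r0 ad fr f0; have [_ cp img] := ad.
have [|t tP] := @finite_singular S M f setT cS.
  by move=> x _; exact: residue_pflat (fr x).
have {tP} : forall x, zflat f x \/ x \in p :: t.
  by move=> x; have [|fx|xt] := tP x; [|left|right; rewrite inE xt orbT].
elim: t f rho s fr f0 => [|z t IH] f rho s fr f0 tP us s0.
  have rp : rho p = 0.
    apply: residue_uniq (fr p) _; apply: (residue_of_chart Ac cp).
    apply: residue_of_inv => //; apply: (big_circle r0) => y yr.
      have [cy yE] := invK (img _ (dist_ltW (lexx _) yr)) => yp.
      rewrite -yE; apply: zflat_inv => //.
      have [//|] := tP (chart_inv c y); rewrite inE => /eqP yp'.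
      by exfalso; apply: yp; rewrite -yE yp'.
    have [cy yE] := invK (img _ (dist_ltW (lexx _) yr)) => yp.
    rewrite -yE; have /(eqg_inv cy) : eqg f czero (chart_inv c y).
      by apply: f0 => -[_]; rewrite yE.
    exact.
  rewrite big1// => x _; have [fx|] := tP x; last by rewrite inE => /eqP->.
  by apply: residue_uniq (fr x) _; exact: residue_flat.
have [zr|nzr] := pselect (ubox c p r z); last first.
  apply: (IH _ _ _ fr f0 _ us s0) => x; have [|] := tP x; first by left.
  rewrite inE => /or3P[/eqP->|/eqP->|xt]; [by right; rewrite mem_head| |by right; apply/orP; right].
  by left; apply: zflat_eqg (eqg_sym (f0 _ nzr)) _; exact: zflat0.
have [zp|/eqP zp] := eqVneq z p.
  apply: (IH _ _ _ fr f0 _ us s0) => x; have [|] := tP x; first by left.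
  by rewrite !inE zp orbA orbb; right.
have pr : ubox c p r p by exact: ubox_center.
have r4 : r <= 4 * r by rewrite ler_peMl ?ler1n// ltW.
pose k := spush c (cbox c p (4 * r)) z p (rho z).
have kP y := @spush_residue M c p (4 * r) r z p (rho z) y Ac ad r4 zr pr.
pose d y := (if y == z then rho z else 0) - (if y == p then rho z else 0).
have fk y : residue (cadd f (copp k)) y (rho y - d y).
  by apply: residue_add; [exact: fr|apply: residue_opp; exact: (kP y).1].
have dz : rho z - d z = 0.
  by rewrite /d eqxx; case: eqP => // _; rewrite subr0 subrr.
have [|f' f'z ff'] := @remove_singularity _ (cadd f (copp k)) z.
  by rewrite -dz.
pose s' := undup (z :: p :: s).
have us' : uniq s' by exact: undup_uniq.
have ss' : {subset s <= s'} by move=> x xs; rewrite mem_undup !inE xs !orbT.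
rewrite -(sum_support us us' ss' s0).
(* The push has residues [rho z] at [z] and [- rho z] at [p], of total zero even when the two points
   coincide. *)
have sd : \sum_(x <- s') d x = 0.
  rewrite /d big_split /= sumrN.
  have one q : q \in s' -> \sum_(x <- s') (if x == q then rho z else 0) = rho z.
    move=> qs; rewrite -big_mkcond /= -big_filter.
    by rewrite (perm_big [:: q]) ?big_seq1// filter_pred1_uniq.
  by rewrite !one ?subrr// mem_undup !inE eqxx ?orbT.
rewrite -[LHS]subr0 -[X in _ - X]sd -sumrB.
apply: (IH f') => //.
- move=> x; have [->|xz] := pselect (x = z); first by rewrite dz; exact: residue_flat.
  exact: residue_eqg (ff' x xz) (fk x).
- move=> x nx; have xz : x <> z by move=> xz; apply: nx; rewrite xz.
  apply: eqg_trans (eqg_sym (ff' x xz)) _.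
  apply: eqg_trans (eqg_add (f0 _ nx) (eqg_opp ((kP x).2 nx))) _.
  by exists setT => [|a b _ _]; [exact: filterT|rewrite /cadd /copp /czero oppr0 addr0].
- move=> x; have [->|xz] := pselect (x = z); first by left.
  have [xp|/eqP xp] := eqVneq x p; first by right; rewrite xp mem_head.
  have [fx|] := tP x; last first.
    rewrite !inE => /or3P[/eqP//|/eqP//|xt]; by right; apply/orP; right.
  left; apply: zflat_eqg (ff' x xz) _; apply: zflat_add => //; apply: zflat_opp.
  have [xr|e] := pselect (ubox c p (4 * r) x).
    have [cx _] := xr; apply: (@zflat_eqg _ _ (pull (chart_map c)
        (push (chart_map c z) (chart_map c p) (rho z)))).
      apply: eqg_sym; apply: mix_in; apply: filterS (ubox_nbhs xr) => y [cy yr].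
      by split=> //; exact: dist_ltW yr.
    apply: zflat_pull; first exact: map_cont.
    apply: zflat_add; last by apply: zflat_opp; exact: zflat_grad.
    have [cz _] := zr; apply: zflat_add; last apply: zflat_opp; apply: cut_flat.
      by move/(map_inj cx cz).
    by move/(map_inj cx cp).
  have e' : ~ ubox c p r x.
    by move=> [cx xr]; apply: e; split=> //; exact: dist_ltS r4 _ xr.
  by apply: zflat_eqg (eqg_sym ((kP x).2 e')) _; exact: zflat0.
- move=> x; rewrite mem_undup !inE !negb_or => /and3P[xz xp xs].
  by rewrite s0// /d (negbTE xz) (negbTE xp) !subr0.
Qed.

Lemma closed_bigcup_seq (l : seq S) (D : S -> set S) :
  (forall p, p \in l -> closed (D p)) -> closed [set x | exists2 p, p \in l & D p x].
Proof.
elim: l => [_|p l IH clD].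
  by rewrite (_ : [set x | _] = set0); [exact: closed0|rewrite predeqE => x; split=> // -[]].
rewrite (_ : [set x | _] = D p `|` [set x | exists2 q, q \in l & D q x]).
  apply: closedU; first by apply: clD; rewrite mem_head.
  by apply: IH => q ql; apply: clD; rewrite inE ql orbT.
rewrite predeqE => x; split=> [[q]|[Dx|[q ql Dq]]].
- by rewrite inE => /orP[/eqP->|ql Dq]; [left|right; exists q].
- by exists p => //; rewrite mem_head.
- by exists q => //; rewrite inE ql orbT.
Qed.

Lemma cbox_nbhs (c : chart R S) p r r' x : r < r' -> cbox c p r x ->
  nbhs x (cbox c p r').
Proof.
move=> rr [cx xr]; have xr' : ubox c p r' x by split=> //; exact: dist_lt_le rr _ xr.
by apply: filterS (ubox_nbhs xr') => y [cy yr]; split=> //; exact: dist_ltW yr.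
Qed.

(** A substitute for a partition of unity. The cochain [b] is [f] on the box of radius [2 * r] and
    zero outside; its uncontrolled germs on the boundary of that box are replaced by means of
    [chart_extension], without touching the places where [b] is already right. *)
Lemma cut_off (c : chart R S) p r (L : set S) f : A c -> 0 < r ->
  admissible c p (12 * r) -> closed L ->
  (forall x, pflat f x) -> (forall x, L x -> peq f czero x) ->
  exists h, [/\ forall x, pflat h x, forall x, cbox c p r x -> peq f h x,
    forall x, L x -> peq h czero x & forall x, ~ ubox c p (3 * r) x -> eqg h czero x].
Proof.
move=> Ac r0 ad clL pf fL.
have adw k : (0 < k)%N -> (k <= 12)%N -> admissible c p (k%:R * r).
  move=> k0 k12; apply: admissibleW ad; first by rewrite mulr_gt0// ltr0n.
  by rewrite ler_pM2r// ler_nat.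
have lt k k' : (k < k')%N -> k%:R * r < k'%:R * r :> R.
  by move=> kk; rewrite ltr_pM2r// ltr_nat.
have r12 : r < 2 * r by rewrite ltr_pMl// ltr1n.
pose V := cbox c p (2 * r); pose V' := cbox c p (4 * r).
have out k x : (0 < k)%N -> (k <= 12)%N -> ~ cbox c p (k%:R * r) x ->
    nbhs x (~` cbox c p (k%:R * r)).
  move=> k0 k12 nx; apply: open_nbhs_nbhs; split=> //.
  by apply: closed_openC; apply: cbox_closed => //; exact: adw.
pose b := mix V f czero.
(* What is kept: the small box, the set [L] where [f] is already trivial, and the outside of the box
   of radius [3 * r]. Only the shell in between, off [L], is filled anew. *)
pose L' := cbox c p r `|` L `|` ~` ubox c p (3 * r).
have bout x : ~ ubox c p (3 * r) x -> eqg b czero x.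
  move=> nx; apply: mix_out; apply: out => // -[cx xr]; apply: nx.
  by split=> //; apply: dist_lt_le xr; exact: lt.
have bD x : cbox c p r x -> eqg b f x.
  by move=> xr; apply: mix_in; exact: cbox_nbhs r12 xr.
have bL x : L x -> peq b czero x by move=> Lx; apply: mix_peq; exact: fL.
have p0 x : pflat (@czero S M) x by apply: zflat_pflat; exact: zflat0.
have [|||h [ph peh eeh]] := @chart_extension M c p (4 * r) L' b Ac.
- exact: adw.
- apply: closedU; first apply: closedU => //.
    by apply: cbox_closed => //; have := adw 1%N; rewrite mul1r; apply.
  rewrite closedC openE => x xr; exact: ubox_nbhs.
- move=> x [[xr|Lx]|nx] _.
  + by apply: (pflat_peq (eqg_peq (eqg_sym (bD _ xr)))).
  + by apply: (pflat_peq (peq_sym (bL _ Lx))).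
  + by apply: (pflat_peq (eqg_peq (eqg_sym (bout _ nx)))).
have hin x : ubox c p (3 * r) x -> cbox c p (4 * r) x /\ eqg (mix V' h czero) h x.
  move=> [cx xr]; have x3 : cbox c p (3 * r) x by split=> //; exact: dist_ltW xr.
  by have h4 := cbox_nbhs (lt 3 4 isT) x3; split; [exact: nbhs_singleton|exact: mix_in].
have hout x : ~ ubox c p (3 * r) x -> eqg (mix V' h czero) czero x.
  move=> nx; have [xV|nV] := pselect (V' x); last by apply: mix_out; exact: out.
  apply: mix_eq; apply: eqg_trans (bout _ nx); apply: eqg_sym.
  apply: eeh => //; first by right.
  by apply: zflat_eqg (eqg_sym (bout _ nx)) _; exact: zflat0.
have r3 x : cbox c p r x -> ubox c p (3 * r) x.
  by move=> [cx xr]; split=> //; apply: dist_lt_le xr; rewrite ltr_pMl// ltr1n.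
exists (mix V' h czero); split=> // x.
- have [/hin[x4 e]|/hout e] := pselect (ubox c p (3 * r) x).
    by apply: (pflat_peq (eqg_peq (eqg_sym e))); exact: ph.
  exact: (pflat_peq (eqg_peq (eqg_sym e))).
- move=> xr; have [x4 e] := hin _ (r3 _ xr).
  apply: peq_trans (eqg_peq (eqg_sym (bD _ xr))) (peq_trans (peh x _ x4) _).
    by left; left.
  exact/eqg_peq/eqg_sym.
- move=> Lx; have [/hin[x4 e]|/hout e] := pselect (ubox c p (3 * r) x).
    apply: peq_trans (eqg_peq e) (peq_trans (peq_sym (peh x _ x4)) (bL _ Lx)).
    by left; right.
  exact: eqg_peq.
Qed.

(** The boxes of a finite cover are peeled off one by one: subtracting the cut-off [h] makes [f]
    trivial on one more box, up to isolated points, and [h] has total residue zero because it is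
    supported in one box. In the end [f] is trivial off isolated points, so all residues vanish. *)
Theorem total_residue f (rho : S -> M) s : (forall x, residue f x (rho x)) ->
  uniq s -> (forall x, x \notin s -> rho x = 0) -> \sum_(x <- s) rho x = 0.
Proof.
have [B [l [BP lP]]] := @box_cover (fun=> setT) (fun=> filterT).
pose D p := cbox (B p).1 p (B p).2.
have clD p : closed (D p).
  have [_ r0 ad _] := BP p; apply: cbox_closed => //; apply: admissibleW ad => //.
  by rewrite ler_peMl ?ler1n// ltW.
(* [q] lists the boxes already treated, on which [f] is trivial off isolated points; [l] lists those
   still to come. *)
move=> fr us s0; pose q : seq S := [::].
have : forall x, (exists2 p, p \in l & D p x) \/ (exists2 p, p \in q & D p x).
  by move=> x; left; exact: lP.
have : forall x, (exists2 p, p \in q & D p x) -> peq f czero x by move=> x [].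
elim: l q f rho s fr us s0 {lP} => [|p l IH] q f rho s fr us s0 fq cov.
  apply: big1 => x _; apply: residue_uniq (fr x) _.
  apply: residue_peq (peq_sym (fq x _)) _; last exact/residue_flat/zflat0.
  by have [[]|] := cov x.
have [Ac r0 ad _] := BP p.
have pf x : pflat f x := residue_pflat (fr x).
have [h [ph hD hq hout]] := cut_off Ac r0 ad (closed_bigcup_seq (fun p _ => clD p)) pf fq.
have /choice[eta hr] x : exists m, residue h x m by apply: residue_ex.
have [|t tP] := @finite_singular S M h setT cS; first by move=> x _; exact: ph.
have t0 x : x \notin t -> eta x = 0.
  have [//|hx _|->//] := tP x; apply: residue_uniq (hr x) _; exact: residue_flat.
pose s' := undup (s ++ t).
have ss' : {subset s <= s'} by move=> x xs; rewrite mem_undup mem_cat xs.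
have us' : uniq s' by exact: undup_uniq.
have h0 : \sum_(x <- s') eta x = 0.
  apply: (@supported_total_residue (B p).1 p (3 * (B p).2) h) => //.
  - by rewrite mulr_gt0.
  - by rewrite mulrA -natrM.
  - by move=> x; rewrite mem_undup mem_cat negb_or => /andP[_]; exact: t0.
rewrite -(sum_support us us' ss' s0) -[LHS]subr0 -[X in _ - X]h0 -sumrB.
have zz x : eqg (cadd (@czero S M) (copp czero)) czero x.
  by exists setT => [|a b _ _]; [exact: filterT|rewrite /cadd /copp /czero subr0].
have ff x : eqg (cadd h (copp h)) czero x.
  by exists setT => [|a b _ _]; [exact: filterT|rewrite /cadd /copp /czero subrr].
apply: (IH (p :: q) (cadd f (copp h))) => //.
- by move=> x; apply: residue_add => //; apply: residue_opp.
- move=> x; rewrite mem_undup mem_cat negb_or => /andP[xs xt].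
  by rewrite s0// t0// subr0.
- move=> x [p']; rewrite inE => /orP[/eqP->|p'q] Dx.
    apply: peq_trans (eqg_peq (ff x)); apply: peq_add (peq_refl _ x).
    exact: hD.
  have qx : exists2 p, p \in q & D p x by exists p'.
  apply: peq_trans (eqg_peq (zz x)); apply: peq_add; first exact: fq.
  by apply: peq_opp; exact: hq.
- move=> x; have [[p']|[p' p'q Dx]] := cov x.
    rewrite inE => /orP[/eqP->|p'l] Dx; first by right; exists p; rewrite ?mem_head.
    by left; exists p'.
  by right; exists p' => //; rewrite inE p'q orbT.
Qed.

End TotalResidue.
End Surface.

(** * Paths and holonomy *)

Section Paths.
Variables (R : realType) (X : topologicalType).
Implicit Types a b c d : X.

(** Paths live on the whole real line, so that any real function can serve as a reparametrization;
    [loop_of] and [path_of] pass to and from loops on the unit interval. *)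
Record path a b := Path {
  path_fun :> R -> X;
  path_cont : continuous path_fun;
  path_src : path_fun 0 = a;
  path_tgt : path_fun 1 = b }.

Definition path_homotopic a b (p q : path a b) := exists H : R * R -> X,
  [/\ continuous H, forall t, H (0, t) = p t, forall t, H (1, t) = q t,
      forall s, H (s, 0) = a & forall s, H (s, 1) = b].

Local Notation "p ~~ q" := (path_homotopic p q) (at level 70).

Lemma double_half (t : R) : t = 2^-1 -> 2 * t = 1.
Proof. by move=> ->; rewrite divff// pnatr_eq0. Qed.

Lemma affine_cont (k h : R) : continuous (fun t : R => k * t + h).
Proof. by apply: caffine => t; exact: cvg_id. Qed.

Lemma join_cont a b c (p : path a b) (q : path b c) :
  continuous (fun t : R => if t <= 2^-1 then p (2 * t + 0) else q (2 * t + (- 1))).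
Proof.
apply: (@pasting R R X id (fun t => p (2 * t + 0))
  (fun t => q (2 * t + (- 1))) 2^-1) => [t||| t /double_half ->].
- exact: cvg_id.
- exact: ccomp (@affine_cont 2 0) (@path_cont _ _ p).
- exact: ccomp (@affine_cont 2 (-1)) (@path_cont _ _ q).
- by rewrite addr0 subrr path_tgt path_src.
Qed.

Lemma join_src a b c (p : path a b) (q : path b c) :
  (if (0 : R) <= 2^-1 then p (2 * 0 + 0) else q (2 * 0 + (- 1))) = a.
Proof. by rewrite invr_ge0 ler0n mulr0 addr0 path_src. Qed.

Lemma join_tgt a b c (p : path a b) (q : path b c) :
  (if (1 : R) <= 2^-1 then p (2 * 1 + 0) else q (2 * 1 + (- 1))) = c.
Proof.
rewrite leNgt half_lt1 /= mulr1 (_ : 2 + -1 = 1) ?path_tgt//.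
by rewrite -[2]/(1 + 1) addrK.
Qed.

Definition join a b c (p : path a b) (q : path b c) : path a c :=
  Path (@join_cont _ _ _ p q) (join_src p q) (join_tgt p q).

Lemma joinE a b c (p : path a b) (q : path b c) t :
  join p q t = if t <= 2^-1 then p (2 * t) else q (2 * t - 1).
Proof. by rewrite /join /= addr0. Qed.

Lemma const_path_cont a : continuous (fun _ : R => a).
Proof. exact: cst_continuous. Qed.

Definition const_path a : path a a := Path (@const_path_cont a) erefl erefl.

Lemma back_cont a b (p : path a b) : continuous (fun t : R => p (-1 * t + 1)).
Proof. exact: ccomp (@affine_cont (-1) 1) (@path_cont _ _ p). Qed.

Lemma back_src a b (p : path a b) : p (-1 * 0 + 1) = b.
Proof. by rewrite mulr0 add0r path_tgt. Qed.

Lemma back_tgt a b (p : path a b) : p (-1 * 1 + 1) = a.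
Proof. by rewrite mulr1 addNr path_src. Qed.

Definition back a b (p : path a b) : path b a :=
  Path (@back_cont _ _ p) (back_src p) (back_tgt p).

Definition unitc (t : R) : R := Num.max 0 (Num.min 1 t).

Lemma unitc_cont : continuous unitc.
Proof.
by apply: cmax; [exact: cst_continuous|apply: cmin; [exact: cst_continuous|move=> t; exact: cvg_id]].
Qed.

Lemma unitc_itv t : 0 <= unitc t <= 1.
Proof. by rewrite le_max lexx ge_max ler01 ge_min lexx. Qed.

Lemma unitc0 : unitc 0 = 0.
Proof. by rewrite /unitc min_r// maxxx. Qed.

Lemma unitc1 : unitc 1 = 1.
Proof. by rewrite /unitc minxx max_r. Qed.

(** The common source of all homotopies below: straight lines in a convex set [C] followed by [F],
    which is a path for reparametrizations and a chart inverse for short paths. [unitc] keeps the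
    homotopy parameter in the interval where convexity applies. *)
Lemma line_homotopy (F : R * R -> X) (C : set (R * R)) (phi psi : R -> R * R)
    a b (p q : path a b) :
  (forall y, C y -> {for y, continuous F}) ->
  (forall y y' s, C y -> C y' -> 0 <= s <= 1 ->
     C ((1 - s) * y.1 + s * y'.1, (1 - s) * y.2 + s * y'.2)) ->
  continuous phi -> continuous psi -> (forall t, C (phi t)) -> (forall t, C (psi t)) ->
  phi 0 = psi 0 -> phi 1 = psi 1 ->
  (forall t, p t = F (phi t)) -> (forall t, q t = F (psi t)) -> p ~~ q.
Proof.
move=> Fc Cc phic psic Cphi Cpsi e0 e1 pE qE.
have lin (s y : R) : (1 - s) * y + s * y = y by rewrite -mulrDl subrK mul1r.
exists (fun st => F ((1 - unitc st.1) * (phi st.2).1 + unitc st.1 * (psi st.2).1,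
                     (1 - unitc st.1) * (phi st.2).2 + unitc st.1 * (psi st.2).2)).
split=> /= [|t|t|s|s].
- have c1 : continuous (fun st : R * R => unitc st.1) by exact: ccomp (@cfst _ _) unitc_cont.
  have c1' : continuous (fun st : R * R => 1 - unitc st.1).
    by have := @caffine R _ (-1) 1 _ c1; under eq_fun do rewrite mulN1r addrC.
  have cp (h : R -> R * R) (hc : continuous h) :
      continuous (fun st : R * R => (h st.2).1) /\ continuous (fun st : R * R => (h st.2).2).
    by split; apply: ccomp (ccomp (@csnd _ _) hc) _; [exact: cfst|exact: csnd].
  move=> st; apply: continuous_comp; last by apply: Fc; apply: Cc => //; exact: unitc_itv.
  by apply: cpair; apply: caddr; apply: cmulr => //;
    [exact: (cp _ phic).1|exact: (cp _ psic).1|exact: (cp _ phic).2|exact: (cp _ psic).2].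
- by rewrite unitc0 subr0 !mul1r !mul0r !addr0 pE -surjective_pairing.
- by rewrite unitc1 subrr !mul1r !mul0r !add0r qE -surjective_pairing.
- by rewrite e0 !lin -surjective_pairing -qE path_src.
- by rewrite e1 !lin -surjective_pairing -qE path_tgt.
Qed.

Lemma reparam (F : R -> X) (phi psi : R -> R) a b (p q : path a b) :
  continuous F -> continuous phi -> continuous psi -> phi 0 = psi 0 -> phi 1 = psi 1 ->
  (forall t, p t = F (phi t)) -> (forall t, q t = F (psi t)) -> p ~~ q.
Proof.
move=> Fc phic psic e0 e1 pE qE.
apply: (@line_homotopy (F \o fst) setT (fun t => (phi t, 0)) (fun t => (psi t, 0))) => //=.
- by move=> y _; apply: continuous_comp; [exact: cfst|exact: Fc].
- by apply: cpair => //; exact: cst_continuous.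
- by apply: cpair => //; exact: cst_continuous.
- by rewrite e0.
- by rewrite e1.
Qed.

Lemma path_homotopic_refl a b (p : path a b) : p ~~ p.
Proof. by apply: (reparam (F := p) (phi := id) (psi := id)) => // [|t|t]; [exact: path_cont|exact: cvg_id..]. Qed.

Lemma path_homotopic_sym a b (p q : path a b) : p ~~ q -> q ~~ p.
Proof.
move=> [H [Hc H0 H1 Hl Hr]].
exists (fun st => H (-1 * st.1 + 1, st.2)); split=> //= [|t|t].
- apply: ccomp Hc; apply: cpair; last exact: csnd.
  by apply: caffine; exact: cfst.
- by rewrite mulr0 add0r.
- by rewrite mulr1 addNr.
Qed.

Lemma path_homotopic_trans a b (q p r : path a b) : p ~~ q -> q ~~ r -> p ~~ r.
Proof.
move=> [H [Hc H0 H1 Hl Hr]] [K [Kc K0 K1 Kl Kr]].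
have sc k h : continuous (fun st : R * R => (k * st.1 + h, st.2)).
  by apply: cpair; [apply: caffine; exact: cfst|exact: csnd].
exists (fun st => if st.1 <= 2^-1 then H (2 * st.1 + 0, st.2)
                  else K (2 * st.1 + -1, st.2)).
split=> /= [|t|t|s|s].
- apply: (pasting (u := fst)); first exact: cfst.
  + exact: ccomp (@sc 2 0) Hc.
  + exact: ccomp (@sc 2 (-1)) Kc.
  by move=> st /double_half ->; rewrite addr0 subrr H1 K0.
- by rewrite invr_ge0 ler0n mulr0 addr0 H0.
- rewrite leNgt half_lt1 /= mulr1 (_ : 2 + -1 = 1) ?K1//.
  by rewrite -[2]/(1 + 1) addrK.
- by case: ifP.
- by case: ifP.
Qed.

Lemma join_homotopic a b c (p p' : path a b) (q q' : path b c) :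
  p ~~ p' -> q ~~ q' -> join p q ~~ join p' q'.
Proof.
move=> [H [Hc H0 H1 Hl Hr]] [K [Kc K0 K1 Kl Kr]].
have sc k h : continuous (fun st : R * R => (st.1, k * st.2 + h)).
  by apply: cpair; [exact: cfst|apply: caffine; exact: csnd].
exists (fun st => if st.2 <= 2^-1 then H (st.1, 2 * st.2 + 0)
                  else K (st.1, 2 * st.2 + -1)).
split=> [|t|t|s|s].
- apply: (pasting (u := snd)); first exact: csnd.
  + exact: ccomp (@sc 2 0) Hc.
  + exact: ccomp (@sc 2 (-1)) Kc.
  by move=> st /double_half ->; rewrite addr0 subrr Hr Kl.
- by rewrite /= H0 K0.
- by rewrite /= H1 K1.
- by rewrite /= invr_ge0 ler0n mulr0 addr0 Hl.
- rewrite /= leNgt half_lt1 /= mulr1 (_ : 2 + -1 = 1) ?Kr//.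
  by rewrite -[2]/(1 + 1) addrK.
Qed.

Lemma join_assoc a b c d (p : path a b) (q : path b c) (r : path c d) :
  join (join p q) r ~~ join p (join q r).
Proof.
(* The reparametrization has slopes 2, 1 and 1/2, with breaks at 1/4 and 1/2; being concave it is
   the minimum of its affine pieces, which gives continuity for free. *)
pose phi (t : R) :=
  Num.min (2 * t + 0) (Num.min (1 * t + 4^-1) (2^-1 * t + 2^-1)).
have phiE t : phi t = if t <= 4^-1 then 2 * t else
    if t <= 2^-1 then t + 4^-1 else 2^-1 * t + 2^-1.
  rewrite /phi; case: (leP (1 * t + 4^-1)) => h1; case: (leP (2 * t + 0)) => h2;
  by case: (leP t 4^-1) => h3; case: (leP t 2^-1) => h4; lra.
apply: (reparam (F := join p (join q r)) (phi := phi) (psi := id)) => //.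
- exact: path_cont.
- by apply: cmin; [exact: affine_cont|apply: cmin; exact: affine_cont].
- by move=> t; exact: cvg_id.
- by rewrite phiE; do ?[case: leP => ?]; lra.
- by rewrite phiE; do ?[case: leP => ?]; lra.
move=> t; rewrite !joinE phiE; case: (leP t 4^-1) => t4.
  have -> : t <= 2^-1 by lra.
  by have -> : 2 * t <= 2^-1 by lra.
case: (leP t 2^-1) => t2.
  have -> : (2 * t <= 2^-1) = false by apply/negbTE; rewrite -ltNge; lra.
  have -> : (t + 4^-1 <= 2^-1) = false by apply/negbTE; rewrite -ltNge; lra.
  have -> : 2 * (t + 4^-1) - 1 <= 2^-1 by lra.
  by congr (q _); lra.
have -> : (2^-1 * t + 2^-1 <= 2^-1) = false by apply/negbTE; rewrite -ltNge; lra.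
have -> : (2 * (2^-1 * t + 2^-1) - 1 <= 2^-1) = false.
  by apply/negbTE; rewrite -ltNge; lra.
by congr (r _); lra.
Qed.

Lemma join_const a b (p : path a b) : join (const_path a) p ~~ p.
Proof.
apply: (reparam (F := p) (phi := fun t => Num.max 0 (2 * t + -1)) (psi := id)) => //.
- exact: path_cont.
- by apply: cmax; [exact: cst_continuous|exact: affine_cont].
- by move=> t; exact: cvg_id.
- by case: leP => ?; lra.
- by case: leP => ?; lra.
move=> t; rewrite joinE; case: (leP t 2^-1) => t2.
  by rewrite max_l ?path_src//; lra.
by rewrite max_r//; lra.
Qed.

Lemma join_back a b (p : path a b) : join (back p) p ~~ const_path b.
Proof.
apply: (reparam (F := p) (phi := fun t => Num.max (-2 * t + 1) (2 * t + -1))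
  (psi := fun=> 1)) => //.
- exact: path_cont.
- by apply: cmax; exact: affine_cont.
- by move=> t; exact: cvg_cst.
- by case: leP => ?; lra.
- by case: leP => ?; lra.
- move=> t; rewrite joinE /=; case: (leP t 2^-1) => t2.
    by rewrite max_l; [congr (p _); lra|lra].
  by rewrite max_r//; lra.
- by move=> t; rewrite path_tgt.
Qed.

Lemma sub_cont a b (p : path a b) (s t : R) :
  continuous (fun r : R => p (s + (t - s) * unitc r)).
Proof.
apply: ccomp (@path_cont _ _ p) => r; have := @caffine R _ (t - s) s _ unitc_cont r.
by under eq_fun do rewrite addrC.
Qed.

Lemma sub_src a b (p : path a b) (s t : R) : p (s + (t - s) * unitc 0) = p s.
Proof. by rewrite unitc0 mulr0 addr0. Qed.

Lemma sub_tgt a b (p : path a b) (s t : R) : p (s + (t - s) * unitc 1) = p t.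
Proof. by rewrite unitc1 mulr1 addrC subrK. Qed.

Definition subpath a b (p : path a b) (s t : R) : path (p s) (p t) :=
  Path (@sub_cont _ _ p s t) (sub_src p s t) (sub_tgt p s t).

Lemma join_sub a b (p : path a b) (r s t : R) :
  join (subpath p r s) (subpath p s t) ~~ subpath p r t.
Proof.
pose k1 (x : R) := unitc (2 * x + 0); pose k2 x := unitc (2 * x + (- 1)).
apply: (reparam (F := p)
  (phi := fun x => ((s - r) * k1 x + 0) + ((t - s) * k2 x + r))
  (psi := fun x => (t - r) * unitc x + r)).
- exact: path_cont.
- apply: caddr; apply: caffine.
    exact: ccomp (@affine_cont 2 0) unitc_cont.
  exact: ccomp (@affine_cont 2 (-1)) unitc_cont.
- by apply: caffine; exact: unitc_cont.
- rewrite /k1 /k2 mulr0 !add0r unitc0 !mulr0 /unitc min_r ?max_l; rewrite ?mulr0; lra.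
- rewrite /k1 /k2 mulr1 addr0 unitc1 /unitc !min_l ?max_r; lra.
- move=> x; rewrite joinE /k1 /k2 !addr0; case: (leP x 2^-1) => x2.
    have -> : unitc (2 * x + (-1)) = 0 by rewrite /unitc min_r ?max_l//; lra.
    by rewrite /=; congr (p _); lra.
  have -> : unitc (2 * x) = 1 by rewrite /unitc min_l ?max_r//; lra.
  by rewrite /=; congr (p _); lra.
- by move=> x /=; rewrite addrC.
Qed.

End Paths.

(** * Classes of loops, and of paths closed up through a base point *)

Section PathClasses.
Local Open Scope quotient_scope.
Local Open Scope group_scope.
Variables (R : realType) (X : topologicalType) (x0 : X).
Local Notation "p ~~ q" := (path_homotopic p q) (at level 70).

Section LoopOf.
Variable p : path R x0 x0.

Lemma loop_of_cont : continuous (fun t : unit_interval R => p (uval t)).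
Proof. exact: ccomp (@uval_continuous R) (@path_cont _ _ _ _ p). Qed.

Lemma loop_of0 : p (uval zero) = x0. Proof. by rewrite uval0 path_src. Qed.
Lemma loop_of1 : p (uval one) = x0. Proof. by rewrite uval1 path_tgt. Qed.

Definition loop_of : loop R x0 := mk_path loop_of_cont loop_of0 loop_of1.

Lemma loop_ofE t : loop_of t = p (uval t). Proof. by []. Qed.

End LoopOf.

Definition loop_class (p : path R x0 x0) : pi1 R x0 := \pi_(pi1 R x0) (loop_of p).

Lemma loop_class_homotopic p q : p ~~ q -> loop_class p = loop_class q.
Proof.
move=> [H [Hc H0 H1 Hl Hr]]; apply/eq_pi1.
exists (fun st => H (uval st.1, uval st.2)); split.
- apply: ccomp Hc; apply: cpair; [exact: ccomp (@cfst _ _) (@uval_continuous R)|].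
  exact: ccomp (@csnd _ _) (@uval_continuous R).
- by move=> t; rewrite /= uval0 H0.
- by move=> t; rewrite /= uval1 H1.
- by move=> s; rewrite /= uval0 Hl.
- by move=> s; rewrite /= uval1 Hr.
Qed.

Lemma loop_eq_class (p q : loop R x0) : p =1 q ->
  \pi_(pi1 R x0) p = \pi_(pi1 R x0) q.
Proof. by move=> pq; congr (\pi_(pi1 R x0) _); apply/path_eqP. Qed.

Lemma loop_class_join p q : loop_class (join p q) = loop_class p * loop_class q.
Proof.
rewrite [RHS]pi1_mulE; apply: loop_eq_class => t; rewrite loop_mulE !loop_ofE joinE.
have /andP[t0 t1] := uval_itv t.
case: (leP (uval t) 2^-1%R) => t2; rewrite clampK//; lra.
Qed.

Lemma loop_class_const : loop_class (const_path R x0) = 1.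
Proof. exact: loop_eq_class. Qed.

Variable P : forall x, path R x0 x.
Hypothesis P0 : P x0 = const_path R x0.

(** The chosen paths [P] retract the fundamental groupoid onto the group at [x0]. *)
Definition path_class a b (s : path R a b) : pi1 R x0 :=
  loop_class (join (P a) (join s (back (P b)))).

Lemma path_class_homotopic a b (s s' : path R a b) :
  s ~~ s' -> path_class s = path_class s'.
Proof.
move=> ss; apply: loop_class_homotopic; apply: join_homotopic.
  exact: path_homotopic_refl.
by apply: join_homotopic => //; exact: path_homotopic_refl.
Qed.

Lemma path_class_join a b c (s : path R a b) (s' : path R b c) :
  path_class (join s s') = path_class s * path_class s'.
Proof.
rewrite /path_class -loop_class_join; apply/esym/loop_class_homotopic.
apply: path_homotopic_trans (join_assoc _ _ _) _.
have J (a' b' c' : X) (u : path R a' b') (v v' : path R b' c') : v ~~ v' -> join u v ~~ join u v'.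
  by move=> vv; apply: join_homotopic => //; exact: path_homotopic_refl.
have J' (a' b' c' : X) (u u' : path R a' b') (v : path R b' c') : u ~~ u' -> join u v ~~ join u' v.
  by move=> vv; apply: join_homotopic => //; exact: path_homotopic_refl.
apply: (J); apply: path_homotopic_trans (join_assoc _ _ _) _.
apply: path_homotopic_trans _ (path_homotopic_sym (join_assoc _ _ _)).
apply: (J); apply: path_homotopic_trans (path_homotopic_sym (join_assoc _ _ _)) _.
apply: path_homotopic_trans (J' _ _ _ _ _ _ (join_back _)) _.
exact: join_const.
Qed.

Lemma path_class_loop (p : path R x0 x0) : path_class p = loop_class p.
Proof.
rewrite /path_class P0 !loop_class_join loop_class_const mul1g.
rewrite -[RHS]mulg1; congr (_ * _); apply: loop_eq_class => t /=.
by [].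
Qed.

Lemma path_class_sub a b (p : path R a b) r s t :
  path_class (subpath p r t) = path_class (subpath p r s) * path_class (subpath p s t).
Proof. by rewrite -path_class_join; apply/esym/path_class_homotopic/join_sub. Qed.

End PathClasses.

Section ChartPaths.
Variables (R : realType) (S : topologicalType).
Implicit Types (c : chart R S) (p x y : S).

Lemma dist_lt_convex (z : R * R) r (y y' : R * R) (s : R) :
  dist_lt z r y -> dist_lt z r y' -> 0 <= s <= 1 ->
  dist_lt z r ((1 - s) * y.1 + s * y'.1, (1 - s) * y.2 + s * y'.2).
Proof.
move=> /oboxP[/andP[h1 h2] /andP[h3 h4]] /oboxP[/andP[k1 k2] /andP[k3 k4]] /andP[s0 s1].
have lo (a u v : R) : a < u -> a < v -> a < (1 - s) * u + s * v.
  move=> au av; have am : a < Num.min u v by rewrite lt_min au.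
  have u1 : (1 - s) * Num.min u v <= (1 - s) * u.
    by rewrite ler_wpM2l ?subr_ge0// ge_min lexx.
  have v1 : s * Num.min u v <= s * v by rewrite ler_wpM2l// ge_min lexx orbT.
  by lra.
have hi (a u v : R) : u < a -> v < a -> (1 - s) * u + s * v < a.
  by move=> ua va; have := lo (- a) (- u) (- v); rewrite !ltrN2 => /(_ ua va); lra.
by apply/oboxP => /=; split; apply/andP; split; auto.
Qed.

Lemma chart_path c p r x y : admissible c p r -> ubox c p r x -> ubox c p r y ->
  exists s : path R x y, forall t, ubox c p r (s t).
Proof.
move=> [r0 cp sub] [cx xr] [cy yr].
pose z := chart_map c x; pose w := chart_map c y.
pose l (t : R) := ((1 - unitc t) * z.1 + unitc t * w.1, (1 - unitc t) * z.2 + unitc t * w.2).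
have lr t : dist_lt (chart_map c p) r (l t).
  by apply: dist_lt_convex => //; exact: unitc_itv.
have img t : (chart_map c @` chart_dom c) (l t) by apply: sub; exact: dist_ltW (lr t).
have lc : continuous l.
  have c1 : continuous (fun t : R => 1 - unitc t).
    by have := @caffine R _ (-1) 1 _ (@unitc_cont R); under eq_fun do rewrite mulN1r addrC.
  by apply: cpair; apply: caddr; apply: cmulr; do ?[exact: c1|exact: unitc_cont|exact: ccst].
have sc : continuous (fun t => chart_inv c (l t)).
  by move=> t; apply: continuous_comp; [exact: lc|exact: inv_cont].
have s0 : chart_inv c (l 0) = x.
  by rewrite /l unitc0 subr0 !mul1r !mul0r !addr0 -surjective_pairing chart_mapK.
have s1 : chart_inv c (l 1) = y.
  by rewrite /l unitc1 subrr !mul1r !mul0r !add0r -surjective_pairing chart_mapK.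
exists (Path sc s0 s1) => t; have [? e] := invK (img t).
by split=> //=; rewrite e.
Qed.

Lemma chart_path_homotopic c p r x y (s s' : path R x y) : admissible c p r ->
  (forall t, ubox c p r (s t)) -> (forall t, ubox c p r (s' t)) ->
  path_homotopic s s'.
Proof.
move=> [r0 cp sub] sr sr'.
have mc (q : path R x y) : (forall t, ubox c p r (q t)) ->
    continuous (fun t => chart_map c (q t)).
  move=> qr t; apply: continuous_comp; first exact: path_cont.
  by apply: map_cont; exact: (qr t).1.
apply: (line_homotopy (F := chart_inv c) (C := dist_lt (chart_map c p) r)
  (phi := fun t => chart_map c (s t)) (psi := fun t => chart_map c (s' t))).
- by move=> y' yr; apply: inv_cont; apply: sub; exact: dist_ltW yr.
- by move=> y1 y2 k; exact: dist_lt_convex.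
- exact: mc.
- exact: mc.
- by move=> t; exact: (sr t).2.
- by move=> t; exact: (sr' t).2.
- by rewrite !path_src.
- by rewrite !path_tgt.
- by move=> t; rewrite chart_mapK//; exact: (sr t).1.
- by move=> t; rewrite chart_mapK//; exact: (sr' t).1.
Qed.

End ChartPaths.

(** * Holonomy of flat cochains along paths *)

Section Holonomy.
Local Open Scope group_scope.
Variables (R : realType) (H : groupType).

Lemma potential_pull (T U : topologicalType) (X : set T) (Y : set U) (phi : T -> U)
    (f : U -> U -> H) (u : U -> H) : continuous phi -> (forall x, X x -> Y (phi x)) ->
  potential Y f u -> potential X (fun x y => f (phi x) (phi y)) (u \o phi).
Proof.
move=> pc XY fu z Xz; have [W Wz Wf] := fu _ (XY _ Xz).
by exists (phi @^-1` W) => [|x y Wx Xx Wy Xy]; [exact: pc|apply: Wf => //; exact: XY].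
Qed.

Lemma flat_pull (T U : topologicalType) (phi : T -> U) (f : U -> U -> H) z :
  {for z, continuous phi} -> flat f (phi z) -> flat (fun x y => f (phi x) (phi y)) z.
Proof.
move=> cz [W Wz Wf]; exists (phi @^-1` W); first exact: cz.
by move=> x y w Wx Wy Ww; exact: Wf.
Qed.

Lemma potential_ratio (T : topologicalType) (X : set T) (f : T -> T -> H) u v :
  connected X -> potential X f u -> potential X f v ->
  forall a b, X a -> X b -> u a / u b = v a / v b.
Proof.
move=> cX fu fv a b Xa Xb; have := potential_unique cX fu fv Xa Xb.
move=> /(congr1 (fun t => u a * t / v b)).
by rewrite mulVKg mulgA mulgK => ->.
Qed.

Variable S : topologicalType.
Implicit Types (f : S -> S -> H).
Local Notation "`I" := (`[0%R : R, 1%R]%classic).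

(** The cochain is pulled back to the interval and integrated there; the ratio of the end values
    does not depend on the potential [v]. *)
Definition holonomy f a b (p : path R a b) (m : H) := exists2 v,
  potential `I (fun s t => f (p s) (p t)) v & v 0%R / v 1%R = m.

Lemma I0 : `I 0%R. Proof. by rewrite /= in_itv /= lexx ler01. Qed.
Lemma I1 : `I 1%R. Proof. by rewrite /= in_itv /= lexx ler01. Qed.

Lemma holonomy_uniq f a b (p : path R a b) m m' :
  holonomy f p m -> holonomy f p m' -> m = m'.
Proof.
move=> [v fv <-] [v' fv' <-].
by apply: (potential_ratio (@segment_connected _ _ _) fv fv'); [exact: I0|exact: I1].
Qed.

Lemma square_potential f (h : R * R -> S) : continuous h -> (forall z, flat f z) ->
  exists u, potential (rect 0 1 0 1) (fun x y => f (h x) (h y)) u.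
Proof.
by move=> hc fl; apply: rect_potential => // z _; apply: flat_pull; [exact: hc|exact: fl].
Qed.

Lemma holonomy_ex f a b (p : path R a b) : (forall z, flat f z) ->
  exists m, holonomy f p m.
Proof.
move=> fl; have [|u fu] := @square_potential f (fun x => p x.1) _ fl.
  exact: ccomp (@cfst _ _) (@path_cont _ _ _ _ p).
exists (u (0%R, 0%R) / u (1%R, 0%R)), (fun t => u (t, 0%R)) => //.
apply: (potential_pull (phi := fun t : R => (t, 0%R)) _ _ fu).
  by apply: cpair; [move=> t; exact: cvg_id|exact: cst_continuous].
by move=> t; rewrite /= in_itv /= => t01; apply/rectP; rewrite /= lexx ler01.
Qed.

(** The cochain pulled back along the homotopy has a potential on the square. On the two sides where
    the endpoint stays fixed this potential takes equal values at the corners, because [f x x = 1];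
    the other two sides compute the two holonomies. *)
Lemma holonomy_homotopic f a b (p q : path R a b) m : (forall z, flat f z) ->
  path_homotopic p q -> holonomy f p m -> holonomy f q m.
Proof.
move=> fl [h [hc h0 h1 hl hr]] pm; have [u fu] := square_potential hc fl.
have side (phi : R -> R * R) : continuous phi -> (forall t, `I t -> rect 0 1 0 1 (phi t)) ->
    potential `I (fun s t => f (h (phi s)) (h (phi t))) (u \o phi).
  by move=> pc pr; exact: potential_pull fu.
have cc (k : R) : continuous (fun t : R => (k, t)) /\ continuous (fun t : R => (t, k)).
  by split; apply: cpair; try exact: cst_continuous; move=> t; exact: cvg_id.
have inr (k : R) : (0 <= k <= 1)%R -> forall t, `I t -> rect 0 1 0 1 (k, t) /\ rect 0 1 0 1 (t, k).
  by move=> k01 t; rewrite /= in_itv /= => t01; split; apply/rectP.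
have k0 : (0 <= (0 : R) <= 1)%R by rewrite lexx ler01.
have k1 : (0 <= (1 : R) <= 1)%R by rewrite lexx ler01.
have flat1 (x : S) : f x x = 1.
  by have [W Wx /(_ x x (nbhs_singleton Wx) (nbhs_singleton Wx))[]] := flat1 (fl x).
have cst (k : R) x : (0 <= k <= 1)%R -> (forall s, h (s, k) = x) ->
    u (0%R, k) = u (1%R, k).
  move=> k01 hk; have := side _ (cc k).2 (fun t It => (inr k k01 t It).2).
  have e : potential `I (fun s t => f (h (s, k)) (h (t, k))) (fun=> 1).
    move=> z _; exists setT => [|s t _ _ _ _]; first exact: filterT.
    by rewrite !hk flat1 divg1.
  move=> /(potential_ratio (@segment_connected _ _ _)) /(_ e _ _ I0 I1).
  by rewrite divg1 => /divg1_eq.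
have pP : holonomy f p (u (0%R, 0%R) / u (0%R, 1%R)).
  exists (fun t => u (0%R, t)) => //.
  have := side _ (cc 0%R).1 (fun t It => (inr _ k0 t It).1).
  by under [X in potential _ X]eq_fun do under eq_fun do rewrite !h0.
exists (fun t => u (1%R, t)).
  have := side _ (cc 1%R).1 (fun t It => (inr _ k1 t It).1).
  by under [X in potential _ X]eq_fun do under eq_fun do rewrite !h1.
by rewrite -(cst _ _ k0 hl) -(cst _ _ k1 hr); exact: holonomy_uniq pP pm.
Qed.

Lemma holonomy_join f a b c (p : path R a b) (q : path R b c) m :
  holonomy f (join p q) m ->
  exists m1 m2, [/\ holonomy f p m1, holonomy f q m2 & m = m1 * m2].
Proof.
move=> [v fv <-].
pose l (t : R) := (2^-1 * t + 0)%R; pose r (t : R) := (2^-1 * t + 2^-1)%R.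
have half (t : R) : `I t -> `I (l t) /\ `I (r t).
  by rewrite /= !in_itv /= /l /r => /andP[t0 t1]; split; apply/andP; split; lra.
have jl t : `I t -> join p q (l t) = p t.
  move=> It; have /andP[t0 t1] : (0 <= t <= 1)%R by move: It; rewrite /= in_itv.
  rewrite joinE /l.
  have -> : (2^-1 * t + 0 <= 2^-1)%R by lra.
  by congr (p _); lra.
have jr t : `I t -> join p q (r t) = q t.
  move=> It; have /andP[t0 t1] : (0 <= t <= 1)%R by move: It; rewrite /= in_itv.
  rewrite joinE /r.
  case: (leP (2^-1 * t + 2^-1) 2^-1)%R => h; last by congr (q _); lra.
  have -> : t = 0%R by lra.
  by rewrite mulr0 add0r divff ?pnatr_eq0// path_tgt path_src.
have pl := potential_pull (@affine_cont R 2^-1 0) (fun t It => (half t It).1) fv.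
have pr := potential_pull (@affine_cont R 2^-1 2^-1) (fun t It => (half t It).2) fv.
have ext (h h' : R -> S) u : (forall t, `I t -> h t = h' t) ->
    potential `I (fun s t => f (h s) (h t)) u -> potential `I (fun s t => f (h' s) (h' t)) u.
  move=> hh' fu z Iz; have [W Wz Wf] := fu z Iz; exists W => // x y Wx Ix Wy Iy.
  by rewrite -!hh'//; exact: Wf.
exists (v 0%R / v (2^-1)%R), (v (2^-1)%R / v 1%R); split.
- exists (v \o l); first exact: ext jl pl.
  by rewrite /l /= mulr0 addr0 mulr1 addr0.
- exists (v \o r); first exact: ext jr pr.
  by rewrite /r /= mulr0 add0r mulr1; congr (_ / v _); lra.
- by rewrite divgKA.
Qed.

End Holonomy.

Section HolonomyMorphism.
Local Open Scope quotient_scope.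
Local Open Scope group_scope.
Variables (R : realType) (S : topologicalType) (x0 : S).

Section PathOf.
Variable l : loop R x0.

Lemma path_of_cont : continuous (fun t : R => l (clamp t)).
Proof. exact: ccomp (@clamp_continuous R) (@loop_continuous _ _ _ l). Qed.

Lemma path_of0 : l (clamp 0) = x0. Proof. exact: path_zero. Qed.
Lemma path_of1 : l (clamp 1) = x0. Proof. exact: path_one. Qed.

Definition path_of : path R x0 x0 := Path path_of_cont path_of0 path_of1.

End PathOf.

Lemma path_ofK (l : loop R x0) : loop_class (path_of l) = \pi_(pi1 R x0) l.
Proof. by apply: loop_eq_class => t; rewrite loop_ofE /= uvalK. Qed.

Lemma path_of_homotopic (l l' : loop R x0) :
  homotopic l l' -> path_homotopic (path_of l) (path_of l').
Proof.
move=> [h [hc h0 h1 hl hr]]; exists (fun st => h (clamp st.1, clamp st.2)); split => //.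
- apply: ccomp hc; apply: cpair; [exact: ccomp (@cfst _ _) (@clamp_continuous R)|].
  exact: ccomp (@csnd _ _) (@clamp_continuous R).
Qed.

Lemma path_of_loop (p : path R x0 x0) : path_homotopic (path_of (loop_of p)) p.
Proof.
apply: (reparam (F := p) (phi := @unitc R) (psi := id)) => //.
- exact: path_cont.
- exact: unitc_cont.
- by move=> t; exact: cvg_id.
- exact: unitc0.
- exact: unitc1.
Qed.

Lemma holonomy_morphism (H : groupType) (f : S -> S -> H) : (forall z, flat f z) ->
  exists2 h : pi1 R x0 -> H, {morph h : x y / x * y} &
    forall p : path R x0 x0, holonomy f p (h (loop_class p)).
Proof.
move=> fl; have /choice[h hP] (x : pi1 R x0) : exists m, holonomy f (path_of (repr x)) m.
  exact: holonomy_ex.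
have hl (p : path R x0 x0) : holonomy f p (h (loop_class p)).
  apply: (holonomy_homotopic fl (path_of_loop p)).
  apply: (holonomy_homotopic fl (path_of_homotopic _) (hP _)).
  exact: repr_pi1.
exists h => // x y; rewrite -[x]reprK -[y]reprK -!path_ofK -loop_class_join.
have [m1 [m2 [h1 h2 ->]]] := holonomy_join (hl (join (path_of (repr x)) (path_of (repr y)))).
by congr (_ * _); [exact: holonomy_uniq h1 (hl _)|exact: holonomy_uniq h2 (hl _)].
Qed.

End HolonomyMorphism.

(** * The cochain of short paths, and finite generation of surface groups *)

Section CoverCochain.
Local Open Scope group_scope.
Variables (R : realType) (S : topologicalType) (A : set (chart R S)).
Hypothesis atlas : is_atlas A.
Hypothesis hS : hausdorff_space S.
Hypothesis cS : compact [set: S].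
Hypothesis connS : connected [set: S].
Variable x0 : S.

Lemma path_connected (x : S) : exists p : path R x0 x, True.
Proof.
apply: (connected_loc (P := fun x => exists p : path R x0 x, True) connS _ (a := x0)) => //.
  move=> z _; have [c Ac cz] := atlas z.
  have [r ad _] := admissible_near cz (@filterT _ (nbhs z) _).
  have [r0 _ _] := ad; have zz := ubox_center r0 cz.
  exists (ubox c z r); first exact: ubox_nbhs.
  move=> y yr _; split=> -[p _].
    by have [s _] := chart_path ad yr zz; exists (join p s).
  by have [s _] := chart_path ad zz yr; exists (join p s).
by exists (const_path R x0).
Qed.

(** The case distinction makes the path at [x0] literally constant, so that closing up a loop at
    [x0] does not change its class. *)
Lemma base_paths : exists P : forall x, path R x0 x, P x0 = const_path R x0.
Proof.
pose Q x := projT1 (cid (path_connected x)).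
pose P x := match pselect (x0 = x) with
  | left e => match e in _ = y return path R x0 y with erefl => const_path R x0 end
  | right _ => Q x end.
exists P; rewrite /P; case: pselect => [e|//].
by rewrite (Prop_irrelevance e erefl).
Qed.

Lemma nbhs_all (T : topologicalType) (z : T) (I : eqType) (l : seq I) (W : I -> set T) :
  (forall i, i \in l -> nbhs z (W i)) -> nbhs z [set x | forall i, i \in l -> W i x].
Proof.
elim: l => [_|i l IH Wz]; first by apply: filterS (@filterT _ (nbhs z) _) => x _ i.
have Wl : nbhs z [set x | forall i, i \in l -> W i x].
  by apply: IH => j jl; apply: Wz; rewrite inE jl orbT.
apply: filterS2 (Wz i (mem_head _ _)) Wl => x Wix Wlx j.
by rewrite inE => /orP[/eqP->|/Wlx].
Qed.

(* The cochain describing the universal covering: [g x y] is the class of a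
   short path from [x] to [y]; it is well defined on small sets only. *)
Lemma cover_cochain : exists g : S -> S -> pi1 R x0,
  (forall z, flat g z) /\
  forall p : path R x0 x0, holonomy g p (loop_class p).
Proof.
have [P P0] := base_paths; pose cl := path_class P.
have [B [l [BP lP]]] := @box_cover R S A atlas cS (fun=> setT) (fun=> filterT).
pose near k p : set S := ubox (B p).1 p (k%:R * (B p).2)%R.
have adm k p : (0 < k)%N -> (k <= 12)%N -> admissible (B p).1 p (k%:R * (B p).2)%R.
  move=> k0 k12; have [_ r0 ad _] := BP p; apply: admissibleW ad.
    by rewrite mulr_gt0// ltr0n.
  by rewrite ler_pM2r// ler_nat.
have lt p k k' : (k < k')%N -> (k%:R * (B p).2 < k'%:R * (B p).2)%R.
  by have [_ r0 _ _] := BP p => kk; rewrite ltr_pM2r// ltr_nat.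
pose good x y m := exists2 p, p \in l & [/\ near 2%N p x, near 2%N p y &
  exists2 s : path R x y, (forall t, near 2%N p (s t)) & m = cl _ _ s].
have /choice[g0 g0P] (xy : S * S) : exists m,
    (exists m', good xy.1 xy.2 m') -> good xy.1 xy.2 m.
  have [[m gm]|ng] := pselect (exists m', good xy.1 xy.2 m'); first by exists m.
  by exists 1.
pose g x y := g0 (x, y).
(* Near [z], the only visible boxes of half-side [2 * r] are those containing [z], and their
   enlargements to [3 * r] contain a whole neighbourhood of [z]. The path chosen for [g x y] and any
   path close to [z] thus lie in one box, where they are homotopic. *)
have local z : exists (c : chart R S) (r : R), admissible c z r /\ forall x y (s : path R x y),
    (forall t, ubox c z r (s t)) -> g x y = cl _ _ s.
  have [c Ac cz] := atlas z.
  have : nbhs z ([set x | forall p, p \in l -> cbox (B p).1 p (2%:R * (B p).2)%R z -> near 3%N p x] `&`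
      [set x | forall p, p \in l -> ~ cbox (B p).1 p (2%:R * (B p).2)%R z ->
         ~ cbox (B p).1 p (2%:R * (B p).2)%R x] `&`
      [set x | forall p, p \in l -> cbox (B p).1 p (B p).2 z -> near 2%N p x]).
    apply: filterI; [apply: filterI|]; apply: nbhs_all => p pl.
    - have [zp|nzp] := pselect (cbox (B p).1 p (2%:R * (B p).2)%R z).
        have zu : near 3%N p z by split; [exact: zp.1|exact: dist_lt_le (lt p 2%N 3%N isT) _ zp.2].
        by apply: filterS (ubox_nbhs zu) => x xr _.
      by apply: filterS (@filterT _ (nbhs z) _) => x _.
    - have [zp|nzp] := pselect (cbox (B p).1 p (2%:R * (B p).2)%R z).
        by apply: filterS (@filterT _ (nbhs z) _) => x _.
      apply: (@filterS _ (nbhs z) _ (~` cbox (B p).1 p (2%:R * (B p).2)%R)) => [x nx _ //|].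
      apply: open_nbhs_nbhs; split=> //; apply: closed_openC; apply: cbox_closed => //.
      exact: adm.
    - have [zp|nzp] := pselect (cbox (B p).1 p (B p).2 z).
        have r12 : ((B p).2 < 2%:R * (B p).2)%R by have [_ ? _ _] := BP p; rewrite ltr_pMl// ltr1n.
        have zu : near 2%N p z by split; [exact: zp.1|exact: dist_lt_le r12 _ zp.2].
        by apply: filterS (ubox_nbhs zu) => x xr _.
      by apply: filterS (@filterT _ (nbhs z) _) => x _.
  move=> /(admissible_near cz)[r ad rW]; exists c, r; split=> // x y s sr.
  move: rW => rW0; pose rW w (wr : ubox c z r w) := rW0 w (conj wr.1 (dist_ltW (lexx r) wr.2)).
  have xr : ubox c z r x by rewrite -(path_src s).
  have yr : ubox c z r y by rewrite -(path_tgt s).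
  have [p pl zp] := lP z.
  have [|q ql [xq yq [s' s'q e]]] := g0P (x, y).
    exists (cl _ _ s), p => //; split; [exact: (rW _ xr).2|exact: (rW _ yr).2|].
    by exists s => // t; exact: (rW _ (sr t)).2.
  rewrite /g e; apply: path_class_homotopic.
  have zq : cbox (B q).1 q (2%:R * (B q).2)%R z.
    apply: contrapT => nzq; apply: ((rW _ xr).1.2 q ql nzq).
    by split; [exact: xq.1|exact: dist_ltW xq.2].
  apply: (chart_path_homotopic (adm 3%N q isT isT)) => t.
    by have [? h] := s'q t; split=> //; apply: dist_ltS h; exact/ltW/lt.
  exact: ((rW _ (sr t)).1.1 q ql zq).
exists g; split=> [z|p].
  have [c [r [ad gE]]] := local z; have [r0 cz _] := ad.
  exists (ubox c z r); first exact/ubox_nbhs/ubox_center.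
  move=> x y w xr yr wr.
  have [s sr] := chart_path ad xr yr; have [s' sr'] := chart_path ad yr wr.
  rewrite (gE _ _ s)// (gE _ _ s')// (gE _ _ (join s s')) ?[RHS]path_class_join//.
  by move=> t; rewrite joinE; case: ifP.
(* The inverse is due to the convention [u s / u t]: it turns the class from 0 to [t] into the class
   from [s] to [t]. *)
exists (fun t => (cl _ _ (subpath p 0%R t))^-1).
  move=> t0 It0; have [c [r [ad gE]]] := local (p t0); have [r0 cz _] := ad.
  have /(@path_cont _ _ _ _ p) /= : nbhs (p t0) (ubox c (p t0) r).
    exact/ubox_nbhs/ubox_center.
  move=> /nbhs_ballR[e e0 eW].
  exists (ball t0 e); first exact: nbhsx_ballx.
  move=> s t; rewrite /ball /= !ltr_distlC => /andP[s1 s2] _ /andP[t1 t2] _.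
  rewrite (gE _ _ (subpath p s t)) => [|k].
    by rewrite /= invgK [cl _ _ (subpath p 0%R t)](path_class_sub P p 0%R s t) mulKg.
  apply: eW; have /andP[k0 k1] := unitc_itv k; rewrite ltr_distlC.
  have [st|ts] := lerP s t.
    have h0 : (0 <= (t - s) * unitc k)%R by rewrite mulr_ge0// subr_ge0.
    have h1 : ((t - s) * unitc k <= t - s)%R by rewrite ler_piMr// subr_ge0.
    by apply/andP; split; lra.
  have h0 : (0 <= (s - t) * unitc k)%R by rewrite mulr_ge0// subr_ge0 ltW.
  have h1 : ((s - t) * unitc k <= s - t)%R by rewrite ler_piMr// subr_ge0 ltW.
  by apply/andP; split; lra.
have e1 : cl _ _ (subpath p 0%R 0%R) = 1.
  apply: (mulgI (cl _ _ (subpath p 0%R 0%R))).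
  by rewrite -[LHS](path_class_sub P p 0%R 0%R 0%R) mulg1.
rewrite e1 invg1 mul1g invgK -(path_class_loop P0).
(* The ends [p 0] and [p 1] equal [x0] only by proof; they are generalized so that these equations
   can be eliminated from the type of the path. *)
have sub_class a b (q q' : path R x0 x0) (s : path R a b) :
    a = x0 -> b = x0 -> (forall t, s t = q (unitc t)) -> cl _ _ s = cl _ _ q.
  move=> ea eb; case: _ / (esym ea) s; case: _ / (esym eb) => s sq.
  apply: path_class_homotopic; apply: (reparam (F := q) (phi := @unitc R) (psi := id)) => //.
  - exact: path_cont.
  - exact: unitc_cont.
  - by move=> t; exact: cvg_id.
  - exact: unitc0.
  - exact: unitc1.
apply: sub_class => //; [exact: path_src|exact: path_tgt|].
by move=> t /=; rewrite subr0 mul1r add0r.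
Qed.

Lemma locally_constant_finite (Y : Type) (K : set S) (u : S -> Y) : compact K ->
  (forall z, K z -> exists2 W, nbhs z W & forall x, W x -> K x -> u x = u z) ->
  exists s : seq S, forall x, K x -> exists2 p, p \in s & u x = u p.
Proof.
move=> cK loc; have [|s [_ sP]] := @finite_cover S K (fun z => [set x | K x -> u x = u z]) cK.
  by move=> z Kz; have [W Wz Wu] := loc z Kz; apply: filterS Wz => x; exact: Wu.
by exists s => x Kx; have [p ps up] := sP x Kx; exists p => //; exact: up.
Qed.

(** Over each box of a finite cover [g] has the potential [g x i]. The transition between two of
    these is locally constant on a compact, possibly disconnected intersection, hence takes finitely
    many values. These values and one base value generate every holonomy. *)
Lemma holonomy_finitely_generated (H : groupType) (g : S -> S -> H) :
  (forall z, flat g z) -> exists s : seq H,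
  forall (p : path R x0 x0) m, holonomy g p m -> m \in generated [set` s].
Proof.
move=> fl; have /choice[W WP] (z : S) : exists W : set S, nbhs z W /\
    forall x y w, W x -> W y -> W w -> g x y * g y w = g x w.
  by have [W Wz Wf] := fl z; exists W.
have [B [l [BP lP]]] := @box_cover R S A atlas cS W (fun z => (WP z).1).
pose K p := cbox (B p).1 p (B p).2.
have adK p : admissible (B p).1 p (B p).2.
  have [_ r0 ad _] := BP p; apply: admissibleW ad => //.
  by rewrite ler_peMl ?ler1n// ltW.
have KW p x : K p x -> nbhs x (W p).
  move=> Kx; have [_ r0 _ sub] := BP p; apply: (@filterS _ (nbhs x) _ (cbox (B p).1 p (12 * (B p).2)%R)) => //.
  by apply: cbox_nbhs Kx; rewrite ltr_pMl// ltr1n.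
have clK p : closed (K p) by exact: cbox_closed.
have Wp p : W p p := nbhs_singleton (WP p).1.
pose tr i j x := (g x i)^-1 * g x j.
have gV i x y : W i x -> W i y -> g x y = g x i * (g y i)^-1.
  by move=> Wx Wy; rewrite -((WP i).2 x y i)// ?mulgK//; exact: Wp.
have /choice[v vP] (ij : S * S) : exists s : seq S, forall x, K ij.1 x -> K ij.2 x ->
    exists2 p, p \in s & tr ij.1 ij.2 x = tr ij.1 ij.2 p.
  case: ij => i j /=; have [||s sP] := @locally_constant_finite _ (K i `&` K j) (tr i j).
  - by apply: compact_closedI => //; exact: cbox_compact.
  - move=> z [Kiz Kjz]; exists (W i `&` W j); first by apply: filterI; exact: KW.
    move=> x [Wix Wjx] _; have [Wiz Wjz] := (nbhs_singleton (KW _ _ Kiz), nbhs_singleton (KW _ _ Kjz)).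
    have e : g x z = g x z by [].
    rewrite {1}(gV i x z)// (gV j x z)// in e; rewrite /tr.
    have -> : g x j = g x i * (g z i)^-1 * g z j by rewrite e mulgVK.
    by rewrite !mulgA mulVg mul1g.
  - by exists s => x Kix Kjx; exact: sP.
have [i0 i0l Ki0] := lP x0.
pose gens := g x0 i0 :: [seq tr ij.1 ij.2 x | ij <- [seq (i, j) | i <- l, j <- l], x <- v ij].
exists gens => p m [u gu <-].
have inH i j x : i \in l -> j \in l -> K i x -> K j x -> tr i j x \in generated [set` gens].
  move=> il jl Kix Kjx; have [q qs ->] := vP (i, j) x Kix Kjx.
  apply: mem_generated => /=; rewrite inE; apply/orP; right.
  by apply/allpairsPdep; exists (i, j), q; split=> //; apply/allpairsP; exists (i, j).
(* While the path stays near box [i], [c t i] is constant in [t]; passing from box [i] to box [j]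
   multiplies it by a transition, so the ratio to its initial value stays in the generated
   subgroup. *)
pose c t i := (u t)^-1 * g (p t) i.
pose Q t := forall i, i \in l -> K i (p t) -> (c 0%R i0)^-1 * c t i \in generated [set` gens].
have Q0 : Q 0%R.
  move=> i il; rewrite path_src => Kix.
  rewrite /c path_src invgM invgK !mulgA mulgK -/(tr i0 i x0).
  exact: inH.
have Q1 : Q 1%R.
  apply: (connected_loc (P := Q) (@segment_connected R 0 1) _ (I0 R) Q0 (I1 R)).
  move=> t It; have [V Vt Vg] := gu t It.
  have : nbhs (p t) [set x | forall i, i \in l -> (K i (p t) -> W i x) /\ (~ K i (p t) -> ~ K i x)].
    apply: nbhs_all => i il; have [Kt|nKt] := pselect (K i (p t)).
      by apply: filterS (KW _ _ Kt) => x Wx; split.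
    apply: (@filterS _ (nbhs (p t)) _ (~` K i)); first by move=> x nKx; split.
    by apply: open_nbhs_nbhs; split=> //; exact: closed_openC.
  move=> /(@path_cont _ _ _ _ p) /= pW.
  exists (V `&` (p @^-1` [set x | forall i, i \in l -> (K i (p t) -> W i x) /\ (~ K i (p t) -> ~ K i x)])).
    exact: filterI.
  move=> s [Vs sW] Is.
  have cE i : i \in l -> K i (p t) -> c s i = c t i.
    move=> il Kt; have [/(_ Kt) Wis _] := sW i il.
    have : u s / u t = g (p s) i / g (p t) i.
      rewrite -(gV i)//; last exact: nbhs_singleton (KW _ _ Kt).
      by rewrite -(Vg s t)//; exact: nbhs_singleton.
    move=> /(congr1 (fun k => (u s)^-1 * k * g (p t) i)).
    by rewrite mulKg mulgA mulgVK /c => ->.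
  have Ks i : i \in l -> K i (p s) -> K i (p t).
    by move=> il Kis; apply: contrapT => nK; exact: (sW i il).2.
  have [i il Ki] := lP (p s); have Kti := Ks i il Ki.
  have move_ j : j \in l -> K j (p t) -> forall k, k \in l -> K k (p t) ->
      (c 0%R i0)^-1 * c t j \in generated [set` gens] ->
      (c 0%R i0)^-1 * c t k \in generated [set` gens].
    move=> jl Kj k kl Kk h.
    have -> : (c 0%R i0)^-1 * c t k = ((c 0%R i0)^-1 * c t j) * tr j k (p t).
      by rewrite /c /tr !mulgA mulgK.
    by rewrite gpredM//; exact: inH.
  split=> Qx k kl Kk.
    apply: (move_ i il Kti k kl Kk); rewrite -cE//; exact: Qx.
  by rewrite cE//; [apply: (move_ i il Kti k kl (Ks k kl Kk)); exact: Qx|exact: Ks].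
have := Q1 i0 i0l; rewrite path_tgt /c path_src path_tgt => /(_ Ki0) h.
have gi : g x0 i0 \in generated [set` gens].
  by apply: mem_generated; rewrite /= mem_head.
have -> : u 0%R / u 1%R = g x0 i0 * ((((u 0%R)^-1 * g x0 i0)^-1 * ((u 1%R)^-1 * g x0 i0))) * (g x0 i0)^-1.
  by rewrite invgM invgK !mulgA mulgV mul1g mulgK.
by rewrite gpredF// gpredM.
Qed.

End CoverCochain.

(** * Lifting flat cochains to an extension *)

Section MorphismLemmas.
Local Open Scope group_scope.
Variables (H K : groupType) (f : H -> K).
Hypothesis fM : {morph f : x y / x * y}.

Lemma morph1 : f 1 = 1.
Proof. by apply: (mulgI (f 1)); rewrite -fM !mulg1. Qed.

Lemma morphV : {morph f : x / x^-1}.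
Proof. by move=> x; apply/esym/mulg1_eq; rewrite -fM mulgV morph1. Qed.

End MorphismLemmas.

Lemma abelianization_comm (G : groupType) :
  commutative ( *%g : abelianization G -> abelianization G -> abelianization G).
Proof.
move=> a b; rewrite -[a]reprK -[b]reprK; pose D := [pred _ : G | true].
rewrite -(quotient_projM (commutators_with D)) -[RHS](quotient_projM (commutators_with D)).
apply/eq_coset.
have -> : ((repr a * repr b)^-1 * (repr b * repr a) = [~ repr b, repr a])%g.
  by rewrite invgM /commg /conjg !mulgA.
by apply: mem_generated; exists (repr b) => //; exists (repr a).
Qed.

Section AdditiveOf.
Local Open Scope group_scope.
Variables (H : groupType) (HC : commutative ( *%g : H -> H -> H)).

(** The proof of commutativity is an argument of the type so that the additive structure can be
    recovered from it. *)
Definition additive_of (_ : commutative ( *%g : H -> H -> H)) : Type := H.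
HB.instance Definition _ := Choice.on (additive_of HC).
HB.instance Definition _ := GRing.isZmodule.Build (additive_of HC)
  (@mulgA H) HC (@mul1g H) (@mulVg H).

End AdditiveOf.

Section Extension.
Local Open Scope group_scope.
Variables (G : groupType) (N : normalSubgroup G).
Hypothesis N_comm : {in N &, commutative *%g}.

Lemma subgroup_comm : commutative ( *%g : subgroup N -> subgroup N -> subgroup N).
Proof. by move=> x y; apply: val_inj; exact: N_comm (valP x) (valP y). Qed.

Definition kernel : zmodType := additive_of subgroup_comm.

Definition to_kernel (x : G) : kernel := insubd (1 : subgroup N) x.
Definition of_kernel (a : kernel) : G := val (a : subgroup N).

Lemma of_kernelP (a : kernel) : of_kernel a \in N.
Proof. exact: valP (a : subgroup N). Qed.

Lemma of_kernelD (a b : kernel) : of_kernel (a + b)%R = of_kernel a * of_kernel b.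
Proof. by []. Qed.

Lemma of_kernelN (a : kernel) : of_kernel (- a)%R = (of_kernel a)^-1.
Proof. by []. Qed.

Lemma of_kernel_inj : injective of_kernel.
Proof. exact: (@val_inj _ _ (subgroup N)). Qed.

Lemma to_kernelK (a : kernel) : to_kernel (of_kernel a) = a.
Proof. exact: (@valKd _ _ (subgroup N)). Qed.

Lemma of_to_kernel (x : G) : x \in N -> of_kernel (to_kernel x) = x.
Proof. by move=> Nx; rewrite /of_kernel /to_kernel insubdK. Qed.

Local Notation beta := (quotient_group N).
Local Notation proj := (quotient_proj N).

(** A set-theoretic section, neither multiplicative nor normalized at 1. *)
Definition section (b : beta) : G := repr b.

Lemma proj_section b : proj (section b) = b.
Proof. exact: reprK. Qed.

Lemma proj_eq (x y : G) : proj x = proj y <-> x^-1 * y \in N.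
Proof. exact: eq_coset. Qed.

Lemma projM : {morph proj : x y / x * y}.
Proof. exact: quotient_projM. Qed.

Lemma projV : {morph proj : x / x^-1}.
Proof. exact: morphV projM. Qed.

Lemma proj_eq1 (x : G) : proj x = 1 <-> x \in N.
Proof.
have <- : proj 1 = 1 by exact: morph1 projM.
rewrite proj_eq mulg1; split=> h; first by rewrite -[x]invgK gpredV.
by rewrite gpredV.
Qed.

Lemma proj_kernel (a : kernel) : proj (of_kernel a) = 1.
Proof. by apply/proj_eq1; exact: of_kernelP. Qed.

(** Conjugation by [c^-1] on the right is [a |-> c a c^-1], a left action. *)
Definition act (c : G) (a : kernel) : kernel := to_kernel (of_kernel a ^ c^-1).

Lemma of_act c a : of_kernel (act c a) = of_kernel a ^ c^-1.
Proof. by rewrite of_to_kernel//; apply: gpredJr; exact: of_kernelP. Qed.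

Lemma actM c d a : act (c * d) a = act c (act d a).
Proof. by apply: of_kernel_inj; rewrite !of_act invgM conjgM. Qed.

Lemma act1 a : act 1 a = a.
Proof. by apply: of_kernel_inj; rewrite of_act invg1 conjg1. Qed.

Lemma actB c : {morph act c : a b / (a - b)%R}.
Proof.
by move=> a b; apply: of_kernel_inj; rewrite !(of_act, of_kernelD, of_kernelN) conjMg conjVg.
Qed.

Lemma actD c : {morph act c : a b / (a + b)%R}.
Proof.
by move=> a b; apply: of_kernel_inj; rewrite !(of_act, of_kernelD, of_kernelN) conjMg.
Qed.

Lemma act0 c : act c 0%R = 0%R.
Proof. by rewrite -[X in act c X](subrr 0%R) actB subrr. Qed.

(** The abelian group [N] acts trivially on itself, so the action factors through the quotient. *)
Lemma act_eq c d a : proj c = proj d -> act c a = act d a.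
Proof.
move=> /proj_eq cd; rewrite -[d](mulKg c^-1) invgK actM; congr (act c _).
apply: of_kernel_inj; rewrite of_act conjgE invgK.
by rewrite [X in _ * X]N_comm ?gpredV ?mulVKg//; exact: of_kernelP.
Qed.

(** * Lifts of a flat cochain to the extension and their residues *)

Variables (R : realType) (S : topologicalType) (A : set (chart R S)).
Hypothesis atlas : is_atlas A.
Hypothesis oriented : forall c d, A c -> A d ->
  forall x, chart_dom c x -> chart_dom d x ->
  orientation_preserving_at (chart_map d \o chart_inv c) (chart_map c x).
Hypothesis hS : hausdorff_space S.
Hypothesis cS : compact [set: S].
Hypothesis connS : connected [set: S].

Variable g : S -> S -> beta.
Variable W : S -> set S.
Hypothesis W_nbhs : forall z, nbhs z (W z).
Hypothesis gW : forall z x y w, W z x -> W z y -> W z w -> g x y * g y w = g x w.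
Implicit Types (f : S -> S -> G) (h k : S -> S -> kernel) (p x y z : S).

Let tau x y : G := section (g x y).

Lemma proj_tau x y : proj (tau x y) = g x y.
Proof. exact: proj_section. Qed.

Lemma W_refl z : W z z.
Proof. exact: nbhs_singleton (W_nbhs z). Qed.

Lemma g_refl z x : W z x -> g x x = 1.
Proof. by move=> Wx; apply: (mulgI (g x x)); rewrite (gW Wx Wx Wx) mulg1. Qed.

Definition lift f := forall x y, proj (f x y) = g x y.

(* Near [p] the section [tau] trivializes the extension: it turns a lift of [g]
   into a cochain with values in the abelian kernel, of which residues make sense. *)
Definition gauge p f : S -> S -> kernel := fun x y =>
  to_kernel ((tau x p)^-1 * f x y * tau y p).

Definition ungauge p h : S -> S -> G := fun x y =>
  tau x p * of_kernel (h x y) * (tau y p)^-1.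

Lemma gaugeK p f x y : lift f -> W p x -> W p y -> ungauge p (gauge p f) x y = f x y.
Proof.
move=> lf Wx Wy; rewrite /ungauge of_to_kernel; first by rewrite -!mulgA mulgV mulg1 mulVKg.
apply/proj_eq1; rewrite !projM projV !proj_tau lf.
by rewrite -mulgA (gW Wx Wy (W_refl p)) mulVg.
Qed.

Lemma proj_ungauge p h x y : W p x -> W p y -> proj (ungauge p h x y) = g x y.
Proof.
move=> Wx Wy; rewrite /ungauge !projM projV !proj_tau proj_kernel mulg1.
by rewrite -(gW Wx Wy (W_refl p)) mulgK.
Qed.

Lemma ungauge_flat p h z : zflat h z -> flat (ungauge p h) z.
Proof.
move=> [V Vz Vh]; exists V => // x y w Vx Vy Vw.
by rewrite /ungauge -(Vh x y w)// of_kernelD -!mulgA mulKg.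
Qed.

Lemma gauge_eqg p f f' z : eqg f f' z -> eqg (gauge p f) (gauge p f') z.
Proof. by move=> [V Vz Vh]; exists V => // x y Vx Vy; rewrite /gauge Vh. Qed.

Lemma gauge_flat p f z : lift f -> nbhs z (W p) ->
  zflat (gauge p f) z <-> flat f z.
Proof.
move=> lf Wz; split=> [/(ungauge_flat p)|[V Vz Vf]].
  by apply: flat_eqg; exists (W p) => // x y Wx Wy; exact: gaugeK.
exists (V `&` W p); first exact: filterI.
move=> x y w [Vx Wx] [Vy Wy] [Vw Ww]; apply: of_kernel_inj.
have e a b : W p a -> W p b -> of_kernel (gauge p f a b) = (tau a p)^-1 * f a b * tau b p.
  move=> Wa Wb; rewrite -[in RHS](gaugeK lf Wa Wb) /ungauge.
  by rewrite -!mulgA mulVg mulg1 mulKg.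
by rewrite of_kernelD !e// -(Vf x y w)// -!mulgA mulVKg.
Qed.

Lemma gauge_pflat p f z : lift f -> nbhs z (W p) ->
  punct (flat f) z <-> pflat (gauge p f) z.
Proof.
move=> lf /nbhs_interior Wz; split; apply: filterS2 Wz => x Wx fx xz.
  by apply/(gauge_flat lf Wx); exact: fx.
by apply/(gauge_flat lf Wx); exact: fx.
Qed.

Definition patch p (V : set S) h f : S -> S -> G := fun x y =>
  if `[< V x >] && `[< V y >] then ungauge p h x y else f x y.

Lemma patch_lift p V h f : V `<=` W p -> lift f -> lift (patch p V h f).
Proof.
move=> VW lf x y; rewrite /patch; case: asboolP => [Vx|_] /=; last exact: lf.
by case: asboolP => [Vy|_] /=; [apply: proj_ungauge; exact: VW|exact: lf].
Qed.

Lemma patch_in p V h f z : nbhs z V -> eqg (patch p V h f) (ungauge p h) z.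
Proof. by move=> Vz; exists V => // x y Vx Vy; rewrite /patch !asboolT. Qed.

Lemma patch_out p V h f z : closed V -> ~ V z -> eqg (patch p V h f) f z.
Proof.
move=> clV nVz; exists (~` V) => [|x y Vx Vy]; last by rewrite /patch asboolF.
by apply: open_nbhs_nbhs; split=> //; exact: closed_openC.
Qed.

Lemma patch_eq p V h f z : lift f -> nbhs z (W p) -> eqg (gauge p f) h z ->
  eqg (patch p V h f) f z.
Proof.
move=> lf Wz [U Uz Uf]; exists (U `&` W p); first exact: filterI.
move=> x y [Ux Wx] [Uy Wy]; rewrite /patch; case: ifP => // _.
by rewrite -[RHS](gaugeK lf Wx Wy) /ungauge Uf.
Qed.

Lemma punct_flat_eqg f f' z : eqg f f' z -> punct (flat f) z -> punct (flat f') z.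
Proof.
move=> /eqg_near e; apply: filterS2 e => x ex fx xz.
by apply: flat_eqg ex _; exact: fx.
Qed.

(** The set-theoretic lift [tau] is corrected box by box. In the gauge at the centre of the next box
    the lift is an abelian cochain; its restriction to the boxes already treated is extended over
    this box and put back, at the cost of isolated singularities. *)
Lemma lift_pflat : exists f, lift f /\ forall z, punct (flat f) z.
Proof.
have [B [l [BP lP]]] := box_cover atlas cS W_nbhs.
pose D p := cbox (B p).1 p (B p).2.
suff [f [lf fl]] : exists f, lift f /\
    forall z, (exists2 p, p \in l & D p z) -> punct (flat f) z.
  by exists f; split=> // z; apply: fl; exact: lP.
have clD p : closed (D p).
  have [_ r0 ad _] := BP p; apply: cbox_closed => //; apply: admissibleW ad => //.
  by rewrite ler_peMl ?ler1n// ltW.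
elim: l {lP} => [|p l [f [lf fl]]]; first by exists tau; split=> [x y|z []//]; exact: proj_tau.
have [Ac r0 ad sub] := BP p; set c := (B p).1 in Ac ad sub *; set r := (B p).2 in r0 ad sub *.
have adw (i : nat) : (0 < i)%N -> (i <= 12)%N -> admissible c p (i%:R * r)%R.
  move=> k0 k12; apply: admissibleW ad; first by rewrite mulr_gt0// ltr0n.
  by rewrite ler_pM2r// ler_nat.
have lt (i j : nat) : (i < j)%N -> (i%:R * r < j%:R * r :> R)%R.
  by move=> kk; rewrite ltr_pM2r// ltr_nat.
have inW (i : nat) x : (i < 12)%N -> cbox c p (i%:R * r)%R x -> nbhs x (W p).
  by move=> k12 xr; apply: filterS sub _; apply: cbox_nbhs xr; exact: lt.
pose L := [set x | exists2 q, q \in l & D q x].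
have clL : closed L by exact: closed_bigcup_seq.
have [|h [ph peh _]] := chart_extension atlas oriented hS Ac (adw 4%N isT isT) clL (f := gauge p f).
  by move=> x Lx xr; apply/(gauge_pflat lf (inW 4%N x isT xr)); exact: fl.
pose V := cbox c p (2%:R * r)%R.
have V4 x : V x -> cbox c p (4%:R * r)%R x.
  by move=> [cx xr]; split=> //; apply: dist_leW xr; exact/ltW/lt.
have VW : V `<=` W p by move=> x /V4/(inW 4%N x isT)/nbhs_singleton.
exists (patch p V h f); split=> [|z]; first exact: patch_lift.
have Lz : L z -> punct (flat (patch p V h f)) z.
  move=> Lz; have [Vz|nVz] := pselect (V z); last first.
    have clV : closed V by apply: cbox_closed => //; exact: adw.
    by apply: (punct_flat_eqg (eqg_sym (patch_out p h f clV nVz))); exact: fl.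
  have Wz := inW 4%N z isT (V4 _ Vz).
  have := peh z Lz (V4 _ Vz); apply: filterS2 (filterI (nbhs_interior Wz) (fl z Lz)).
  move=> x [Wx fx] ex xz; apply: flat_eqg (eqg_sym (patch_eq _ lf Wx (ex xz))) _.
  exact: fx.
move=> [q]; rewrite inE => /orP[/eqP->|ql] Dz; last by apply: Lz; exists q.
have r12 : (r < 2%:R * r)%R by rewrite ltr_pMl// ltr1n.
have Vz : nbhs z V by exact: cbox_nbhs r12 Dz.
apply: (punct_flat_eqg (eqg_sym (patch_in _ _ _ Vz))).
have := ph z (V4 _ (nbhs_singleton Vz)); apply: filterS => x hx xz.
by apply: ungauge_flat; exact: hx.
Qed.

Definition gres f z m := residue A (gauge z f) z m.

(** A cochain [k] has coefficients in the local system given by the action on [N]; [twist z]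
    trivializes this system near [z], compatibly with the gauge at [z]. *)
Definition twist z k : S -> S -> kernel := fun x y => act (tau x z)^-1 (k x y).
Definition tres k z m := residue A (twist z k) z m.
Definition shift k f : S -> S -> G := fun x y => of_kernel (k x y) * f x y.

Lemma shift_lift k f : lift f -> lift (shift k f).
Proof. by move=> lf x y; rewrite /shift projM proj_kernel mul1g. Qed.

Lemma gauge_in z f x y : lift f -> W z x -> W z y ->
  (tau x z)^-1 * f x y * tau y z \in N.
Proof.
move=> lf Wx Wy; apply/proj_eq1; rewrite !projM projV !proj_tau lf.
by rewrite -mulgA (gW Wx Wy (W_refl z)) mulVg.
Qed.

Lemma gauge_shift k f z : lift f ->
  eqg (cadd (twist z k) (gauge z f)) (gauge z (shift k f)) z.
Proof.
move=> lf; exists (W z) => // x y Wx Wy; apply: of_kernel_inj.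
rewrite /cadd of_kernelD of_act !of_to_kernel; last 2 first.
- exact: gauge_in (shift_lift k lf) Wx Wy.
- exact: gauge_in.
by rewrite invgK conjgE /shift -!mulgA mulVKg.
Qed.

Lemma gres_shift k f z m n : lift f ->
  tres k z m -> gres f z n -> gres (shift k f) z (m + n)%R.
Proof.
move=> lf km fn; apply: (residue_eqg (gauge_shift k z lf)).
exact: residue_add.
Qed.

Lemma gres_pflat f z m : lift f -> gres f z m -> punct (flat f) z.
Proof. by move=> lf fm; apply/(gauge_pflat lf (W_nbhs z)); exact: residue_pflat fm. Qed.

Lemma gres_ex f z : lift f -> punct (flat f) z -> exists m, gres f z m.
Proof. by move=> lf /(gauge_pflat lf (W_nbhs z)); exact: residue_ex. Qed.

Lemma gres_eqg f f' z m : eqg f f' z -> gres f z m -> gres f' z m.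
Proof. by move=> /(gauge_eqg z); exact: residue_eqg. Qed.

Lemma gres_flat f z : lift f -> flat f z -> gres f z 0%R.
Proof. by move=> lf /(gauge_flat lf (W_nbhs z)); exact: residue_flat. Qed.

Lemma lift_remove f z : lift f -> gres f z 0%R ->
  exists f', [/\ lift f', flat f' z & forall x, x <> z -> eqg f f' x].
Proof.
move=> lf /(remove_singularity atlas hS)[h hz fh].
have [V [clV Vz VW]] := closed_nbhs atlas hS (nbhs_interior (W_nbhs z)).
have VW' : V `<=` W z by move=> x /VW/interior_subset.
exists (patch z V h f); split.
- exact: patch_lift.
- by apply: flat_eqg (eqg_sym (patch_in z h f Vz)) _; exact: ungauge_flat.
move=> x xz; apply: eqg_sym; have [/VW Wx|nVx] := pselect (V x); last exact: patch_out.
by apply: patch_eq => //; exact: fh.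
Qed.

Lemma flat_finite_singular (H : groupType) (f : S -> S -> H) :
  (forall z, punct (flat f) z) -> exists t : seq S, forall x, flat f x \/ x \in t.
Proof.
move=> fl; have [|t [_ tP]] := finite_cover cS (W := fun z => [set x | x <> z -> flat f x]).
  by move=> z _; exact: fl.
exists t => x; have [//|p pt /= fp] := tP x.
by have [->|/fp] := pselect (x = p); [right|left].
Qed.

Lemma lift_remove_all f : lift f -> (forall z, gres f z 0%R) ->
  exists f', lift f' /\ forall z, flat f' z.
Proof.
move=> lf f0; have [|t] := @flat_finite_singular _ f.
  by move=> z; exact: gres_pflat (f0 z).
elim: t f lf f0 => [|z t IH] f lf f0 ft; first by exists f; split=> // x; case: (ft x).
have [f' [lf' f'z ff']] := lift_remove lf (f0 z).
apply: (IH f') => // x.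
  have [->|xz] := pselect (x = z); first exact: gres_flat.
  exact: gres_eqg (ff' x xz) (f0 x).
have [->|xz] := pselect (x = z); first by left.
have [fx|] := ft x; first by left; exact: flat_eqg (ff' x xz) fx.
by rewrite inE => /orP[/eqP//|]; right.
Qed.

(** * Transport of residues on the surface *)

Definition at_point z (b : kernel) y : kernel := if y == z then b else 0%R.
(* Shifting a lift by [k] turns a residue [b'] at [w] into a residue [b] at [z]. *)
Definition move z b w b' := exists k, forall y,
  tres k y (at_point z b y - at_point w b' y)%R.

Lemma tres_add k h z m n : tres k z m -> tres h z n -> tres (cadd k h) z (m + n)%R.
Proof.
move=> km hn; apply: (residue_eqg (f := cadd (twist z k) (twist z h))).
  by exists setT => [|x y _ _]; [exact: filterT|rewrite /cadd /twist actD].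
exact: residue_add.
Qed.

Lemma tres_opp k z m : tres k z m -> tres (copp k) z (- m)%R.
Proof.
move=> km; apply: (residue_eqg (f := copp (twist z k))).
  exists setT => [|x y _ _]; first exact: filterT.
  by rewrite /copp /twist -[in RHS](sub0r (k x y)) actB act0 sub0r.
exact: residue_opp.
Qed.

Lemma tres0 z : tres czero z 0%R.
Proof.
apply: (residue_eqg (f := czero)); last exact/residue_flat/zflat0.
by exists setT => [|x y _ _]; [exact: filterT|rewrite /czero /twist act0].
Qed.

Lemma move_refl z b : move z b z b.
Proof. by exists czero => y; rewrite subrr; exact: tres0. Qed.

Lemma move_sym z b w b' : move z b w b' -> move w b' z b.
Proof.
by move=> [k kP]; exists (copp k) => y; rewrite -opprB; exact: tres_opp.
Qed.

Lemma move_trans z b w b' v b'' : move z b w b' -> move w b' v b'' -> move z b v b''.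
Proof.
move=> [k kP] [h hP]; exists (cadd k h) => y.
by rewrite -(subrK (at_point w b' y) (at_point z b y)) -addrA; exact: tres_add.
Qed.

(** A push in a chart around [z], with values carried back from the gauge at [z] to the local
    system. The residue arriving at [w] is read in the gauge at [w], whence the factor
    [act (tau w z)]. *)
Lemma move_near z : nbhs z [set w | forall b, move z b w (act (tau w z) b)].
Proof.
have [c Ac cz] := atlas z.
have [r ad rW] := admissible_near cz (W_nbhs z); have [r0 _ _] := ad.
have r20 : (0 < r / 2)%R by rewrite divr_gt0.
have r2 : (r / 2 <= r)%R by lra.
have ad2 : admissible c z (r / 2)%R by exact: admissibleW ad.
have zz : ubox c z (r / 2)%R z by exact: ubox_center.
apply: filterS (ubox_nbhs zz) => w wr b.
pose k := spush c (cbox c z (r / 2)%R) z w b.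
have kP y := @spush_residue R S A oriented hS kernel c z (r / 2)%R (r / 2)%R z w b y
  Ac ad2 (lexx _) zz wr.
exists (fun x y => act (tau x z) (k x y)) => y.
have [yr|nyr] := pselect (ubox c z (r / 2)%R y); last first.
  have e := (kP y).2 nyr.
  have -> : (at_point z b y - at_point w (act (tau w z) b) y = 0)%R.
    rewrite /at_point; case: eqP => [yz|_]; first by case: nyr; rewrite yz.
    case: eqP => [yw|_]; first by case: nyr; rewrite yw.
    by rewrite subrr.
  apply: (residue_eqg (f := czero)); last exact/residue_flat/zflat0.
  apply: eqg_sym; case: e => V Vy Vk; exists V => // x x' Vx Vx'.
  by rewrite /twist /k Vk// !act0.
have Wy : nbhs y (W z).
  apply: filterS rW _; apply: filterS (ubox_nbhs yr) => x [cx xr].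
  by split=> //; exact: dist_ltW r2 _ xr.
have -> : (at_point z b y - at_point w (act (tau w z) b) y)%R =
    act (tau y z) ((if y == z then b else 0) - (if y == w then b else 0))%R.
  rewrite actB /at_point; congr (_ - _)%R; case: eqP => [->|_]; rewrite ?act0//.
  rewrite (@act_eq _ 1) ?act1// proj_tau (g_refl (W_refl z)).
  by apply/esym; exact: morph1 projM.
have h := residue_map (actB (tau y z)) (kP y).1.
apply: (residue_eqg (f := fun x x' => act (tau y z) (k x x'))); last exact: h.
(* Untwisting at [y] and twisting at [z] combine to the constant [act (tau y z)], because
   [g x y * g y z = g x z]. *)
exists (W z `&` W y) => [|x x' [Wzx Wyx] _]; first by apply: filterI => //; exact: W_nbhs.
rewrite /twist -actM; apply: act_eq.
rewrite projM projV !proj_tau -(gW Wzx (nbhs_singleton Wy) (W_refl z)).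
by rewrite mulKg.
Qed.

Lemma move_near_inv z : nbhs z [set w | forall b, move w b z (act (tau w z)^-1 b)].
Proof.
apply: filterS (move_near z) => w mw b; have := mw (act (tau w z)^-1 b).
by rewrite -actM mulgV act1; exact: move_sym.
Qed.

Lemma move_reach z b w : exists b', move z b w b'.
Proof.
apply: (connected_loc (P := fun w => exists b', move z b w b') connS _ (a := z)) => //.
  move=> v _; exists [set w | (forall b, move v b w (act (tau w v) b)) /\
      forall b, move w b v (act (tau w v)^-1 b)].
    by apply: filterI; [exact: move_near|exact: move_near_inv].
  move=> x [h1 h2] _; split=> -[b' mb].
    by exists (act (tau x v)^-1 b'); exact: move_trans mb (h2 b').
  by exists (act (tau x v) b'); exact: move_trans mb (h1 b').
by exists b; exact: move_refl.
Qed.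

(** Parallel transport: up to time [t] the residue is acted on by [u t / u 0]. At the end this is
    the inverse of the holonomy, which cancels [d]. *)
Lemma move_path a a' (p : path R a a') d b : holonomy g p (proj d) ->
  move a (act d b) a' b.
Proof.
move=> [u gu ud].
pose P t := forall b, move a b (p t) (act (section (u t * (u 0%R)^-1)) b).
have P0 : P 0%R.
  move=> b'; rewrite path_src mulgV (@act_eq _ 1) ?act1; first exact: move_refl.
  by rewrite proj_section (morph1 projM).
have P1 : P 1%R.
  apply: (connected_loc (P := P) (@segment_connected R 0 1) _ (I0 R) P0 (I1 R)).
  move=> t It; have [V Vt Vg] := gu t It.
  have := move_near (p t) => /(@path_cont _ _ _ _ p) /= mt.
  exists (V `&` (p @^-1` [set w | forall b, move (p t) b w (act (tau w (p t)) b)])).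
    exact: filterI.
  move=> s [Vs ms] Is.
  have e b' : act (section (u s * (u 0%R)^-1)) b' =
      act (tau (p s) (p t)) (act (section (u t * (u 0%R)^-1)) b').
    rewrite -actM; apply: act_eq; rewrite projM !proj_section.
    by rewrite (Vg s t)//; [rewrite divgKA|exact: nbhs_singleton].
  split=> Px b'.
    apply: move_trans (Px b') _; rewrite e; apply: move_sym; exact: ms.
  by apply: move_trans (Px b') _; rewrite e; exact: ms.
have := P1 (act d b); rewrite path_tgt -actM.
rewrite (@act_eq (section (u 1%R / u 0%R) * d) 1) ?act1//.
by rewrite (morph1 projM) projM proj_section -ud divgKA mulgV.
Qed.

Variable x0 : S.
Hypothesis hol : forall d : beta, exists p : path R x0 x0, holonomy g p d.

Lemma commutator_residue a : a \in commutators_with N ->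
  a \in N /\ exists k, forall y, tres k y (at_point x0 (to_kernel a) y).
Proof.
pose K : {pred G} := fun a => `[< a \in N /\
  exists k, forall y, tres k y (at_point x0 (to_kernel a) y) >].
have at0 y : at_point x0 0%R y = 0%R by rewrite /at_point if_same.
have to1 : to_kernel 1 = 0%R by exact: (to_kernelK 0%R).
suff KP : {subset commutators_with N <= K} by move=> /KP/asboolP.
apply: generated_min => [|_ [d _ [b Nb <-]]].
  split=> [|x y /asboolP[Nx [k kP]] /asboolP[Ny [h hP]]]; apply/asboolP; split.
  - exact: gpred1.
  - by exists czero => y; rewrite to1 at0; exact: tres0.
  - exact: gpredF.
  exists (cadd k (copp h)) => z.
  have -> : at_point x0 (to_kernel (x / y)) z =
      (at_point x0 (to_kernel x) z - at_point x0 (to_kernel y) z)%R.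
    have -> : to_kernel (x / y) = (to_kernel x - to_kernel y)%R.
      apply: of_kernel_inj; rewrite of_kernelD of_kernelN !of_to_kernel//.
      exact: gpredF.
    by rewrite /at_point; case: ifP => // _; rewrite subrr.
  by apply: tres_add => //; exact: tres_opp.
have Nb' : b ^ d \in N by exact: gpredJr.
have Nc : [~ d, b] \in N by rewrite commgEr gpredM// gpredJr// gpredV.
apply/asboolP; split=> //.
(* Transporting [b^-1] around a loop of holonomy [d^-1] leaves the difference of [d^-1 b^-1 d] and
   [b^-1], that is [d^-1 b^-1 d b]. *)
have [p hp] := hol (proj d^-1).
have [k kP] := move_path (to_kernel b^-1) hp.
have e : (act d^-1 (to_kernel b^-1) - to_kernel b^-1)%R = to_kernel [~ d, b].
  apply: of_kernel_inj; rewrite of_kernelD of_kernelN of_act !of_to_kernel ?gpredV//.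
  by rewrite !invgK commgEr.
exists k => y; have := kP y; rewrite -e /at_point.
by case: ifP => //; rewrite subrr.
Qed.

(** Composed with the abelianization of [G], the lift becomes an abelian cochain on the whole
    surface, to which [total_residue] applies; its only residue is the class of [m]. *)
Lemma residue_in_derived f m : lift f -> gres f x0 m ->
  (forall y, y <> x0 -> gres f y 0%R) ->
  of_kernel m \in commutators_with [pred _ : G | true].
Proof.
move=> lf fm f0; pose D := [pred _ : G | true].
have abC := @abelianization_comm G.
pose cls (x : G) : additive_of abC := quotient_proj (commutators_with D) x.
have clsM (s t : G) : cls (s * t) = (cls s + cls t)%R by exact: quotient_projM.
have clsV (s : G) : cls s^-1 = (- cls s)%R := morphV (quotient_projM (commutators_with D)) s.
have aB : {morph (fun a => cls (of_kernel a)) : a b / (a - b)%R}.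
  by move=> a b; rewrite of_kernelD of_kernelN clsM clsV.
have res y n : gres f y n -> residue A (fun x x' => cls (f x x')) y (cls (of_kernel n)).
  (* In the abelianization a change of gauge merely adds the gradient of [v], which has no
     residue. *)
  move=> fn; pose v x := cls (tau x y).
  apply: (residue_eqg (f := cadd (grad v) (fun x x' => cls (of_kernel (gauge y f x x'))))).
    exists (W y) => // x x' Wx Wx'.
    rewrite -[in RHS](gaugeK lf Wx Wx') /ungauge !clsM clsV /cadd /grad /v.
    by rewrite addrAC.
  rewrite -[X in residue _ _ _ X]add0r; apply: residue_add; first exact: residue_grad.
  exact: residue_map aB fn.
have : cls (of_kernel m) = 0%R.
  have cls1 : cls (of_kernel 0%R) = 0%R by rewrite -(subrr 0%R) aB subrr.
  have h y : residue A (fun x x' => cls (f x x')) y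
      ((fun y => if y == x0 then cls (of_kernel m) else 0%R) y).
    rewrite /=; case: eqP => [->|yx]; first exact: res.
    by rewrite -cls1; apply: res; exact: f0.
  have := total_residue atlas oriented hS cS h (s := [:: x0]).
  rewrite big_seq1 eqxx; apply=> // x; rewrite inE => /negbTE -> //.
move=> c1; have : cls 1 = cls (of_kernel m) by rewrite c1; exact: morph1 (quotient_projM _).
by move=> /eq_coset; rewrite invg1 mul1g.
Qed.

Theorem flat_lift :
  (forall a, a \in N -> a \in commutators_with [pred _ : G | true] ->
     a \in commutators_with N) ->
  exists f, lift f /\ forall z, flat f z.
Proof.
move=> inj; have [f1 [lf1 fl1]] := lift_pflat.
suff [f [lf [m fm] f0]] : exists f, [/\ lift f, exists m, gres f x0 m &
    forall y, y <> x0 -> gres f y 0%R].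
  have mD := residue_in_derived lf fm f0.
  have /commutator_residue[_ [k kP]] : (of_kernel m)^-1 \in commutators_with N.
    by rewrite gpredV; apply: inj => //; exact: of_kernelP.
  apply: (lift_remove_all (f := shift k f)) => [|z]; first exact: shift_lift.
  have [->|zx] := pselect (z = x0).
    have := gres_shift lf (kP x0) fm; rewrite /at_point eqxx -of_kernelN to_kernelK.
    by rewrite addNr.
  have := gres_shift lf (kP z) (f0 z zx); rewrite /at_point.
  by case: eqP => // _; rewrite addr0.
have [t tP] := flat_finite_singular fl1.
suff : forall f, lift f -> (forall y, exists m, gres f y m) ->
    (forall y, y <> x0 -> gres f y 0%R \/ y \in t) ->
    exists f, [/\ lift f, exists m, gres f x0 m & forall y, y <> x0 -> gres f y 0%R].
  apply=> [|y|y _]; [exact: lf1|exact: gres_ex|].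
  by have [fy|] := tP y; [left; exact: gres_flat|right].
elim: t {f1 lf1 fl1 tP} => [|z t IH] f lf fe ft.
  by exists f; split=> // y /ft[].
have [m fm] := fe z.
(* The shift has residue [- m] at [z], which cancels [m]; whatever it brings to [x0] is harmless, no
   condition being imposed there. *)
have [b [k kP]] := move_reach z (- m)%R x0.
have sh y n : gres f y n -> gres (shift k f) y
    ((at_point z (- m) y - at_point x0 b y) + n)%R.
  by move=> fn; exact: gres_shift (kP y) fn.
apply: (IH (shift k f)); first exact: shift_lift.
  by move=> y; have [n /sh fn] := fe y; exists (at_point z (- m) y - at_point x0 b y + n)%R.
move=> y yx; have x0y : (y == x0) = false by apply/eqP.
have [yz|/eqP/negbTE zy] := pselect (y = z).
  left; move: (sh z m fm); rewrite -yz /at_point eqxx x0y subr0 addNr.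
  by [].
have [fy|] := ft y yx; last by rewrite inE zy /=; right.
by left; have := sh y _ fy; rewrite /at_point zy x0y subr0 addr0.
Qed.

End Extension.

(** * Finitely generated abelian groups *)

Section FinitelyGeneratedAbelian.
Variable X : zmodType.
Implicit Types (x y u : X) (l : seq X) (n : nat).

(** Generation in the form of an induction principle. *)
Definition spans l := forall P : X -> Prop, P 0 ->
  (forall a b, P a -> P b -> P (a - b)) -> (forall g, g \in l -> P g) -> forall x, P x.

Fixpoint combos n l : seq X := if l is g :: l' then
  [seq g *+ k + y | k <- iota 0 n, y <- combos n l'] else [:: 0].

Let near_combo n l x := exists2 c, c \in combos n l & exists u, x = c + u *+ n.

Let near_comboD n l x u : near_combo n l x -> near_combo n l (x + u *+ n).
Proof.
by move=> [c cl [v ->]]; exists c => //; exists (v + u); rewrite mulrnDl addrA.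
Qed.

Let near_combo_cons n g l x : (0 < n)%N -> near_combo n (g :: l) x <->
  exists (j : nat) y, near_combo n l y /\ x = g *+ j + y.
Proof.
move=> n0; split=> [[c /allpairsPdep[k [y [_ yl ->]]] [u ->]]|[j [y [[c cl [u ->]] ->]]]].
  exists k, (y + u *+ n); split; last by rewrite addrA.
  by exists y => //; exists u.
exists (g *+ (j %% n) + c).
  apply/allpairsPdep; exists (j %% n)%N, c; split=> //.
  by rewrite mem_iota /= add0n ltn_mod.
exists (g *+ (j %/ n) + u); rewrite {1}(divn_eq j n) mulrnDr mulrnDl -mulrnA.
by rewrite [X in X + _ = _]addrC addrACA.
Qed.

(** Coefficients of the generators may be reduced modulo [n], so [X] modulo [n] has finitely many
    classes. *)
Lemma combos_dense n l x : (0 < n)%N -> spans l ->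
  exists2 c, c \in combos n l & exists u, x = c + u *+ n.
Proof.
move=> n0; have c0 l' : near_combo n l' 0.
  elim: l' => [|g l' IH]; first by exists 0; rewrite ?inE//; exists 0; rewrite mul0rn addr0.
  by apply/near_combo_cons => //; exists 0%N, 0; rewrite mulr0n addr0.
have cB l' a b : near_combo n l' a -> near_combo n l' b -> near_combo n l' (a - b).
  elim: l' a b => [|g l' IH] a b.
    move=> [_ /[1!inE] /eqP-> [u ->]] [_ /[1!inE] /eqP-> [v ->]].
    by exists 0; rewrite ?inE//; exists (u - v); rewrite mulrnBl !add0r.
  move=> /near_combo_cons-/(_ n0)[j [y [yl ->]]] /near_combo_cons-/(_ n0)[k [z [zl ->]]].
  (* Coefficients are natural numbers: [- k] is replaced by [(n - 1) * k], which is congruent to it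
     modulo [n]. *)
  have ek : - (g *+ k) = g *+ (n.-1 * k) + (- (g *+ k)) *+ n.
    by rewrite mulnC mulrnA -{2}(prednK n0) mulrS mulNrn addrCA subrr addr0.
  apply/near_combo_cons => //; exists (j + n.-1 * k)%N, (y - z + (- (g *+ k)) *+ n).
  split; first by apply: near_comboD; exact: IH.
  rewrite opprD [in LHS]ek mulrnDr -[_ + _ - z]addrA addrACA; congr (_ + _).
  by rewrite -addrA; congr (_ + _); rewrite addrC.
move=> sp; apply: (sp (near_combo n l)) => [|a b|g]; [exact: c0|exact: cB|].
elim: l {sp} => // h l IH; rewrite inE => /orP[/eqP->|/IH gl]; apply/near_combo_cons => //.
  by exists 1%N, 0; rewrite mulr1n addr0.
by exists 0%N, g; rewrite mulr0n add0r.
Qed.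

Lemma mod_reps n l : (0 < n)%N -> spans l -> exists (r : X -> X) (s : seq X),
  [/\ uniq s, forall x, r x \in s, forall x, exists u, x = r x + u *+ n,
      forall x u, r (x + u *+ n) = r x & forall x, x \in s -> r x = x].
Proof.
move=> n0 sp; pose P x : pred X := fun y => `[< exists u, x = y + u *+ n >].
pose r x := choose (P x) x.
have Pxx x : P x x by apply/asboolP; exists 0; rewrite mul0rn addr0.
have rP x : exists u, x = r x + u *+ n by apply/asboolP; exact: (@chooseP _ (P x)).
have rD x u : r (x + u *+ n) = r x.
  (* Congruent elements define the same predicate, and a canonical choice then selects the same
     representative. *)
  have PE : P (x + u *+ n) =1 P x.
    move=> y; apply/asboolP/asboolP => -[v e].
      by exists (v - u); rewrite mulrnBl addrA -e addrK.
    by exists (v + u); rewrite mulrnDl addrA -e.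
  rewrite /r (eq_choose PE); apply: choose_id => //.
  by apply/asboolP; exists (- u); rewrite mulNrn addrK.
have rr x : r (r x) = r x.
  by have [u e] := rP x; rewrite {2}e rD.
exists r, (undup [seq r c | c <- combos n l]); split=> //.
- exact: undup_uniq.
- move=> x; have [c cl [u ->]] := combos_dense x n0 sp.
  by rewrite rD mem_undup map_f.
- by move=> x; rewrite mem_undup => /mapP[c _ ->].
Qed.

(* A maximal subgroup avoiding [x] has torsion quotient: any [y] outside of it
   has a nonzero multiple congruent to [x], and likewise for [2x]. *)
Lemma infinitely_divisible_eq0 l x : spans l ->
  (forall n, (0 < n)%N -> exists u, x = u *+ n) -> x = 0.
Proof.
move=> sp dv; apply: contrapT => x0.
pose P (N : set X) := (forall a b, N a -> N b -> N (a - b)) /\ ~ N x.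
have [F FP Ftot|N [[NB Nx] Nmax]] := @Zorn_bigcup X P.
  split=> [a b [A FA Aa] [B FB Bb]|[A FA Ax]]; last exact: (FP _ FA).2.
  have [AB|BA] := Ftot _ _ FA FB.
    by exists B => //; apply: (FP _ FB).1 => //; exact: AB.
  by exists A => //; apply: (FP _ FA).1 => //; exact: BA.
(* The predicate [P] does not require 0, because the union of the empty chain must satisfy it;
   maximality supplies 0 here. *)
have N0 : N 0.
  apply: contrapT => N0; apply: (Nmax [set 0]).
    split=> [y Ny|sub]; first by exfalso; apply: N0; rewrite -(subrr y); exact: NB.
    by apply: N0; exact: sub.
  by split=> [a b -> ->|/= e]; [rewrite /= subrr|exact: x0].
have NN a : N a -> N (- a) by rewrite -sub0r; exact: NB.
have ND a b : N a -> N b -> N (a + b) by rewrite -{2}(opprK b) => Na /NN; exact: NB.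
have NMn a n : N a -> N (a *+ n).
  by move=> Na; elim: n => [|n IH]; [rewrite mulr0n|rewrite mulrS; exact: ND].
have NM a (k : int) : N a -> N (a *~ k).
  by case: k => n Na; [exact: NMn|rewrite NegzE mulrNz; exact/NN/NMn].
have hit y : ~ N y -> exists k : int, N (x - y *~ k).
  move=> Ny; pose B := [set b | exists k : int, N (b - y *~ k)].
  apply: contrapT => nx; apply: (Nmax B); last first.
    split=> // a b [k Na] [j Nb]; exists (k - j).
    rewrite /= mulrzBr opprB addrACA [- b + _]addrC addrACA -[X in _ + X]opprB.
    exact: NB.
  split=> [b Nb|sub]; first by exists 0; rewrite mulr0z subr0.
  by apply: Ny; apply: sub; exists 1; rewrite mulr1z subrr.
have [e e0 Ne] : exists2 e : nat, (0 < e)%N & forall y, N (y *+ e).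
  have tors y : exists2 e : nat, (0 < e)%N & N (y *+ e).
    suff [k k0 Nk] : exists2 k : int, k != 0 & N (y *~ k).
      exists `|k|%N; first by rewrite absz_gt0.
      by case: k k0 Nk => n n0 //; rewrite NegzE mulrNz => /NN; rewrite opprK.
    have [Ny|/hit[k Nk]] := pselect (N y); first by exists 1.
    have k0 : k != 0 by apply/eqP => k0; apply: Nx; rewrite k0 mulr0z subr0 in Nk.
    (* Since [k y] is congruent to [x], a nonzero multiple of [x] in [N] is enough. If [2 x] is not
       in [N], then [x] is congruent to [2 j x], and [2 j - 1] is nonzero because it is odd. *)
    have [N2|/hit[j Nj]] := pselect (N (x *+ 2)).
      exists (k * 2); first by rewrite mulf_neq0.
      have -> : y *~ (k * 2) = x *+ 2 - (x - y *~ k) *+ 2.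
        by rewrite mulrnBl opprB addrC subrK mulrzA.
      by apply: NB => //; exact: NMn.
    pose i : int := 2 * j - 1.
    have i0 : i != 0 by rewrite /i subr_eq0; apply/eqP => /(congr1 (fun i : int => odd `|i|%N)); rewrite abszM oddM.
    have Ni : N (x *~ i).
      have -> : x *~ i = - (x - x *+ 2 *~ j) by rewrite /i mulrzBr mulr1z opprB mulrzA.
      exact: NN.
    exists (k * i); first by rewrite mulf_neq0.
    have -> : y *~ (k * i) = x *~ i - (x - y *~ k) *~ i.
      by rewrite mulrzBl opprB addrC subrK mulrzA.
    by apply: NB => //; exact: NM.
  have [e e0 Ne] : exists2 e : nat, (0 < e)%N & forall y, y \in l -> N (y *+ e).
    elim: l {sp} => [|g l [e e0 Ne]]; first by exists 1%N.
    have [e' e0' Ng] := tors g; exists (e * e')%N; first by rewrite muln_gt0 e0.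
    move=> y; rewrite inE => /orP[/eqP->|yl]; last by rewrite mulrnA; exact/NMn/Ne.
    by rewrite mulnC mulrnA; exact: NMn.
  exists e => // y; apply: (sp (fun y => N (y *+ e))) => //; first by rewrite mul0rn.
  by move=> a b Na Nb; rewrite mulrnBl; exact: NB.
by have [u xu] := dv e e0; apply: Nx; rewrite xu.
Qed.

End FinitelyGeneratedAbelian.

Lemma uniq_map_injective (T : eqType) (f : T -> T) (s : seq T) :
  uniq (map f s) -> {in s &, injective f}.
Proof.
elim: s => //= a s IH /andP[fa us] x y; rewrite !inE.
case/orP => [/eqP->|xs]; case/orP => [/eqP->|ys] // e.
- by rewrite e map_f in fa.
- by rewrite -e map_f in fa.
- exact: IH.
Qed.

(* Counting modulo [n]: the surjection [X/n x Y/n -> Z/n] given by [i] and a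
   section of [q] is bijective, since both sides have the same finite size. *)
Lemma split_size_injective (X Y Z : zmodType) (lX : seq X) (lY : seq Y)
    (i : X -> Z) (q : Z -> Y) (p1 : Z -> X) (p2 : Z -> Y) :
  spans lX -> spans lY ->
  {morph i : a b / a - b} -> {morph q : a b / a - b} ->
  {morph p1 : a b / a - b} -> {morph p2 : a b / a - b} ->
  (forall y, exists z, q z = y) -> (forall z, q z = 0 -> exists x, i x = z) ->
  (forall x y, exists z, p1 z = x /\ p2 z = y) ->
  forall x, i x = 0 -> x = 0.
Proof.
move=> spX spY iB qB p1B p2B qs qk ps x ix.
have m0 (U V : zmodType) (h : U -> V) : {morph h : a b / a - b} -> h 0 = 0.
  by move=> hB; rewrite -(subrr 0) hB subrr.
have mN (U V : zmodType) (h : U -> V) : {morph h : a b / a - b} -> {morph h : a / - a}.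
  by move=> hB a; rewrite -sub0r hB (m0 _ _ _ hB) sub0r.
have mD (U V : zmodType) (h : U -> V) : {morph h : a b / a - b} -> {morph h : a b / a + b}.
  by move=> hB a b; rewrite -{1}(opprK b) hB (mN _ _ _ hB) opprK.
have mM (U V : zmodType) (h : U -> V) n : {morph h : a b / a - b} -> {morph h : a / a *+ n}.
  move=> hB a; elim: n => [|n IH]; first by rewrite !mulr0n (m0 _ _ _ hB).
  by rewrite !mulrS (mD _ _ _ hB) IH.
apply: (infinitely_divisible_eq0 spX) => n n0.
have [rX [sX [usX rXs rXP rXD rXid]]] := mod_reps n0 spX.
have [rY [sY [usY rYs rYP rYD rYid]]] := mod_reps n0 spY.
have /choice[sg sgP] := qs.
pose s := [seq (a, b) | a <- sX, b <- sY].
have us : uniq s by apply: allpairs_uniq => // -[a b] [a' b'].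
pose t (ab : X * Y) := i ab.1 + sg ab.2.
pose T ab := (rX (p1 (t ab)), rY (p2 (t ab))).
(* A preimage of [(a, b)]: take [z] with these components, subtract the section of the
   representative of [q z] and a multiple of [n]; the remainder is killed by [q], hence comes from
   [X]. *)
have Tsurj : {subset s <= map T s}.
  move=> _ /allpairsP[[a b] /= [as_ bs ->]]; have [z [za zb]] := ps a b.
  have [w ew] := rYP (q z); have [v vw] := qs w.
  have [a0 ea0] : exists a0, i a0 = z - sg (rY (q z)) - v *+ n.
    apply: qk; rewrite qB qB (mM _ _ _ _ qB) sgP vw [X in X - _ - _]ew.
    by rewrite addrAC addrK subrr.
  have [u eu] := rXP a0.
  have ez : z = t (rX a0, rY (q z)) + (i u + v) *+ n.
    rewrite /t /= mulrnDl -(mM _ _ _ _ iB) addrACA -(mD _ _ _ iB) -eu ea0.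
    by rewrite -[_ - _ - _]addrA -opprD subrK.
  set c := (rX a0, rY (q z)) in ez.
  apply/mapP; exists c; first by apply/allpairsP; exists (rX a0, rY (q z)); rewrite rXs rYs.
  rewrite /T -(rXD _ (p1 (i u + v))) -(rYD _ (p2 (i u + v))).
  rewrite -(mM _ _ _ _ p1B) -(mM _ _ _ _ p2B) -(mD _ _ _ p1B) -(mD _ _ _ p2B) -ez.
  by rewrite za zb rXid// rYid.
have sT : (size (map T s) <= size s)%N by rewrite size_map.
have Tinj := uniq_map_injective (leq_size_uniq us Tsurj sT).
(* As [i x = 0], both pairs have the same image modulo [n]; injectivity makes [x] congruent to 0. *)
have e : (rX x, rY 0) = (rX 0, rY 0).
  have ins a b : (rX a, rY b) \in s by apply/allpairsP; exists (rX a, rY b); rewrite rXs rYs.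
  apply: Tinj => //; have [u eu] := rXP x; have [v ev] := rXP 0.
  have h : t (rX 0, rY 0) = t (rX x, rY 0) + i (u - v) *+ n.
    rewrite /t /= addrAC; congr (_ + _); rewrite -(mM _ _ _ _ iB) -(mD _ _ _ iB).
    have -> : rX x + (u - v) *+ n = x - v *+ n by rewrite mulrnBl addrA -eu.
    rewrite iB ix (mM _ _ _ _ iB) sub0r.
    have : i (rX 0 + v *+ n) = 0 by rewrite -ev (m0 _ _ _ iB).
    by rewrite (mD _ _ _ iB) (mM _ _ _ _ iB) => /eqP; rewrite addr_eq0 => /eqP.
  by rewrite /T h (mD _ _ _ p1B) (mD _ _ _ p2B) (mM _ _ _ _ p1B) (mM _ _ _ _ p2B) rXD rYD.
have [u eu] := rXP x; have [v ev] := rXP 0; case: e => e.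
exists (u - v); rewrite mulrnBl; rewrite eu e.
have -> : rX 0 = - (v *+ n) by apply/eqP; rewrite -addr_eq0 -ev.
by rewrite addrC.
Qed.

(** * The abelianization of an extension *)

Section Quotients.
Local Open Scope group_scope.
Variable G : groupType.

Lemma quotient_lift (N : normalSubgroup G) (H : groupType) (h : G -> H) :
  {morph h : x y / x * y} -> (forall a, a \in N -> h a = 1) ->
  forall a, h (repr (quotient_proj N a)) = h a.
Proof.
move=> hM hN a; have /eq_coset/hN : quotient_proj N (repr (quotient_proj N a)) =
  quotient_proj N a by exact: reprK.
by rewrite hM (morphV hM) => /(congr1 (fun y => h (repr (quotient_proj N a)) * y)); rewrite mulVKg mulg1 => ->.
Qed.

Lemma quotient_liftM (N : normalSubgroup G) (H : groupType) (h : G -> H) :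
  {morph h : x y / x * y} -> (forall a, a \in N -> h a = 1) ->
  {morph (fun x : quotient_group N => h (repr x)) : x y / x * y}.
Proof. by move=> hM hN x y; rewrite -hM; exact: (quotient_lift hM hN). Qed.

Lemma commutators_with_eq1 (B : {pred G}) (H : groupType) (h : G -> H) :
  {morph h : x y / x * y} -> (forall g b, b \in B -> h [~ g, b] = 1) ->
  forall a, a \in commutators_with B -> h a = 1.
Proof.
move=> hM hB a; pose D : {pred G} := fun z => h z == 1.
suff /[apply] /eqP : {subset commutators_with B <= D} by [].
apply: generated_min => [|_ [g _ [b Bb <-]]]; last exact/eqP/hB.
split=> [|x y /eqP hx /eqP hy]; apply/eqP; first exact: morph1 hM.
by rewrite hM (morphV hM) hx hy mulgV.
Qed.

Lemma derived_eq1 (H : groupType) (h : G -> H) :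
  commutative ( *%g : H -> H -> H) -> {morph h : x y / x * y} ->
  forall a, a \in commutators_with [pred _ : G | true] -> h a = 1.
Proof.
move=> HC hM; apply: (commutators_with_eq1 hM) => g b _.
by rewrite /commg /conjg !hM !(morphV hM) (HC (h b)^-1) mulgK mulVg.
Qed.

Lemma commutators_with_derived (B : {pred G}) :
  {subset commutators_with B <= commutators_with [pred _ : G | true]}.
Proof.
apply: generated_min => [|x [g _ [b _ <-]]]; first exact: generated_group_closed.
by apply: mem_generated; exists g => //; exists b.
Qed.

Lemma derived_lift (N : normalSubgroup G) b :
  b \in commutators_with [pred _ : quotient_group N | true] ->
  exists2 d, d \in commutators_with [pred _ : G | true] & quotient_proj N d = b.
Proof.
pose D : {pred quotient_group N} := fun b => `[<
  exists2 d, d \in commutators_with [pred _ : G | true] & quotient_proj N d = b>].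
suff /[apply] /asboolP : {subset commutators_with [pred _ : quotient_group N | true] <= D} by [].
have pM := quotient_projM N.
apply: generated_min => [|_ [g _ [c _ <-]]].
  split=> [|x y /asboolP[u Du <-] /asboolP[v Dv <-]]; apply/asboolP.
    by exists 1; [exact: gpred1|exact: morph1 pM].
  by exists (u / v); [exact: gpredF|rewrite pM (morphV pM)].
apply/asboolP; exists [~ repr g, repr c].
  by apply: mem_generated; exists (repr g) => //; exists (repr c).
rewrite /commg /conjg !pM !(morphV pM); congr (_^-1 * (_^-1 * (_ * _))); exact: reprK.
Qed.

Lemma spans_generated (D : {pred G}) (s : seq G) (K : zmodType) (h : G -> K) :
  D =i generated [set` s] -> {in D &, forall x y, h (x / y) = (h x - h y)%R} ->
  (forall k, exists2 g, g \in D & h g = k) -> spans (map h s).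
Proof.
move=> Ds hB hs P P0 PB Ps k; have [g Dg <-] := hs k.
have D1 : 1 \in D by rewrite Ds gpred1.
have h0 : h 1 = 0%R by rewrite -(mulgV 1) hB// subrr.
pose E : {pred G} := fun x => (x \in D) && `[< P (h x) >].
suff /(_ g) : {subset generated [set` s] <= E}.
  by rewrite -Ds => /(_ Dg)/andP[_ /asboolP].
apply: generated_min => [|x /= xs]; last first.
  rewrite unfold_in Ds mem_generated//=; apply/asboolP/Ps; exact: map_f.
split=> [|x y /andP[Dx /asboolP Px] /andP[Dy /asboolP Py]]; rewrite unfold_in.
  by rewrite D1 h0; exact/asboolP.
rewrite hB//; apply/andP; split; last exact/asboolP/PB.
by move: Dx Dy; rewrite !Ds; exact: gpredF.
Qed.

End Quotients.

Section SplitAbelianization.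
Local Open Scope group_scope.
Variables (G : groupType) (N : normalSubgroup G).
Hypothesis N_comm : {in N &, commutative *%g}.

Local Notation beta := (quotient_group N).
Local Notation proj := (quotient_proj N).
Local Notation M := (coinvariants N).
Local Notation ab := (quotient_proj (commutators_with [pred _ : _ | true])).

Definition coinv (a : G) : M :=
  quotient_proj (Defs.restrict N (commutators_with N)) (insubd (1 : subgroup N) a).

Lemma coinvM : {in N &, {morph coinv : a b / a * b}}.
Proof.
move=> a b Na Nb; rewrite /coinv -quotient_projM; congr (quotient_proj _ _).
by apply: val_inj => /=; rewrite !insubdK// gpredM.
Qed.

Lemma coinv1 : coinv 1 = 1.
Proof. by apply: (mulgI (coinv 1)); rewrite -coinvM ?gpred1// !mulg1. Qed.

Lemma coinvV : {in N, {morph coinv : a / a^-1}}.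
Proof.
by move=> a Na; apply/esym/mulg1_eq; rewrite -coinvM ?gpredV// mulgV coinv1.
Qed.

Lemma coinv_surj x : exists2 a, a \in N & coinv a = x.
Proof.
exists (val (repr x)); first exact: valP.
by rewrite /coinv valKd; exact: reprK.
Qed.

Lemma coinv_eq1 a : a \in N -> (coinv a = 1) <-> a \in commutators_with N.
Proof.
move=> Na; have -> : (coinv a = 1) <-> (1 = coinv a) by split.
by rewrite eq_coset invg1 mul1g -[in X in _ <-> X](insubdK (1 : subgroup N) Na).
Qed.

Lemma coinvJ a g : a \in N -> coinv (a ^ g) = coinv a.
Proof.
move=> Na; have Ng : [~ a, g] \in N by rewrite gpredM ?gpredV// gpredJr.
rewrite -(mulVKg a (a ^ g)) coinvM// (_ : coinv [~ a, g] = 1) ?mulg1//.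
apply/(coinv_eq1 Ng); rewrite -gpredV invgR.
by apply: mem_generated; exists g => //; exists a.
Qed.

Lemma coinv_comm : commutative ( *%g : M -> M -> M).
Proof.
move=> x y; have [a Na <-] := coinv_surj x; have [b Nb <-] := coinv_surj y.
by rewrite -!coinvM// N_comm.
Qed.

Definition incl_ab (x : M) : abelianization G := ab (val (repr x)).
Definition proj_ab (z : abelianization G) : abelianization beta := ab (proj (repr z)).

Let ab_valM : {morph (fun a : subgroup N => ab (val a) : abelianization G) : a b / a * b}.
Proof. by move=> a b; exact: quotient_projM. Qed.

Let ab_val1 a : a \in Defs.restrict N (commutators_with N) ->
  ab (val a) = 1 :> abelianization G.
Proof.
move=> /commutators_with_derived Da; apply/esym/eq_coset.
by rewrite invg1 mul1g.
Qed.

Lemma incl_ab_coinv a : a \in N -> incl_ab (coinv a) = ab a.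
Proof.
by move=> Na; rewrite /incl_ab /coinv (quotient_lift ab_valM ab_val1) insubdK.
Qed.

Lemma incl_abM : {morph incl_ab : x y / x * y}.
Proof. exact: quotient_liftM ab_valM ab_val1. Qed.

Let ab_projM : {morph (fun g : G => ab (proj g) : abelianization beta) : x y / x * y}.
Proof. by move=> x y; rewrite !quotient_projM. Qed.

Let ab_proj1 := derived_eq1 (@abelianization_comm beta) ab_projM.

Lemma proj_ab_ab g : proj_ab (ab g) = ab (proj g).
Proof. exact: (quotient_lift ab_projM ab_proj1). Qed.

Lemma proj_abM : {morph proj_ab : x y / x * y}.
Proof. exact: quotient_liftM ab_projM ab_proj1. Qed.

Lemma ab_surj (H : groupType) (z : abelianization H) : exists g, ab g = z.
Proof. by exists (repr z); exact: reprK. Qed.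

Lemma proj_ab_surj y : exists z, proj_ab z = y.
Proof.
have [b <-] := ab_surj y; exists (ab (repr b)).
by rewrite proj_ab_ab; congr (quotient_proj _ _); exact: reprK.
Qed.

(** Exactness in the middle: if [proj g] is a product of commutators, it lifts to some [d] in the
    derived subgroup, and [d^-1 * g] lies in [N] with the same class as [g]. *)
Lemma proj_ab_eq1 z : proj_ab z = 1 -> exists x, incl_ab x = z.
Proof.
have [g <-] := ab_surj z; rewrite proj_ab_ab => /esym/eq_coset.
rewrite invg1 mul1g => /derived_lift[d Dd /eq_coset Ndg]; exists (coinv (d^-1 * g)).
rewrite incl_ab_coinv//; apply/eq_coset.
have -> : (d^-1 * g)^-1 * g = d ^ g by rewrite invgM invgK -mulgA.
exact: gpredJr.
Qed.

(** The isomorphism enters only through the joint surjectivity of its two components; exactness of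
    coinvariants, abelianization and quotient then lets the counting show that [incl_ab] has trivial
    kernel. *)
Lemma derived_coinvariants (s : seq beta) :
  finitely_generated N -> (forall d, d \in generated [set` s]) ->
  isomorphic (abelianization G) (M * abelianization beta)%type ->
  forall a, a \in N -> a \in commutators_with [pred _ : G | true] ->
    a \in commutators_with N.
Proof.
move=> [t Nt] gs [f [finv fK Kf]] a Na Da.
pose X := additive_of coinv_comm; pose Y := additive_of (@abelianization_comm beta).
pose Z := additive_of (@abelianization_comm G).
have div (H K : groupType) (h : H -> K) : {morph h : x y / x * y} ->
    {morph h : x y / x / y} by move=> hM x y; rewrite hM (morphV hM).
have spX : spans (map (coinv : G -> X) t).
  apply: (spans_generated Nt); last exact: coinv_surj.
  by move=> x y Nx Ny; rewrite coinvM ?gpredV// coinvV.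
have spY : spans (map (ab : beta -> Y) s).
  apply: (spans_generated (D := [pred _ | true])) => [d|x y _ _|k].
  - by rewrite gs.
  - exact: (div _ _ _ (quotient_projM _)).
  - by have [d <-] := ab_surj k; exists d.
have fM : {morph f : x y / x * y} by exact: gmulfM.
pose p1 z := (f z).1; pose p2 z := (f z).2.
have p1M : {morph p1 : x y / x * y} by move=> x y; rewrite /p1 fM.
have p2M : {morph p2 : x y / x * y} by move=> x y; rewrite /p2 fM.
apply/(coinv_eq1 Na).
apply: (@split_size_injective X Y Z _ _ incl_ab proj_ab p1 p2 spX spY
  (div _ _ _ incl_abM) (div _ _ _ proj_abM) (div _ _ _ p1M) (div _ _ _ p2M)
  proj_ab_surj proj_ab_eq1) => [x y|].
  by exists (finv (x, y)); rewrite /p1 /p2 Kf.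
rewrite incl_ab_coinv//; apply/esym/eq_coset.
by rewrite invg1 mul1g.
Qed.

(** * From a section to the splitting of the abelianization *)

Section FromSection.
Variable s : beta -> G.
Hypotheses (sM : {morph s : x y / x * y}) (sK : cancel s proj).

(** The [N]-component of [g] in the semidirect product decomposition given by [s]. *)
Let r g := g * (s (proj g))^-1.

Let rN g : r g \in N.
Proof.
have /eq_coset : proj 1 = proj (r g).
  by rewrite /r !quotient_projM (morphV (quotient_projM N)) sK mulgV (morph1 (quotient_projM N)).
by rewrite invg1 mul1g.
Qed.

Let c g := coinv (r g).

(** [r] is a crossed morphism, [r (x * y) = (r y ^ x^-1) * r x], and the conjugation is invisible in
    the coinvariants. The resulting morphism retracts [incl_ab]. *)
Let cM : {morph c : x y / x * y}.
Proof.
move=> x y; have -> : c (x * y) = coinv (r y ^ x^-1 * r x).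
  congr coinv; rewrite /r quotient_projM sM invgM /conjg invgK.
  by rewrite !mulgA mulgVK.
by rewrite coinvM ?gpredJr ?rN// coinvJ ?rN// coinv_comm.
Qed.

Let c1 := derived_eq1 coinv_comm cM.

Lemma split_abelianization :
  isomorphic (abelianization G) (M * abelianization beta)%type.
Proof.
pose F (z : abelianization G) : (M * abelianization beta)%type := (c (repr z), proj_ab z).
have FM : {morph F : x y / x * y}.
  by move=> x y; rewrite /F (quotient_liftM cM c1) proj_abM.
pose Fm : {multiplicative abelianization G -> (M * abelianization beta)%type} :=
  HB.pack F (isMultiplicative.Build _ _ F FM).
pose S (y : abelianization beta) := ab (s (repr y)) : abelianization G.
have sabM : {morph (fun b => ab (s b) : abelianization G) : x y / x * y}.
  by move=> x y; rewrite sM quotient_projM.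
have SE b : S (ab b) = ab (s b).
  exact: (quotient_lift sabM (derived_eq1 (@abelianization_comm G) sabM)).
exists Fm; exists (fun p => incl_ab p.1 * S p.2) => [z|[x y]] /=.
  have [g <-] := ab_surj z.
  rewrite (quotient_lift cM c1) proj_ab_ab SE incl_ab_coinv// -quotient_projM.
  by rewrite mulgVK.
have [a Na <-] := coinv_surj x; have [b <-] := ab_surj y.
rewrite SE incl_ab_coinv// -quotient_projM /F (quotient_lift cM c1) proj_ab_ab.
have pa : proj a = 1 by apply/esym/eq_coset; rewrite invg1 mul1g.
by rewrite /c /r quotient_projM sK pa mul1g mulgK.
Qed.

End FromSection.

End SplitAbelianization.

(** * Surface groups: from a flat lift to a section *)

Lemma flat_map (H K : groupType) (S : topologicalType) (F : H -> K)
    (f : S -> S -> H) z :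
  {morph F : x y / (x * y)%g} -> flat f z -> flat (fun x y => F (f x y)) z.
Proof.
by move=> FM [W Wz Wf]; exists W => // x y w Wx Wy Ww; rewrite -FM Wf.
Qed.

Lemma holonomy_map (R : realType) (H K : groupType) (S : topologicalType)
    (F : H -> K) (f : S -> S -> H) (a b : S) (p : path R a b) m :
  {morph F : x y / (x * y)%g} -> holonomy f p m ->
  holonomy (fun x y => F (f x y)) p (F m).
Proof.
move=> FM [v fv <-]; exists (F \o v) => [z zI|]; last by rewrite /= FM (morphV FM).
have [W Wz Wf] := fv z zI; exists W => // x y Wx Xx Wy Xy.
by rewrite (Wf x y)// FM (morphV FM).
Qed.

(** The cochain of short paths, carried to the quotient by the isomorphism, has as holonomy the
    identity. The holonomy of a flat lift is a morphism to [G], and it projects to the holonomy of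
    the cochain lifted, hence is a section. *)
Lemma surface_group_section (R : realType) (G : groupType) (N : normalSubgroup G) :
  {in N &, commutative *%g}%g -> PD2plus_group R (quotient_group N) ->
  (exists s : seq (quotient_group N), forall d, d \in generated [set` s]) /\
  ((forall a, a \in N -> a \in commutators_with [pred _ : G | true] ->
      a \in commutators_with N) ->
   exists s : {multiplicative quotient_group N -> G}, cancel s (quotient_proj N)).
Proof.
move=> N_comm [S [x0 [[hS _ cS _] connS [A atlas oriented] _ [phi [psi phiK psiK]]]]].
have phiM : {morph phi : x y / (x * y)%g} by exact: gmulfM.
have psiM : {morph psi : x y / (x * y)%g}.
  by move=> x y; apply: (can_inj phiK); rewrite phiM !psiK.
have [c [cflat chol]] := cover_cochain atlas hS cS connS x0.
pose g x y := psi (c x y).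
have gflat z : flat g z by apply: flat_map.
have ghol (p : path R x0 x0) : holonomy g p (psi (loop_class p)).
  by apply: holonomy_map => //; exact: chol.
have hol d : exists p : path R x0 x0, loop_class p = phi d.
  by exists (path_of (repr (phi d))); rewrite path_ofK reprK.
split.
  have [s sP] := holonomy_finitely_generated atlas hS cS x0 gflat.
  by exists s => d; have [p pd] := hol d; apply: (sP p); rewrite -(phiK d) -pd.
move=> inj; have gW : forall z : S, exists W, nbhs z W /\
    forall x y w, W x -> W y -> W w -> (g x y * g y w)%g = g x w.
  by move=> z; have [W] := gflat z; exists W.
have [W WP] := choice gW.
have [d|f [lf ff]] := flat_lift N_comm atlas oriented hS cS connS
    (fun z => (WP z).1) (fun z => (WP z).2) (x0 := x0) _ inj.
  by have [p pd] := hol d; exists p; rewrite -(phiK d) -pd; exact: ghol.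
have [h hM hh] := holonomy_morphism R x0 ff.
pose s d := h (phi d).
have sM : {morph s : x y / (x * y)%g} by move=> x y; rewrite /s phiM hM.
exists (HB.pack_for {multiplicative quotient_group N -> G} s
  (isMultiplicative.Build _ _ s sM)) => d /=.
have [p pd] := hol d; have := ghol p; rewrite pd phiK => gd.
have fg : (fun x y => quotient_proj N (f x y)) = g.
  by apply/funext => x; apply/funext => y; exact: lf.
by apply: holonomy_uniq gd; rewrite -fg /s -pd; exact: holonomy_map (quotient_projM N) (hh p).
Qed.

Local Open Scope group_scope.

Theorem lemma2 (R : realType) (G : groupType) (A : normalSubgroup G)
    (A_abelian : {in A &, commutative *%g})
    (A_fg : finitely_generated A)
    (beta_PD2 : PD2plus_group R (quotient_group A)) :
  (exists s : {multiplicative quotient_group A -> G},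
     cancel s (quotient_proj A))
  <->
  isomorphic (abelianization G)
    (coinvariants A * abelianization (quotient_group A))%type.
Proof.
have [[t gt] sec] := surface_group_section A_abelian beta_PD2.
split=> [[s sK]|iso]; first by apply: split_abelianization sK => //; exact: gmulfM.
exact/sec/(derived_coinvariants A_abelian A_fg gt iso).
Qed.
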